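(* Let $X^L(x,y)=X^L(x,y;\eta)$ and $X^R(x,y)=X^R(x,y;\eta)$ be smooth vector fields on $\mathbb R^2$ depending smoothly on a parameter $\eta\in\mathbb R$, let $\phi$ be a sigmoidal function satisfying the assumptions in the context, and for $\varepsilon>0$ let $$X_\varepsilon(x,y)=X^L(x,y)\bigl(1-\phi(\varepsilon^{-1}(x-1))\bigr)+X^R(x,y)\,\phi(\varepsilon^{-1}(x-1)).$$ Suppose that conditions (i)–(v) listed in the context hold with $\eta^L=0$, and let $\Gamma_0=\Gamma_0^L\cup\Gamma_0^R$ be the closed curve defined there. Then for any $c>0$ there exists a closed interval $I\subset(0,\eta_0]$, with $\eta_0>0$ sufficiently small, such that the following holds: there exists $\varepsilon_0>0$ such that $X_\varepsilon$, for all $\varepsilon\in(0,\varepsilon_0]$ and any $\eta\in I$, has an attracting limit cycle $\Gamma_\varepsilon$ which is closer to $\Gamma_0$ than $c$ in Hausdorff distance.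
   Context: Assumptions on $\phi$: $\phi:\mathbb R\to\mathbb R$ is smooth with $\phi(z)\in(0,1)$ and $\phi'(z)>0$ for all $z$, $\phi(z)\to1$ as $z\to\infty$, $\phi(z)\to0$ as $z\to-\infty$. There exist $k\in\mathbb N$ (positive) and smooth $\phi^L,\phi^R:[0,\infty)\to[0,\infty)$ with $\phi^{L}(0),\phi^R(0)>0$ such that $\phi(z)=(-z)^{-k}\phi^L((-z)^{-1})$ for $z<0$ and $\phi(z)=1-z^{-k}\phi^R(z^{-1})$ for $z>0$. Write $X^{L}=(X^{L}_1,X^{L}_2)$, $X^{R}=(X^{R}_1,X^{R}_2)$. The line $x=1$ is the switching manifold. A point of $x=1$ is a crossing point if $X^L_1$ and $X^R_1$ are nonzero with the same sign there. A point with $X^L_1<0<X^R_1$ is a point of repelling sliding; there the Filippov sliding flow is $\dot y=s(y)$ with $s=(X^R_1X^L_2-X^L_1X^R_2)/(X^R_1-X^L_1)$ evaluated at $(1,y)$. Conditions (normalised so that $\eta^L=0$): (i) A proper stable node $z^L=z^L(\eta)$ of $X^L$ (two distinct negative real eigenvalues; the eigenvalue closest to $0$ and its eigenspace are called weak) intersects the line $x=1$ transversally under variation of $\eta$ at $\eta=\eta^L=0$, in the point $p^L=(1,y^L)$ (i.e. $z^L(0)=p^L$ and the $x$-coordinate of $z^L(\eta)$ has nonzero derivative at $\eta=0$), in such a way that there are no equilibria of $X^L|_{x<1}$ near $p^L$ for $\eta>0$ small. (ii) For $\eta=0$ the weak eigenspace of $z^L$ is not parallel to the line $x=1$. (iii)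 For $\eta=0$ the local piecewise smooth system near $p^L$ is of the following generic boundary-node type: $X_1^R(p^L)>0$, $\partial_yX_1^L(p^L)>0$ (so that points $(1,y)$ with $y$ close to $y^L$ are of repelling sliding type for $y<y^L$ and crossing for $y>y^L$), and the Filippov sliding flow on the repelling sliding segment $y<y^L$ is directed away from the node $p^L$, nondegenerately: the smooth function $s$ satisfies $s(y^L)=0$, $s'(y^L)>0$. (This sliding flow agrees with the slow flow on the repelling critical manifold obtained by the blow-up $x=1+\varepsilon x_2$ of $X_\varepsilon$.) (iv) For $\eta=0$, the forward orbit $\Gamma_0^R$ of $p^L$ under the flow of $X^R|_{x\ge1}$ has a first return to $x=1$, in finite time, at a point $q^R$ that is a regular crossing point for the piecewise smooth system given by $X^L|_{x<1}$ and $X^R|_{x>1}$. (v) For $\eta=0$, the forward orbit $\Gamma_0^L$ of $q^R$ under the flow of $X^L|_{x\le1}$ approaches $z^L=p^L$ as $t\to\infty$ along the weak eigendirection of $z^L$. A limit cycle is an isolated (nonconstant) periodic orbit.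
   Formalization: In (v) the orbit Γ_0^L is assumed to lie in x<1 after leaving q^R, so it does not touch the line x=1 tangentially; if such grazing is allowed, the claim fails in general, since for η>0 nearby orbits can cross into x>1 and escape. *)

(* Defs.v *)
(* Points of the plane are row vectors
   p : 'rV[R]_2 with coordinates p 0 0 (that is, x) and p 0 1 (that is, y). *)
From HB Require Import structures.
From mathcomp Require Import all_boot all_order all_algebra.
From mathcomp Require Import all_classical all_reals all_analysis.

Set Implicit Arguments.
Unset Strict Implicit.
Unset Printing Implicit Defensive.

Import Order.TTheory GRing.Theory Num.Theory numFieldNormedType.Exports.

Local Open Scope classical_set_scope.
Local Open Scope ring_scope.

Section smoothness.
Context {R : realType}.

(* For finite-dimensional V, having all directional derivatives of class C^k
   is the same as having a derivative x |-> 'd f x of class C^k. *)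
Fixpoint class_C (n : nat) (V W : normedModType R) (f : V -> W) : Prop :=
  match n with
  | 0 => continuous f
  | k.+1 => (forall x, differentiable f x) /\
            (forall v, class_C k (fun x => 'D_v f x))
  end.

Definition smooth (V W : normedModType R) (f : V -> W) : Prop :=
  forall n, class_C n f.

(* Smoothness on [0, +oo[ up to the boundary point, as the existence of a
   smooth extension. *)
Definition smooth_halfline (f : R -> R) : Prop :=
  exists2 g : R -> R, smooth g & forall x, 0 <= x -> f x = g x.

End smoothness.

Section sigmoidal.
Context {R : realType}.

Record sigmoidal (phi : R -> R) : Prop := Sigmoidal {
  sigmoidal_smooth : smooth phi;
  sigmoidal_range : forall z, 0 < phi z < 1;
  sigmoidal_increasing : forall z, 0 < derive1 phi z;
  sigmoidal_right : phi z @[z --> +oo] --> (1 : R);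
  sigmoidal_left : phi z @[z --> -oo] --> (0 : R);
  sigmoidal_tails : exists (k : nat) (phiL phiR : R -> R),
    [/\ (0 < k)%N,
        smooth_halfline phiL /\ smooth_halfline phiR,
        (forall z : R, 0 <= z -> 0 <= phiL z /\ 0 <= phiR z),
        0 < phiL 0 /\ 0 < phiR 0 &
        (forall z : R, z < 0 -> phi z = (- z) ^- k * phiL (- z)^-1) /\
        (forall z : R, 0 < z -> phi z = 1 - z ^- k * phiR z^-1)] }.

End sigmoidal.

Section planar_vector_fields.
Context {R : realType}.
Implicit Types (X : 'rV[R]_2 -> 'rV[R]_2) (p q z : 'rV[R]_2).
Implicit Types (A B G : set 'rV[R]_2) (c : R -> 'rV[R]_2).

Definition vec2 (x y : R) : 'rV[R]_2 := \row_j [:: x; y]`_j.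

(* The norm of the library on 'rV[R]_2 is the sup norm. *)
Definition eucl_dist p q : R :=
  Num.sqrt ((p 0 0 - q 0 0) ^+ 2 + (p 0 1 - q 0 1) ^+ 2).

Definition hausdorff_dist A B : \bar R :=
  maxe (ereal_sup [set ereal_inf [set (eucl_dist a b)%:E | b in B] | a in A])
       (ereal_sup [set ereal_inf [set (eucl_dist a b)%:E | a in A] | b in B]).

Definition thickening A (r : R) : set 'rV[R]_2 :=
  [set p | exists2 a, A a & eucl_dist p a < r].

(* On a closed interval I, continuity on I together with the differential
   equation in the interior is the usual notion of solution on I (one-sided
   derivatives at the end points). *)
Definition solution_on X (I : set R) c : Prop :=
  {within I, continuous c} /\
  (forall t, interior I t -> is_derive t 1 c (X (c t))).

(* The library's jacobian and eigenspaces are both relative to the action on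
   row vectors, v |-> v *m 'J X z = 'D_v X z, so they match. *)
Definition proper_stable_node X z : Prop :=
  X z = 0 /\
  (exists l1 l2 : R, [/\ l1 < l2, l2 < 0,
     eigenvalue (jacobian X z) l1 & eigenvalue (jacobian X z) l2]).

Definition weak_eigenvalue X z (l : R) : Prop :=
  eigenvalue (jacobian X z) l /\
  (forall m, eigenvalue (jacobian X z) m -> `|l| <= `|m|).

Definition approaches_along_weak_direction X z c : Prop :=
  [/\ c t @[t --> +oo] --> z,
      \forall t \near +oo, c t != z &
      exists (l : R) (v : 'rV[R]_2),
        [/\ weak_eigenvalue X z l, v != 0,
            (v <= eigenspace (jacobian X z) l)%MS &
            `|c t - z|^-1 *: (c t - z) @[t --> +oo] --> v]].

Definition crossing_point (XL XR : 'rV[R]_2 -> 'rV[R]_2) p : Prop :=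
  p 0 0 = 1 /\ 0 < XL p 0 0 * XR p 0 0.

(* The y-component of the convex combination of XL and XR tangent to x = 1. *)
Definition sliding (XL XR : 'rV[R]_2 -> 'rV[R]_2) (y : R) : R :=
  let p := vec2 1 y in
  (XR p 0 0 * XL p 0 1 - XL p 0 0 * XR p 0 1) / (XR p 0 0 - XL p 0 0).

Definition regularization (phi : R -> R) (XL XR : 'rV[R]_2 -> 'rV[R]_2)
    (eps : R) p : 'rV[R]_2 :=
  (1 - phi (eps^-1 * (p 0 0 - 1))) *: XL p + phi (eps^-1 * (p 0 0 - 1)) *: XR p.

Definition periodic_orbit X G : Prop :=
  exists c (T : R),
    [/\ solution_on X setT c, 0 < T, (forall t, c (t + T) = c t),
        (exists t, c t != c 0) & G = range c].

Definition limit_cycle X G : Prop :=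
  periodic_orbit X G /\
  (exists2 r : R, 0 < r &
     forall G', periodic_orbit X G' -> G' `<=` thickening G r -> G' = G).

(* Asymptotic orbital stability.  For the smooth fields considered the forward
   solution from p is unique, so the existential on c is harmless. *)
Definition attracting X G : Prop :=
  forall r : R, 0 < r -> exists2 d : R, 0 < d &
    forall p, thickening G d p -> exists c,
      [/\ solution_on X `[0, +oo[ c, c 0 = p,
          (forall t : R, 0 <= t -> thickening G r (c t)) &
          (forall e : R, 0 < e -> \forall t \near +oo, thickening G e (c t))].

End planar_vector_fields.

(* Main.v *)
(* For small eta > 0 the node of XL lies at distance of order eta to the right
   of x = 1, so near p^L both fields point to the right.  Fix eta in
   [eta0 / 2, eta0] and consider the orbits that start on x = 1 + delta near
   p^L.  They follow XR to a neighbourhood of q^R, cross the layer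
   |x - 1| <= delta, follow XL towards its virtual node and are therefore
   brought back to x = 1 - delta, which they reach along the weak direction,
   with XL_1 of order eta, and cross the layer once more.  The passage close to
   the node contracts by any prescribed factor if eta0 is small.  The passages
   through the layer expand by at most e if delta is small compared with eta,
   uniformly in eps: there the slope dy/dx is bounded and Lipschitz in y,
   because a convex combination of XL and XR is never small compared with eta.
   So the return map is a contraction, and its fixed point is an attracting,
   isolated periodic orbit that follows Gamma_0.
   All estimates compare two orbits directly, by Gronwall's lemma and, at the
   node, by a quadratic Lyapunov function for their difference, so no
   differentiability of flows is needed.  The fields are made globally bounded
   and Lipschitz by clamping their arguments to a large square. *)
Require Import Defs.
From HB Require Import structures.
From mathcomp Require Import all_boot all_order all_algebra.
From mathcomp Require Import all_classical all_reals all_analysis.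
From mathcomp Require Import ring lra.

Set Implicit Arguments.
Unset Strict Implicit.
Unset Printing Implicit Defensive.

Import Order.TTheory GRing.Theory Num.Theory numFieldNormedType.Exports.

Local Open Scope classical_set_scope.
Local Open Scope ring_scope.

(** * Calculus on the line *)

(** Near p^L the speed of [XL] is only of order [eta], so deviations there have to be small relative
    to [eta], and the sections have width [A * eta]. A circularity threatens: the size [C0 * eta] of
    the arrivals near the node fixes the width [A * eta], while the time needed near the node
    depends on that width and on the contraction factor wanted. It is broken because [C0], [c1],
    [S1] are obtained before [A] and [theta]: after a long time the initial deviation is forgotten,
    and only the incoming orbit and the displacement of the node matter. The order of choice is
    therefore: [C0] and the slope bounds, then [A], then [theta] (from e * theta * e * K <= 1/2,
    with K the expansion along [XR]), then the range of [eta], its lower bound [a], the layer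
    [delta] with the tolerance [sigma], and last [eps]. Inside the layer the x-derivative of the
    field is of order 1/eps, and comparing two orbits at equal times would lose all uniformity;
    comparing them at equal x never differentiates [phi]. *)

Section calculus.
Context {R : realType}.
Implicit Types (f df g V : R -> R) (a b : R).

Lemma eq_ler (r s : R) : r = s -> r <= s.
Proof. by move=> ->. Qed.

Lemma within_contD (A : set R) f g : {within A, continuous f} ->
  {within A, continuous g} -> {within A, continuous (fun t => f t + g t)}.
Proof. by move=> cf cg x; apply: cvgD; [exact: cf|exact: cg]. Qed.

Lemma within_contB (A : set R) f g : {within A, continuous f} ->
  {within A, continuous g} -> {within A, continuous (fun t => f t - g t)}.
Proof. by move=> cf cg x; apply: cvgB; [exact: cf|exact: cg]. Qed.

Lemma within_contM (A : set R) f g : {within A, continuous f} ->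
  {within A, continuous g} -> {within A, continuous (fun t => f t * g t)}.
Proof. by move=> cf cg x; apply: cvgM; [exact: cf|exact: cg]. Qed.

Lemma within_cst (A : set R) (k : R) : {within A, continuous (fun=> k)}.
Proof. by apply: continuous_subspaceT => x; exact: cvg_cst. Qed.

Lemma is_derive_within f df a b :
  (forall t : R, is_derive t (1:R) f (df t)) -> {within `[a, b], continuous f}.
Proof.
move=> H; apply: derivable_within_continuous => x _.
by have [] := H x.
Qed.

Lemma is_derive_continuous f df : (forall t : R, is_derive t (1:R) f (df t)) -> continuous f.
Proof.
by move=> H t; apply/differentiable_continuous/derivable1_diffP; case: (H t).
Qed.

Lemma der_ge f df a b m : a <= b ->
  (forall t : R, a < t < b -> is_derive t (1:R) f (df t)) ->
  {within `[a, b], continuous f} ->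
  (forall t : R, a < t < b -> m <= df t) -> m * (b - a) <= f b - f a.
Proof.
rewrite le_eqVlt => /orP[/eqP <- *|ab fD fC mdf]; first by rewrite !subrr mulr0.
have fD' x : x \in `]a, b[ -> is_derive x (1:R) f (df x) by rewrite in_itv; exact: fD.
have [c + ->] := MVT ab fD' fC.
by rewrite in_itv => /mdf H; rewrite ler_wpM2r// subr_ge0 ltW.
Qed.

Lemma der_le f df a b m : a <= b ->
  (forall t : R, a < t < b -> is_derive t (1:R) f (df t)) ->
  {within `[a, b], continuous f} ->
  (forall t : R, a < t < b -> df t <= m) -> f b - f a <= m * (b - a).
Proof.
rewrite le_eqVlt => /orP[/eqP <- *|ab fD fC mdf]; first by rewrite !subrr mulr0.
have fD' x : x \in `]a, b[ -> is_derive x (1:R) f (df x) by rewrite in_itv; exact: fD.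
have [c + ->] := MVT ab fD' fC.
by rewrite in_itv => /mdf H; rewrite ler_wpM2r// subr_ge0 ltW.
Qed.

(** The function (V + m/k) e^(-k(t-a)) is nonincreasing. [k] may have either sign: positive in
    growth estimates, negative for the decay towards the node. *)
Lemma linear_gronwall V dV k m a b : a <= b -> k != 0 ->
  (forall t : R, a < t < b -> is_derive t (1:R) V (dV t)) ->
  {within `[a, b], continuous V} ->
  (forall t : R, a < t < b -> dV t <= k * V t + m) ->
  V b + m / k <= (V a + m / k) * expR (k * (b - a)).
Proof.
move=> ab k0 VD VC VH.
pose W t := (V t + m / k) * expR (- k * (t - a)).
have WD t : a < t < b -> is_derive t (1:R) W ((dV t - k * (V t + m / k)) * expR (- k * (t - a))).
  move=> /VD {}VD; apply: is_derive_eq; rewrite /GRing.scale/=; ring.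
have WC : {within `[a, b], continuous W}.
  apply: within_contM; first by apply: within_contD => //; exact: within_cst.
  apply: (is_derive_within (df := fun t => expR (- k * (t - a)) * - k)) => t.
  by apply: is_derive_eq; rewrite /GRing.scale/=; ring.
have : W b - W a <= 0 * (b - a).
  apply: der_le WD WC _ => // t atb.
  rewrite mulr_le0_ge0 ?expR_ge0// subr_le0 (le_trans (VH _ atb))//.
  by rewrite mulrDr [k * (_ / _)]mulrC divfK.
rewrite mul0r subr_le0 /W subrr mulr0 expR0 mulr1 => H.
have -> : V b + m / k = (V b + m / k) * expR (- k * (b - a)) * expR (k * (b - a)).
  by rewrite -mulrA -expRD mulNr addNr expR0 mulr1.
by rewrite ler_wpM2r ?expR_ge0.
Qed.

Lemma within_eps f a b t e : {within `[a, b], continuous f} -> a <= t <= b ->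
  0 < e -> exists2 d, 0 < d &
  forall s, a <= s <= b -> `|s - t| < d -> `|f s - f t| < e.
Proof.
move=> fC tab e0; have tA : `[a, b]%classic t by rewrite /= in_itv.
have /subspace_continuousP/(_ t tA)/cvgrPdist_lt/(_ e e0) := fC.
rewrite near_withinE => -[d /= d0 He].
exists d => // s sab st; have := He s; rewrite /= distrC => /(_ st).
by rewrite in_itv distrC => /(_ sab).
Qed.

Lemma continuous_eps f t e : continuous f -> 0 < e -> exists2 d, 0 < d &
  forall s, `|s - t| < d -> `|f s - f t| < e.
Proof.
move=> fC e0; have /cvgrPdist_lt/(_ e e0) [d /= d0 H] := fC t.
by exists d => // s st; rewrite distrC; apply: H; rewrite /= distrC.
Qed.

(** Bootstrap principle: at the infimum of the times where [r <= V] the hypothesis gives [V < r],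
    which persists nearby by continuity, so there are no such times. It lets an estimate valid only
    inside a ball prove that an orbit never leaves that ball. *)
Lemma continuity_method V a b r : a <= b -> {within `[a, b], continuous V} ->
  (forall t, a <= t <= b -> (forall s, a <= s < t -> V s < r) -> V t < r) ->
  forall t, a <= t <= b -> V t < r.
Proof.
move=> ab VC VH t tab; rewrite ltNge; apply/negP => rVt.
pose S := [set s | a <= s <= b /\ r <= V s].
have S0 : has_inf S.
  split; first by exists t.
  by exists a => s -[/andP[]].
pose s0 := inf S.
have as0 : a <= s0 by apply: lb_le_inf; [exact: S0.1|move=> s [/andP[]]].
have s0t : s0 <= t by apply: ge_inf; [exact: S0.2|].
have s0ab : a <= s0 <= b by rewrite as0 (le_trans s0t)//; case/andP: tab.
have Vs0 : V s0 < r.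
  apply: VH => // s /andP[sa ss0]; rewrite ltNge; apply/negP => rs.
  have : S s by split=> //; rewrite sa ltW//; rewrite (lt_le_trans ss0)//; case/andP: s0ab.
  by move=> /(ge_inf S0.2); rewrite leNgt ss0.
have rV0 : 0 < r - V s0 by rewrite subr_gt0.
have [e e0 He'] := within_eps VC s0ab rV0.
have He s : a <= s <= b -> `|s - s0| < e -> V s < r.
  by move=> sab /(He' _ sab); rewrite ltr_norml => /andP[? ?]; lra.
have [s [sab rs] ss0] := inf_adherent e0 S0.
have : V s < r.
  apply: He => //; rewrite ger0_norm; first by rewrite ltrBlDl.
  by rewrite subr_ge0; apply: ge_inf => //; exact: S0.2.
by rewrite ltNge rs.
Qed.

(** Taking the first time, rather than any time given by the intermediate value theorem, records
    that an orbit has stayed on one side of a section up to the hit. *)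
Lemma first_hit f a b v : a <= b -> {within `[a, b], continuous f} ->
  f a < v -> v <= f b ->
  exists t, [/\ a < t, t <= b, f t = v & forall s, a <= s < t -> f s < v].
Proof.
move=> ab fC fa fb.
pose S := [set s | a <= s <= b /\ v <= f s].
have S0 : has_inf S.
  split; first by exists b; split=> //; rewrite lexx ab.
  by exists a => s -[/andP[]].
pose t := inf S.
have at_ : a <= t by apply: lb_le_inf; [exact: S0.1|move=> s [/andP[]]].
have tb : t <= b by apply: ge_inf; [exact: S0.2|split=> //; rewrite lexx ab].
have below s : a <= s < t -> f s < v.
  move=> /andP[as_ st]; rewrite ltNge; apply/negP => vs.
  have : S s by split=> //; rewrite as_ ltW// (lt_le_trans st).
  by move=> /(ge_inf S0.2); rewrite leNgt st.
have tab : a <= t <= b by rewrite at_ tb.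
have fCt e := within_eps (e := e) fC tab.
have ft : v <= f t.
  rewrite leNgt; apply/negP => ftv.
  have [|d d0 Hd] := fCt (v - f t); first by rewrite subr_gt0.
  have [s [sab vs] st] := inf_adherent d0 S0.
  have : `|f s - f t| < v - f t.
    apply: Hd => //; rewrite ger0_norm ?ltrBlDl// subr_ge0.
    by apply: ge_inf => //; exact: S0.2.
  rewrite ltr_norml => /andP[_ ?]; lra.
have alt : a < t.
  rewrite lt_neqAle at_ andbT; apply/eqP => atE.
  by move: ft; rewrite -atE leNgt fa.
exists t; split => //; apply/eqP; rewrite eq_le ft andbT leNgt; apply/negP => vft.
have [|d d0 Hd] := fCt (f t - v); first by rewrite subr_gt0.
pose s := Num.max a (t - d / 2).
have st : s < t by rewrite gt_max alt /=; lra.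
have as_ : a <= s by rewrite le_max lexx.
have : `|f s - f t| < f t - v.
  apply: Hd; first by rewrite as_ ltW// (lt_le_trans st).
  rewrite ltr0_norm ?subr_lt0// opprB.
  have : t - d / 2 <= s by rewrite le_max lexx orbT.
  lra.
have : f s < v by apply: below; rewrite as_.
rewrite ltr_norml => ? /andP[? ?]; lra.
Qed.

(** The increments after n sum to at most 2A/2^n, so u_n - 2A/2^n increases and u_n + 2A/2^n
    decreases; the limit is the supremum of the former. *)
Lemma geometric_limit (u : nat -> R) A :
  (forall n, `|u n.+1 - u n| <= A / 2 ^+ n) ->
  exists l, forall n, `|u n - l| <= 2 * A / 2 ^+ n.
Proof.
move=> uA.
have A0 n : 0 <= A / 2 ^+ n by rewrite (le_trans _ (uA n)).
pose al n := u n - 2 * A / 2 ^+ n; pose be n := u n + 2 * A / 2 ^+ n.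
have E n : 2 * A / 2 ^+ n.+1 = A / 2 ^+ n.
  by rewrite exprS invfM mulrACA divff ?mul1r// pnatr_eq0.
have step n : al n <= al n.+1 /\ be n.+1 <= be n.
  rewrite /al /be E -mulrA; have := uA n; rewrite ler_norml => /andP[]; set z := A / _.
  by split; lra.
have alM n m : (n <= m)%N -> al n <= al m.
  by move=> /subnK <-; elim: (m - n)%N => // k IH; rewrite addSn (le_trans IH)//; exact: (step _).1.
have beM n m : (n <= m)%N -> be m <= be n.
  by move=> /subnK <-; elim: (m - n)%N => // k IH; rewrite addSn (le_trans _ IH)//; exact: (step _).2.
have ab n m : al n <= be m.
  apply: (le_trans (alM _ _ (leq_maxl n m))); apply: (le_trans _ (beM _ _ (leq_maxr n m))).
  rewrite /al /be -mulrA; have := A0 (maxn n m); lra.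
have S0 : has_sup (range al).
  split; first by exists (al 0%N), 0%N.
  by exists (be 0%N) => _ [n _ <-].
exists (sup (range al)) => n.
have h1 : al n <= sup (range al) by apply: ub_le_sup; [exact: S0.2|exists n].
have h2 : sup (range al) <= be n by apply: ge_sup; [exact: S0.1|move=> _ [k _ <-]].
by move: h1 h2; rewrite /al /be ler_norml => *; apply/andP; split; lra.
Qed.

(** Integration from -N gives a primitive on ]-N, N[ only. Normalised to vanish at 0, these
    primitives agree on common domains and glue to one on the line. *)
Lemma primitive_exists g : continuous g ->
  exists2 G : R -> R, G 0 = 0 & forall t : R, is_derive t (1:R) G (g t).
Proof.
move=> gC.
have loc (N : R) : 0 < N -> exists2 G : R -> R, G 0 = 0 & forall t : R, - N < t < N -> is_derive t (1:R) G (g t).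
  move=> N0; pose F x := (\int[lebesgue_measure]_(t in [set` `[- N, x]]) g t)%R.
  have int : lebesgue_measure.-integrable `[- N, N] (EFin \o g).
    by apply: continuous_compact_integrable; [exact: segment_compact|exact: continuous_subspaceT].
  exists (fun x => F x - F 0); first by rewrite subrr.
  move=> t /andP[Nt tN].
  have [dF FE] := continuous_FTC1_closed tN int Nt (gC t).
  have FD : is_derive t (1:R) F (g t) by split; [exact: dF|rewrite -derive1E; exact: FE].
  by apply: is_derive_eq; rewrite subr0.
pose GN (N : R) : R -> R := if pselect (0 < N) is left N0 then s2val (cid2 (loc N N0)) else cst 0.
have GN0 N : GN N 0 = 0 by rewrite /GN; case: pselect => // N0; case: cid2.
have GND (N t : R) : - N < t < N -> is_derive t (1:R) (GN N) (g t).
  by rewrite /GN => tN; case: pselect => [N0|]; [case: cid2 => /= G _; exact|case; lra].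
have cons (N M t : R) : - N < t < N -> - M < t < M -> GN N t = GN M t.
  move=> tN tM.
  have HD (s : R) : Num.min t 0 <= s <= Num.max t 0 -> is_derive s (1:R) (fun s => GN N s - GN M s) 0.
    move=> sb; have [s1 s2] : - N < s < N /\ - M < s < M.
      by move: sb; rewrite /Num.min /Num.max; case: ifP => ? ?; split; lra.
    by apply: is_derive_eq; [apply: is_deriveB; exact: GND|rewrite subrr].
  have HC a b : (forall s, a <= s <= b -> Num.min t 0 <= s <= Num.max t 0) ->
     {within `[a, b], continuous (fun s => GN N s - GN M s)}.
    move=> sub; apply: derivable_within_continuous => s; rewrite in_itv => /sub/HD[] //.
  suff : GN N t - GN M t = 0 by move/eqP; rewrite subr_eq0 => /eqP.
  have [t0|t0] := leP t 0.
  - have S (s : R) : t <= s <= 0 -> Num.min t 0 <= s <= Num.max t 0 by rewrite min_l// max_r.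
    have D (s : R) : t < s < 0 -> is_derive s (1:R) (fun s => GN N s - GN M s) ((fun=> 0) s).
      by move=> ?; apply: HD; apply: S; lra.
    have := der_ge t0 D (HC _ _ S) (m := 0) (fun _ _ => lexx _).
    have := der_le t0 D (HC _ _ S) (m := 0) (fun _ _ => lexx _).
    rewrite !GN0; lra.
  - have S (s : R) : 0 <= s <= t -> Num.min t 0 <= s <= Num.max t 0 by rewrite min_r ?max_l// ltW.
    have D (s : R) : 0 < s < t -> is_derive s (1:R) (fun s => GN N s - GN M s) ((fun=> 0) s).
      by move=> ?; apply: HD; apply: S; lra.
    have := der_ge (ltW t0) D (HC _ _ S) (m := 0) (fun _ _ => lexx _).
    have := der_le (ltW t0) D (HC _ _ S) (m := 0) (fun _ _ => lexx _).
    rewrite !GN0; lra.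
(* The bound |t| + 1 varies with t, but near each t the function coincides with the fixed primitive
   [GN M], which gives its derivative. *)
exists (fun t => GN (`|t| + 1) t); first by rewrite GN0.
move=> t; pose M := `|t| + 1.
have tM : - M < t < M by rewrite -ltr_norml /M ltrDl.
have [dG GE] := GND M t tM.
suff nE : {near t, GN M =1 (fun t => GN (`|t| + 1) t)}.
  by split; [exact: (near_eq_derivable nE)|rewrite -(near_eq_derive _ nE)].
have : \forall s \near t, s \in `]- M, M[.
  by apply: near_in_itvoo; rewrite in_itv.
apply: filterS => s; rewrite in_itv /= => sM.
by apply: cons => //; rewrite -ltr_norml ltrDl.
Qed.

End calculus.

(** * Flows of Lipschitz planar fields *)

Section planar_ode.
Context {R : realType}.
Implicit Types (f g : R -> R -> R).

Definition lip (L : R) f := forall x y x' y' : R,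
  `|f x y - f x' y'| <= L * (`|x - x'| + `|y - y'|).

Definition is_sol f g (x y : R -> R) := forall t : R,
  is_derive t (1:R) x (f (x t) (y t)) /\ is_derive t (1:R) y (g (x t) (y t)).

Lemma lip_continuous L f (x y : R -> R) : lip L f -> continuous x -> continuous y ->
  continuous (fun t => f (x t) (y t)).
Proof.
move=> fL xC yC t; apply/cvgrPdist_lt => e e0.
have L1 : 0 < `|L| + 1 by rewrite ltr_wpDl.
have d0 : 0 < e / (2 * (`|L| + 1)) by rewrite divr_gt0// mulr_gt0.
have /cvgrPdist_lt/(_ _ d0) xt := xC t; have /cvgrPdist_lt/(_ _ d0) yt := yC t.
near=> s.
rewrite (le_lt_trans (fL _ _ _ _))//.
have xs : `|x t - x s| < e / (2 * (`|L| + 1)) by near: s.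
have ys : `|y t - y s| < e / (2 * (`|L| + 1)) by near: s.
rewrite (@le_lt_trans _ _ ((`|L| + 1) * (`|x t - x s| + `|y t - y s|)))//.
  by rewrite ler_wpM2r ?addr_ge0// (le_trans (ler_norm _))// lerDl.
rewrite -ltr_pdivlMl//; apply: lt_le_trans (ltrD xs ys) _.
by apply: eq_ler; field; exact: lt0r_neq0.
Unshelve. all: by end_near. Qed.

(** Integration has norm at most 1/K for the weight e^(K|t|), because B/K e^(Kt) is a primitive of
    the bound. Negative times follow by reflection. *)
Lemma exp_weight_bound (h dh : R -> R) B K : 0 < K ->
  h 0 = 0 -> (forall t : R, is_derive t (1:R) h (dh t)) ->
  (forall t, `|dh t| <= B * expR (K * `|t|)) ->
  forall t, `|h t| <= B / K * expR (K * `|t|).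
Proof.
move=> K0.
have B0 (dh' : R -> R) : (forall t, `|dh' t| <= B * expR (K * `|t|)) -> 0 <= B.
  by move=> /(_ 0); rewrite normr0 mulr0 expR0 mulr1; exact: le_trans.
have key (k dk : R -> R) : k 0 = 0 -> (forall t : R, is_derive t (1:R) k (dk t)) ->
    (forall t, `|dk t| <= B * expR (K * `|t|)) ->
    forall t, 0 <= t -> `|k t| <= B / K * expR (K * `|t|).
  move=> k00 kD kB t t0; rewrite (ger0_norm t0).
  have bnd s : 0 < s < t -> - (B * expR (K * s)) <= dk s <= B * expR (K * s).
    by move=> /andP[s0 _]; rewrite -ler_norml -{2}(gtr0_norm s0).
  have BK : 0 <= B / K by rewrite divr_ge0 ?(ltW K0)//; exact: (B0 _ kB).
  have e1D (c s : R) : is_derive s (1:R) (fun s => k s + c * (B / K * expR (K * s)))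
      (dk s + c * (B * expR (K * s))).
    have := kD s => ksD; apply: is_derive_eq; rewrite /GRing.scale/=.
    by congr (_ + _); field; rewrite gt_eqF.
  have up := @der_le _ (fun s => k s + -1 * (B / K * expR (K * s)))
    (fun s => dk s + -1 * (B * expR (K * s))) 0 t 0 t0 (fun s _ => e1D _ s)
    (is_derive_within (e1D _)).
  have lo := @der_ge _ (fun s => k s + 1 * (B / K * expR (K * s)))
    (fun s => dk s + 1 * (B * expR (K * s))) 0 t 0 t0 (fun s _ => e1D _ s)
    (is_derive_within (e1D _)).
  have {}up : k t + -1 * (B / K * expR (K * t)) - (k 0 + -1 * (B / K * expR (K * 0))) <= 0 * (t - 0).
    by apply: up => s /bnd /andP[? ?]; lra.
  have {}lo : 0 * (t - 0) <= k t + 1 * (B / K * expR (K * t)) - (k 0 + 1 * (B / K * expR (K * 0))).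
    by apply: lo => s /bnd /andP[? ?]; lra.
  rewrite mulr0 expR0 k00 in up lo.
  by rewrite ler_norml; apply/andP; split; lra.
move=> h0 hD hB t; have [t0|t0] := leP 0 t; first exact: (key h dh).
have D s : is_derive s (1:R) (fun s => h (- s)) (- dh (- s)).
  have := hD (- s) => hsD.
  by apply: (is_derive_eq (is_derive1_comp hsD _)); rewrite mulrN1.
have := key (fun s => h (- s)) _ _ D _ (- t); rewrite normrN opprK; apply.
- by rewrite oppr0.
- by move=> s; rewrite normrN -(normrN s); exact: hB.
- by rewrite oppr_ge0 ltW.
Qed.

Lemma halves_eq0 (z C : R) : (forall n, `|z| <= C / 2 ^+ n) -> z = 0.
Proof.
move=> H; apply/eqP; rewrite -normr_le0 leNgt; apply/negP => z0.
have C0 : 0 <= C by have := H 0%N; rewrite expr0 divr1; apply: le_trans.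
pose n := Num.trunc (C / `|z|).
have n1 : C / `|z| < n.+1%:R by rewrite truncnS_gt.
have := H n.+1; rewrite leNgt => /negP; apply.
rewrite ltr_pdivrMr ?exprn_gt0// mulrC -ltr_pdivrMr//.
rewrite (lt_le_trans n1)// -natrX ler_nat; exact: ltnW (ltn_expl _ _).
Qed.

Lemma halves_lt (C e : R) : 0 < e -> exists n, C / 2 ^+ n < e.
Proof.
move=> e0; apply: contrapT => /forallNP H.
have HC n : e <= C / 2 ^+ n by rewrite leNgt; apply/negP/H.
have : e = 0 by apply: (@halves_eq0 _ C) => n; rewrite gtr0_norm.
by move=> eE; rewrite eE ltxx in e0.
Qed.

(* Picard iteration, with the increments measured in the weight e^(K|t|),
   K = 4 L, for which the Picard operator is a contraction on the whole line. *)
Theorem flow_exists f g (L x0 y0 : R) : lip L f -> lip L g ->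
  exists x y : R -> R, [/\ x 0 = x0, y 0 = y0 & is_sol f g x y].
Proof.
wlog L0 : L / 0 < L.
  move=> H fL gL; have lipW h : lip L h -> lip (`|L| + 1) h.
    move=> hL a b a' b'; rewrite (le_trans (hL _ _ _ _))// ler_wpM2r ?addr_ge0//.
    by rewrite (le_trans (ler_norm _))// lerDl.
  by apply: (H (`|L| + 1)); [rewrite ltr_wpDl|exact: lipW|exact: lipW].
move=> fL gL.
(* Iteration needs a total operator; the default [cst 0] for discontinuous [h] is never met, since
   all iterates are continuous. *)
pose prim (h : R -> R) : R -> R :=
  if pselect (continuous h) is left hC then s2val (cid2 (primitive_exists hC)) else cst 0.
have prim0 h : prim h 0 = 0 by rewrite /prim; case: pselect => // hC; case: cid2.
have primD h : continuous h -> forall t : R, is_derive t (1:R) (prim h) (h t).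
  by move=> hC; rewrite /prim; case: pselect => // hC'; case: cid2.
pose F (c : (R -> R) * (R -> R)) : (R -> R) * (R -> R) :=
  (fun t => x0 + prim (fun s => f (c.1 s) (c.2 s)) t,
   fun t => y0 + prim (fun s => g (c.1 s) (c.2 s)) t).
pose c n := iter n F (cst x0, cst y0).
have cC n : continuous (c n).1 /\ continuous (c n).2.
  elim: n => [|n [c1 c2]]; first by split; exact: cst_continuous.
  by split => t /=; (apply: continuousD; first exact: cst_continuous);
    apply: (is_derive_continuous (primD _ _)); apply: lip_continuous; eassumption.
have fC n := lip_continuous fL (cC n).1 (cC n).2.
have gC n := lip_continuous gL (cC n).1 (cC n).2.
have c1D n (t : R) : is_derive t (1:R) (c n.+1).1 (f ((c n).1 t) ((c n).2 t)).
  have := primD _ (fC n) t => D.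
  rewrite (_ : (c n.+1).1 = (fun t => x0 + prim (fun s => f ((c n).1 s) ((c n).2 s)) t))//.
  by apply: is_derive_eq; rewrite /GRing.scale/=; ring.
have c2D n (t : R) : is_derive t (1:R) (c n.+1).2 (g ((c n).1 t) ((c n).2 t)).
  have := primD _ (gC n) t => D.
  rewrite (_ : (c n.+1).2 = (fun t => y0 + prim (fun s => g ((c n).1 s) ((c n).2 s)) t))//.
  by apply: is_derive_eq; rewrite /GRing.scale/=; ring.
have c0 n : (c n).1 0 = x0 /\ (c n).2 0 = y0.
  by case: n => // n; rewrite /= !prim0 !addr0.
pose K := 4 * L; have K0 : 0 < K by rewrite mulr_gt0.
pose M := `|f x0 y0| + `|g x0 y0|; pose A := M / K.
have A0 : 0 <= A by rewrite divr_ge0 ?(ltW K0)// addr_ge0.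
have E1 (t : R) : 1 <= expR (K * `|t|) by rewrite -expR0 ler_expR mulr_ge0// ltW.
have inc n t : `|(c n.+1).1 t - (c n).1 t| <= A / 2 ^+ n * expR (K * `|t|) /\
               `|(c n.+1).2 t - (c n).2 t| <= A / 2 ^+ n * expR (K * `|t|).
  elim: n t => [|n IH] t.
    have D1 (s : R) : is_derive s (1:R) (fun s => (c 1%N).1 s - (c 0%N).1 s) (f x0 y0).
      by have := c1D 0%N s => D; apply: is_derive_eq; rewrite subr0.
    have D2 (s : R) : is_derive s (1:R) (fun s => (c 1%N).2 s - (c 0%N).2 s) (g x0 y0).
      by have := c2D 0%N s => D; apply: is_derive_eq; rewrite subr0.
    have MB (z : R) (s : R) : z <= M -> z <= M * expR (K * `|s|).
      by move=> zM; rewrite (le_trans zM)// ler_peMr// addr_ge0.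
    rewrite expr0 divr1; split.
      apply: (exp_weight_bound K0 _ D1) => [|s]; last by apply: MB; rewrite lerDl.
      by rewrite !(c0 _).1 subrr.
    apply: (exp_weight_bound K0 _ D2) => [|s]; last by apply: MB; rewrite lerDr.
    by rewrite !(c0 _).2 subrr.
  have D1 (s : R) : is_derive s (1:R) (fun s => (c n.+2).1 s - (c n.+1).1 s)
      (f ((c n.+1).1 s) ((c n.+1).2 s) - f ((c n).1 s) ((c n).2 s)).
    by have := c1D n.+1 s => D; have := c1D n s => D'; apply: is_derive_eq.
  have D2 (s : R) : is_derive s (1:R) (fun s => (c n.+2).2 s - (c n.+1).2 s)
      (g ((c n.+1).1 s) ((c n.+1).2 s) - g ((c n).1 s) ((c n).2 s)).
    by have := c2D n.+1 s => D; have := c2D n s => D'; apply: is_derive_eq.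
  (* The two coordinates contribute 2 L, and K = 4 L turns this into the factor 1/2. *)
  have E : A / 2 ^+ n.+1 = L * (2 * (A / 2 ^+ n)) / K.
    by rewrite exprS /K; field; rewrite ?gt_eqF// exprn_gt0.
  have B h s : lip L h -> `|h ((c n.+1).1 s) ((c n.+1).2 s) - h ((c n).1 s) ((c n).2 s)|
      <= L * (2 * (A / 2 ^+ n)) * expR (K * `|s|).
    move=> hL; apply: (le_trans (hL _ _ _ _)); rewrite -mulrA ler_wpM2l ?(ltW L0)//.
    have [i1 i2] := IH s; lra.
  rewrite E; split.
    by apply: (exp_weight_bound K0 _ D1) => [|s]; [rewrite !(c0 _).1 subrr|exact: B].
  by apply: (exp_weight_bound K0 _ D2) => [|s]; [rewrite !(c0 _).2 subrr|exact: B].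
have lim1 t : exists l, forall n, `|(c n).1 t - l| <= 2 * (A * expR (K * `|t|)) / 2 ^+ n.
  by apply: geometric_limit => n; have := (inc n t).1; rewrite mulrAC.
have lim2 t : exists l, forall n, `|(c n).2 t - l| <= 2 * (A * expR (K * `|t|)) / 2 ^+ n.
  by apply: geometric_limit => n; have := (inc n t).2; rewrite mulrAC.
have [x xE] := choice lim1; have [y yE] := choice lim2.
(* Convergence is uniform on |s| <= |t| + 1 only, which is enough for continuity at t. *)
have limC (u : nat -> R -> R) (z : R -> R) : (forall n, continuous (u n)) ->
    (forall t n, `|u n t - z t| <= 2 * (A * expR (K * `|t|)) / 2 ^+ n) -> continuous z.
  move=> uC uz t; apply/cvgrPdist_lt => e e0.
  have e3 : 0 < e / 3 by rewrite divr_gt0.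
  have [n nE] := halves_lt (2 * (A * expR (K * (`|t| + 1)))) e3.
  have /cvgrPdist_lt/(_ _ e3) ut := uC n t.
  have tn : \forall s \near t, `|t - s| <= 1.
    by have /cvgrPdist_le/(_ 1 ltr01) : id s @[s --> t] --> t by exact: cvg_id.
  apply: filterS2 tn ut => s ts us.
  have B r : `|r| <= `|t| + 1 -> `|u n r - z r| < e / 3.
    move=> rt; rewrite (le_lt_trans (uz _ _))// (le_lt_trans _ nE)//.
    rewrite ler_wpM2r ?invr_ge0 ?exprn_ge0// ler_wpM2l// ler_wpM2l// ler_expR.
    by rewrite ler_wpM2l// ltW.
  have bt : `|u n t - z t| < e / 3 by apply: B; rewrite lerDl.
  have bs : `|u n s - z s| < e / 3.
    apply: B; rewrite -lerBlDl (le_trans (lerB_dist _ _))//.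
    by rewrite distrC.
  move: bt bs us; rewrite !ltr_norml => /andP[? ?] /andP[? ?] /andP[? ?].
  by apply/andP; split; lra.
have xC : continuous x by apply: (limC (fun n => (c n).1)) => // n; exact: (cC n).1.
have yC : continuous y by apply: (limC (fun n => (c n).2)) => // n; exact: (cC n).2.
have fxC := lip_continuous fL xC yC; have gxC := lip_continuous gL xC yC.
have dist h t n : lip L h -> `|h ((c n).1 t) ((c n).2 t) - h (x t) (y t)| <=
    4 * L * A / 2 ^+ n * expR (K * `|t|).
  move=> hL; rewrite (le_trans (hL _ _ _ _))//.
  rewrite (@le_trans _ _ (L * (2 * (2 * (A * expR (K * `|t|)) / 2 ^+ n))))//.
    rewrite ler_wpM2l ?(ltW L0)//; have := xE t n; have := yE t n; lra.
  by apply: eq_ler; ring.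
have lim_eq (u : nat -> R -> R) (z : R -> R) h z0 : lip L h -> continuous (fun s => h (x s) (y s)) ->
    (forall n, u n 0 = z0) ->
    (forall n (t : R), is_derive t (1:R) (u n.+1) (h ((c n).1 t) ((c n).2 t))) ->
    (forall t n, `|u n t - z t| <= 2 * (A * expR (K * `|t|)) / 2 ^+ n) ->
    forall t, z t = z0 + prim (fun s => h (x s) (y s)) t.
  move=> hL hC u0 uD uz t; apply/eqP; rewrite -subr_eq0; apply/eqP.
  (* For every n, the limit and its Picard image are both within a multiple of 2^(-n) of iterate n +
     1, hence equal. *)
  apply: (@halves_eq0 _ (3 * (A * expR (K * `|t|)))) => n.
  have D (s : R) : is_derive s (1:R) (fun s => u n.+1 s - z0 - prim (fun s => h (x s) (y s)) s)
     (h ((c n).1 s) ((c n).2 s) - h (x s) (y s)).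
    have := uD n s => D; have := primD _ hC s => D'.
    by apply: is_derive_eq; rewrite subr0.
  have := exp_weight_bound K0 _ D (fun s => dist h s n hL) t.
  rewrite u0 prim0 !subrr => /(_ erefl).
  have -> : 4 * L * A / 2 ^+ n / K * expR (K * `|t|) = A * expR (K * `|t|) / 2 ^+ n.
    by rewrite /K; field; rewrite ?gt_eqF// exprn_gt0.
  have := uz t n.+1; rewrite exprS.
  have -> : 2 * (A * expR (K * `|t|)) / (2 * 2 ^+ n) = A * expR (K * `|t|) / 2 ^+ n.
    by field; rewrite gt_eqF// exprn_gt0.
  set w := A * _ / _.
  have -> : 3 * (A * expR (K * `|t|)) / 2 ^+ n = 3 * w by rewrite -mulrA.
  have w0 : 0 <= w by rewrite divr_ge0 ?exprn_ge0// mulr_ge0// expR_ge0.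
  rewrite !ler_norml => /andP[? ?] /andP[? ?]; apply/andP; split; lra.
have xP := lim_eq (fun n => (c n).1) x f x0 fL fxC (fun n => (c0 n).1) c1D xE.
have yP := lim_eq (fun n => (c n).2) y g y0 gL gxC (fun n => (c0 n).2) c2D yE.
exists x, y; split; [by rewrite xP prim0 addr0|by rewrite yP prim0 addr0|move=> t].
have lift z h z0 : continuous h -> (forall t, z t = z0 + prim h t) -> is_derive t (1:R) z (h t).
  move=> hC zE; rewrite (funext zE); have := primD _ hC t => D.
  by apply: is_derive_eq; rewrite /GRing.scale/=; ring.
by split; [exact: lift fxC xP|exact: lift gxC yP].
Qed.

(** The estimate is made for V = u^2 + v^2, which avoids differentiating absolute values. [s] is a
    constant forcing; [K] depends on [L] and [T] alone, so it can be fixed before the solutions. *)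
Lemma gronwall (L T : R) : 0 <= L -> 0 <= T -> exists2 K, 1 <= K &
  forall (u v du dv : R -> R) (a b d s : R), a <= b <= a + T -> 0 <= d -> 0 <= s ->
  (forall t : R, a < t < b -> is_derive t (1:R) u (du t)) ->
  (forall t : R, a < t < b -> is_derive t (1:R) v (dv t)) ->
  {within `[a, b], continuous u} -> {within `[a, b], continuous v} ->
  (forall t, a < t < b -> `|du t| <= L * (`|u t| + `|v t|) + s) ->
  (forall t, a < t < b -> `|dv t| <= L * (`|u t| + `|v t|) + s) ->
  `|u a| <= d -> `|v a| <= d ->
  `|u b| <= K * (d + s) /\ `|v b| <= K * (d + s).
Proof.
(* 4 L bounds the growth of V; the extra 1 absorbs the mixed terms in [s] and keeps [k] positive
   when L = 0. *)
move=> L0 T0; pose k := 4 * L + 1; have k0 : 0 < k by rewrite /k; lra.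
pose E := expR (k * T).
have E1 : 1 <= E by rewrite -expR0 ler_expR mulr_ge0// ltW.
exists (2 * E); first by lra.
move=> u v du dv a b d s /andP[ab bT] d0 s0 uD vD uC vC duB dvB ua va.
pose V t := u t * u t + v t * v t.
have VD (t : R) : a < t < b -> is_derive t (1:R) V (2 * (u t * du t + v t * dv t)).
  move=> tab; have := uD t tab => D; have := vD t tab => D'.
  by apply: is_derive_eq; rewrite /GRing.scale/=; ring.
have VC : {within `[a, b], continuous V} by apply: within_contD; exact: within_contM.
have dV t : a < t < b -> 2 * (u t * du t + v t * dv t) <= k * V t + 2 * (s * s).
  move=> tab; have := duB t tab; have := dvB t tab.
  set z := L * _ + s => dvz duz.
  have e1 : u t * du t <= `|u t| * z.
    by rewrite (le_trans (ler_norm _))// normrM ler_wpM2l.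
  have e2 : v t * dv t <= `|v t| * z.
    by rewrite (le_trans (ler_norm _))// normrM ler_wpM2l.
  rewrite (@le_trans _ _ (2 * (`|u t| * z + `|v t| * z)))//; first by lra.
  have -> : V t = `|u t| ^+ 2 + `|v t| ^+ 2 by rewrite !real_normK ?num_real// !expr2.
  rewrite /z /k; set p := `|u t|; set q := `|v t|.
  have i1 : 0 <= L * (p - q) ^+ 2 by rewrite mulr_ge0// sqr_ge0.
  have i2 : 0 <= (p - s) ^+ 2 + (q - s) ^+ 2 by rewrite addr_ge0// sqr_ge0.
  rewrite -subr_ge0; apply: le_trans (addr_ge0 (mulr_ge0 (ler0n _ 2) i1) i2) _.
  by apply: eq_ler; ring.
have H := linear_gronwall ab (lt0r_neq0 k0) VD VC dV.
have Eb : expR (k * (b - a)) <= E by rewrite ler_expR ler_wpM2l ?(ltW k0)//; lra.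
have sq (z w : R) : 0 <= w -> z * z <= w * w -> `|z| <= w.
  by move=> w0; rewrite -!expr2 -(real_normK (num_real z)) ler_pXn2r ?nnegrE.
have VaB : V a <= 2 * (d * d).
  have pd (z : R) : `|z| <= d -> z * z <= d * d.
    by move=> zd; rewrite -!expr2 -(real_normK (num_real z)) ler_pXn2r ?nnegrE.
  by have := pd _ ua; have := pd _ va; rewrite /V; lra.
have ss : 0 <= 2 * (s * s) by rewrite !mulr_ge0.
have m1 : 2 * (s * s) / k <= 2 * (s * s).
  by rewrite ler_pdivrMr// ler_peMr// /k lerDr mulr_ge0.
have m0 : 0 <= 2 * (s * s) / k by rewrite divr_ge0 ?(ltW k0).
have Va0 : 0 <= V a by rewrite /V addr_ge0// -expr2 sqr_ge0.
have LL4 : 0 <= 4 * L by rewrite mulr_ge0.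
have VbB : V b <= (2 * E * (d + s)) * (2 * E * (d + s)).
  rewrite (@le_trans _ _ ((V a + 2 * (s * s) / k) * E))//.
    rewrite (le_trans _ (le_trans H _))//; first by rewrite lerDl.
    by rewrite ler_wpM2l// addr_ge0.
  rewrite (@le_trans _ _ ((2 * (d * d) + 2 * (s * s)) * E))//.
    by rewrite ler_wpM2r ?(le_trans ler01 E1)// lerD// (le_trans m1).
  rewrite (@le_trans _ _ (2 * (d + s) ^+ 2 * E))//.
    rewrite ler_wpM2r ?(le_trans ler01 E1)//.
    have : 0 <= d * s by rewrite mulr_ge0.
    by rewrite expr2; lra.
  have -> : 2 * E * (d + s) * (2 * E * (d + s)) = (2 * (d + s) ^+ 2 * E) * (2 * E) by ring.
  rewrite ler_peMr//; last by lra.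
  by rewrite mulr_ge0 ?(le_trans ler01 E1)// mulr_ge0// sqr_ge0.
have Ed : 0 <= 2 * E * (d + s) by rewrite mulr_ge0 ?addr_ge0//; lra.
have uu : 0 <= u b * u b by rewrite -expr2 sqr_ge0.
have vv : 0 <= v b * v b by rewrite -expr2 sqr_ge0.
by move: VbB; rewrite /V => VbB; split; apply: sq => //; lra.
Qed.

Lemma lip_ge0 L f : lip L f -> 0 <= L.
Proof.
move=> /(_ 1 0 0 0); rewrite !subrr subr0 normr0 normr1 addr0 mulr1.
exact: le_trans.
Qed.

Lemma lipW L L' f : L <= L' -> lip L f -> lip L' f.
Proof.
by move=> LL' fL x y x' y'; rewrite (le_trans (fL _ _ _ _))// ler_wpM2r// addr_ge0.
Qed.

(** The derivatives [p], [q] have to agree with [f], [g] only along the curve, on the open interval.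
    A curve built from a clamped or frozen field is thus recognised as an orbit of the original
    field as long as it stays where the two coincide. *)
Lemma sol_unique_on L f g (x y x' y' p q : R -> R) a b : lip L f -> lip L g ->
  (forall t : R, a < t < b -> is_derive t (1:R) x (p t)) ->
  (forall t : R, a < t < b -> is_derive t (1:R) y (q t)) ->
  {within `[a, b], continuous x} -> {within `[a, b], continuous y} ->
  (forall t, a < t < b -> p t = f (x t) (y t) /\ q t = g (x t) (y t)) ->
  is_sol f g x' y' -> x a = x' a -> y a = y' a ->
  forall t, a <= t <= b -> x t = x' t /\ y t = y' t.
Proof.
move=> fL gL xD yD xC yC pq S xa ya t /andP[at_ tb].
have L0 := lip_ge0 fL.
have T0 : 0 <= t - a by rewrite subr_ge0.
have [K K1 HK] := gronwall L0 T0.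
have sub s : a < s < t -> a < s < b.
  by move=> /andP[-> /lt_le_trans]; apply.
have CS (z : R -> R) : {within `[a, b], continuous z} -> {within `[a, t], continuous z}.
  apply: continuous_subspaceW => s /=; rewrite !in_itv /= => /andP[-> h].
  exact: le_trans tb.
have xD' s : a < s < t -> is_derive s (1:R) (fun s => x s - x' s) (p s - f (x' s) (y' s)).
  by move=> /sub/xD D; have [D' _] := S s; apply: is_derive_eq.
have yD' s : a < s < t -> is_derive s (1:R) (fun s => y s - y' s) (q s - g (x' s) (y' s)).
  by move=> /sub/yD D; have [_ D'] := S s; apply: is_derive_eq.
have := HK _ _ _ _ a t 0 0 _ (lexx _) (lexx _) xD' yD'.
have -> : a <= t <= a + (t - a) by rewrite at_ subrKC /=.
rewrite xa ya !subrr normr0 addr0 mulr0 => /(_ isT) [].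
- apply: within_contB; first exact: CS.
  exact: (is_derive_within (fun s => (S s).1)).
- apply: within_contB; first exact: CS.
  exact: (is_derive_within (fun s => (S s).2)).
- by move=> s /sub/pq[-> _]; rewrite addr0; exact: fL.
- by move=> s /sub/pq[_ ->]; rewrite addr0; exact: gL.
- by [].
- by [].
- by rewrite !normr_le0 !subr_eq0 => /eqP -> /eqP ->.
Qed.

Lemma is_sol_shift f g (x y : R -> R) s : is_sol f g x y ->
  is_sol f g (fun t => x (t + s)) (fun t => y (t + s)).
Proof.
move=> S t; have [D1 D2] := S (t + s).
have D (z : R -> R) d : is_derive (t + s) (1:R) z d -> is_derive t (1:R) (fun t => z (t + s)) d.
  move=> zD; have T : is_derive t (1:R) (fun t => t + s) 1.
    by apply: is_derive_eq; rewrite addr0.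
  by have := @is_derive1_comp R z (fun t => t + s) t d 1 zD T; rewrite mulr1.
by split; exact: D.
Qed.

Lemma is_sol_rev f g (x y : R -> R) : is_sol f g x y ->
  is_sol (fun a b => - f a b) (fun a b => - g a b) (fun t => x (- t)) (fun t => y (- t)).
Proof.
move=> S t; have [D1 D2] := S (- t).
have D (z : R -> R) d : is_derive (- t) (1:R) z d -> is_derive t (1:R) (fun t => z (- t)) (- d).
  move=> zD; have T : is_derive t (1:R) (fun t : R => - t) (- 1) by apply: is_derive_eq.
  by have := @is_derive1_comp R z (fun t => - t) t d (-1) zD T; rewrite mulrN1.
by split; exact: D.
Qed.

Lemma lipN L f : lip L f -> lip L (fun a b => - f a b).
Proof. by move=> fL x y x' y'; rewrite -opprD normrN; exact: fL. Qed.

Lemma sol_cont f g (x y : R -> R) : is_sol f g x y -> continuous x /\ continuous y.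
Proof.
by move=> S; split; [exact: (is_derive_continuous (fun s => (S s).1))|
  exact: (is_derive_continuous (fun s => (S s).2))].
Qed.

Lemma sol_unique L f g (x y x' y' : R -> R) : lip L f -> lip L g ->
  is_sol f g x y -> is_sol f g x' y' -> x 0 = x' 0 -> y 0 = y' 0 ->
  forall t, x t = x' t /\ y t = y' t.
Proof.
have fwd f' g' (u v u' v' : R -> R) : lip L f' -> lip L g' -> is_sol f' g' u v ->
    is_sol f' g' u' v' -> u 0 = u' 0 -> v 0 = v' 0 ->
    forall t, 0 <= t -> u t = u' t /\ v t = v' t.
  move=> fL gL S S' u0 v0 t t0; have [uC vC] := sol_cont S.
  apply: (@sol_unique_on L f' g' u v u' v' (fun t => f' (u t) (v t))
    (fun t => g' (u t) (v t)) 0 t) => //; last by rewrite t0 lexx.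
  - by move=> s _; exact: (S s).1.
  - by move=> s _; exact: (S s).2.
  - exact: continuous_subspaceT.
  - exact: continuous_subspaceT.
move=> fL gL S S' x0 y0 t; have [t0|t0] := leP 0 t; first exact: (fwd f g).
have := @fwd _ _ _ _ _ _ (lipN fL) (lipN gL) (is_sol_rev S) (is_sol_rev S').
rewrite !oppr0 => /(_ x0 y0 (- t)); rewrite !opprK; apply; lra.
Qed.

End planar_ode.

(** * Contracting return maps and limit cycles *)

Section cycle.
Context {R : realType}.

(* The section is the segment |y - yc| <= w of the line x = s; tau need not be
   the first return time. *)
Record return_map (f g : R -> R -> R) (s yc w Tm TM : R) (P tau : R -> R) : Prop := {
  ret_w0 : 0 < w;
  ret_Tm0 : 0 < Tm;
  ret_tau : forall y, `|y - yc| <= w -> Tm <= tau y <= TM;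
  ret_self : forall y, `|y - yc| <= w -> `|P y - yc| < w;
  ret_transversal : forall y, `|y - yc| <= w -> 0 < f s y;
  ret_sol : forall x y : R -> R, is_sol f g x y -> x 0 = s -> `|y 0 - yc| <= w ->
    x (tau (y 0)) = s /\ y (tau (y 0)) = P (y 0);
  ret_contr : forall y y', `|y - yc| <= w -> `|y' - yc| <= w ->
    `|P y - P y'| <= 2^-1 * `|y - y'| }.

(** The intermediate value theorem suffices: [P] maps the segment into its interior, so P y - y
    changes sign. Contraction enters through continuity. *)
Lemma return_fixpoint f g s yc w Tm TM P tau : return_map f g s yc w Tm TM P tau ->
  exists2 y, `|y - yc| < w & P y = y.
Proof.
move=> [w0 _ _ PJ _ _ Pcontr].
have hC : {within `[yc - w, yc + w], continuous (fun y => P y - y)}.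
  apply/subspace_continuousP => y; rewrite /= in_itv /= => yJ.
  apply/cvgrPdist_lt => e e0; rewrite near_withinE; near=> z.
  rewrite /= in_itv /= => zJ.
  have yJ' : `|y - yc| <= w by rewrite ler_norml; lra.
  have zJ' : `|z - yc| <= w by rewrite ler_norml; lra.
  have h1 := Pcontr _ _ yJ' zJ'.
  have h2 : `|y - z| < e / 2 by near: z; apply: cvgr_dist_lt; rewrite ?divr_gt0//; exact: cvg_id.
  have -> : P y - y - (P z - z) = (P y - P z) - (y - z) by ring.
  have := ler_normB (P y - P z) (y - z); lra.
have wJ1 : `|yc - w - yc| <= w by rewrite ler_norml; lra.
have wJ2 : `|yc + w - yc| <= w by rewrite ler_norml; lra.
have p1 : 0 <= P (yc - w) - (yc - w) by have := PJ _ wJ1; rewrite ltr_norml; lra.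
have p2 : P (yc + w) - (yc + w) <= 0 by have := PJ _ wJ2; rewrite ltr_norml; lra.
have ab : yc - w <= yc + w by lra.
have [|y yJ Py] := IVT (v := 0) ab hC.
  have p12 := le_trans p2 p1; by rewrite min_r ?max_l ?p1 ?p2.
have yJ' : `|y - yc| <= w by move: yJ; rewrite in_itv /= ler_norml; lra.
have PyE : P y = y by move: Py; lra.
by exists y => //; rewrite -{1}PyE; exact: PJ.
Unshelve. all: by end_near. Qed.

Record return_orbit (f g : R -> R -> R) (s yc w Tm TM : R) (P tau : R -> R)
    (ys : R) (x y : R -> R) : Prop := {
  orb_ret : return_map f g s yc w Tm TM P tau;
  orb_lip : exists2 L, lip L f & lip L g;
  orb_in : `|ys - yc| < w;
  orb_fix : P ys = ys;
  orb_sol : is_sol f g x y;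
  orb_x0 : x 0 = s;
  orb_y0 : y 0 = ys }.

Lemma orbit_T_gt0 f g s yc w Tm TM P tau ys x y
    (O : return_orbit f g s yc w Tm TM P tau ys x y) : 0 < tau ys.
Proof.
have [[_ Tm0 tauB _ _ _ _] _ ysJ _ _ _ _] := O.
by have /andP[/(lt_le_trans Tm0)] := tauB _ (ltW ysJ).
Qed.

Lemma orbit_periodic f g s yc w Tm TM P tau ys x y
    (O : return_orbit f g s yc w Tm TM P tau ys x y) t : x (t + (tau ys)) = x t /\ y (t + (tau ys)) = y t.
Proof.
have [[w0 Tm0 tauB PJ f_sec Pret Pcontr] [L fL gL] ysJ Pys S x0 y0] := O.
have T0 := orbit_T_gt0 O.
have yJ : `|y 0 - yc| <= w by rewrite y0 ltW.
have [xT yT] := Pret _ _ S x0 yJ.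
apply: (sol_unique fL gL (is_sol_shift (tau ys) S) S); rewrite add0r.
  by rewrite -y0 xT x0.
by rewrite -y0 yT y0.
Qed.

Lemma orbit_periodicn f g s yc w Tm TM P tau ys x y
    (O : return_orbit f g s yc w Tm TM P tau ys x y) n t : x (t + n%:R * (tau ys)) = x t /\ y (t + n%:R * (tau ys)) = y t.
Proof.
elim: n => [|n [IH1 IH2]]; first by rewrite mul0r addr0.
by rewrite -addn1 natrD mulrDl mul1r addrA (orbit_periodic O _).1 (orbit_periodic O _).2.
Qed.

Lemma orbit_reduce f g s yc w Tm TM P tau ys x y
    (O : return_orbit f g s yc w Tm TM P tau ys x y) t : exists t', [/\ 0 <= t', t' < (tau ys), x t = x t' & y t = y t'].
Proof.
have [[w0 Tm0 tauB PJ f_sec Pret Pcontr] [L fL gL] ysJ Pys S x0 y0] := O.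
have T0 := orbit_T_gt0 O.
have pos r : 0 <= r -> exists t', [/\ 0 <= t', t' < (tau ys), x r = x t' & y r = y t'].
  move=> r0; have /andP[h1 h2] : (Num.truncn (r / (tau ys)))%:R <= r / (tau ys) < (Num.truncn (r / (tau ys))).+1%:R.
    by apply: trunc_itv; rewrite divr_ge0 // ltW.
  move: h1 h2; set n := Num.truncn _; rewrite ler_pdivlMr// ltr_pdivrMr// => h1 h2.
  have := orbit_periodicn O n (r - n%:R * (tau ys)); rewrite subrK => -[-> ->].
  exists (r - n%:R * (tau ys)); split => //; first by rewrite subr_ge0.
  by move: h2; rewrite -addn1 natrD; lra.
have [t0|t0] := leP 0 t; first exact: pos.
have h : - t / (tau ys) < (Num.truncn (- t / (tau ys))).+1%:R by exact: truncnS_gt.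
move: h; set n := (Num.truncn _).+1; rewrite ltr_pdivrMr// => h.
by have [<- <-] := orbit_periodicn O n t; apply: pos; lra.
Qed.

(** At time 0 the orbit crosses the section from left to right with positive speed. The strict
    inequalities at -h and h are open conditions, so nearby solutions cross the section in the same
    time window. *)
Lemma orbit_section f g s yc w Tm TM P tau ys x y
    (O : return_orbit f g s yc w Tm TM P tau ys x y) e : 0 < e -> exists h, [/\ 0 < h, h < e, x (- h) < s, s < x h &
  forall t, - h <= t <= h -> `|y t - ys| < e].
Proof.
have [[w0 Tm0 tauB PJ f_sec Pret Pcontr] [L fL gL] ysJ Pys S x0 y0] := O.
have T0 := orbit_T_gt0 O.
move=> e0; have [xC yC] := sol_cont S.
have fC := lip_continuous fL xC yC.
have f0 : 0 < f (x 0) (y 0) by rewrite x0 y0; apply: f_sec; exact: ltW.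
have f20 : 0 < f (x 0) (y 0) / 2 by rewrite divr_gt0.
have [d1 d10 H1] := continuous_eps 0 fC f20.
have [d2 d20 H2] := continuous_eps 0 yC e0.
pose h := Num.min (Num.min d1 d2) (Num.min e 1) / 2.
have hE : [/\ 0 < h, h < d1, h < d2, h < e & h < 1].
  have m0 : 0 < Num.min (Num.min d1 d2) (Num.min e 1) by rewrite !lt_min d10 d20 e0 ltr01.
  have : Num.min (Num.min d1 d2) (Num.min e 1) <= Num.min (Num.min d1 d2) (Num.min e 1) by [].
  rewrite {2}/h !le_min => /andP[/andP[a1 a2] /andP[a3 a4]].
  move: m0 a1 a2 a3 a4; rewrite /h; clear; move: (Num.min _ (Num.min e 1)) => m.
  by split; lra.
have [h0 h1 h2 h3 h4] := hE.
have inc a b : - h <= a -> a < b -> b <= h -> x a < x b.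
  move=> ha ab' hb.
  have := @der_ge _ x (fun t => f (x t) (y t)) a b (f (x 0) (y 0) / 2) (ltW ab')
    (fun t _ => (S t).1) (continuous_subspaceT xC).
  have /[swap]/[apply] : forall t, a < t < b -> f (x 0) (y 0) / 2 <= f (x t) (y t).
    move=> t /andP[at_ tb].
    have : `|f (x t) (y t) - f (x 0) (y 0)| < f (x 0) (y 0) / 2.
      by apply: H1; rewrite subr0 ltr_norml; move: ha at_ tb hb h1; clear; lra.
    by rewrite ltr_norml; clear; lra.
  have : 0 < f (x 0) (y 0) / 2 * (b - a) by rewrite mulr_gt0// subr_gt0.
  by clear; lra.
exists h; split => //.
- by rewrite -x0; apply: inc => //; move: h0; clear; lra.
- by rewrite -x0; apply: inc => //; move: h0; clear; lra.
- by move=> t th; rewrite -y0; apply: H2; rewrite subr0 ltr_norml; move: th h2; clear; lra.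
Qed.

(** A nearby solution follows the orbit by Gronwall up to the section, which it meets close to [ys].
    From then on each return halves the bound on the distance to [ys], and Gronwall between
    consecutive returns transports this to all times, with one constant because return times are at
    most [TM]. *)
Lemma orbit_attracts f g s yc w Tm TM P tau ys x y
    (O : return_orbit f g s yc w Tm TM P tau ys x y) r : 0 < r -> exists2 d, 0 < d & forall u v : R -> R,
  is_sol f g u v -> (exists t0, `|u 0 - x t0| < d /\ `|v 0 - y t0| < d) ->
  (forall t, 0 <= t -> exists t', `|u t - x t'| < r /\ `|v t - y t'| < r) /\
  (forall e, 0 < e -> exists t1, forall t, t1 <= t ->
     exists t', `|u t - x t'| < e /\ `|v t - y t'| < e).
Proof.
have [[w0 Tm0 tauB PJ f_sec Pret Pcontr] [L fL gL] ysJ Pys S x0 y0] := O.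
have T0 := orbit_T_gt0 O.
move=> r0; have L0 := lip_ge0 fL.
have TM0 : 0 < TM by have /andP[h1 h2] := tauB _ (ltW ysJ); lra.
(* At most three periods pass until the first hit of the section, and a return takes at most [TM];
   one Gronwall constant for the sum covers both phases. *)
have Tt0 : 0 <= 3 * (tau ys) + TM by have := T0; lra.
have [K K1 HK] := gronwall L0 Tt0.
have near_orbit (u v : R -> R) a t0 d t : is_sol f g u v -> 0 <= d ->
    `|u a - x t0| <= d -> `|v a - y t0| <= d -> a <= t <= a + (3 * (tau ys) + TM) ->
    `|u t - x (t0 + (t - a))| <= K * d /\ `|v t - y (t0 + (t - a))| <= K * d.
  move=> S' d0 ua va atb.
  have S2 := is_sol_shift (t0 - a) S.
  have E z : t0 + (z - a) = z + (t0 - a) by ring.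
  rewrite !E.
  have := HK (fun t => u t - x (t + (t0 - a))) (fun t => v t - y (t + (t0 - a)))
    (fun t => f (u t) (v t) - f (x (t + (t0 - a))) (y (t + (t0 - a))))
    (fun t => g (u t) (v t) - g (x (t + (t0 - a))) (y (t + (t0 - a)))) a t d 0 atb d0 (lexx _).
  have D1 (z : R) : is_derive z (1:R) (fun t => u t - x (t + (t0 - a)))
     (f (u z) (v z) - f (x (z + (t0 - a))) (y (z + (t0 - a)))).
    by have [A1 _] := S' z; have [A2 _] := S2 z; apply: is_derive_eq.
  have D2 (z : R) : is_derive z (1:R) (fun t => v t - y (t + (t0 - a)))
     (g (u z) (v z) - g (x (z + (t0 - a))) (y (z + (t0 - a)))).
    by have [_ A1] := S' z; have [_ A2] := S2 z; apply: is_derive_eq.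
  rewrite addr0; apply => //.
  - exact: is_derive_within D1.
  - exact: is_derive_within D2.
  - by move=> z _; rewrite addr0; exact: fL.
  - by move=> z _; rewrite addr0; exact: gL.
  - by rewrite addrCA subrr addr0.
  - by rewrite addrCA subrr addr0.
(* The first entry keeps the hits of the section in the segment; the second leaves room for the
   Gronwall factor [K] within distance [r]. *)
pose ej := Num.min (w - `|ys - yc|) (r / (4 * K)).
have K0 : 0 < K by lra.
have ej0 : 0 < ej by rewrite lt_min subr_gt0 ysJ /= divr_gt0// mulr_gt0.
have ejJ z : `|z - ys| <= ej -> `|z - yc| <= w.
  rewrite le_min => /andP[h _]; have := ler_normD (z - ys) (ys - yc).
  by rewrite addrA subrK; lra.
have ejr : 4 * (K * ej) <= r.
  have : ej <= r / (4 * K) by rewrite ge_min lexx orbT.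
  by rewrite ler_pdivlMr ?mulr_gt0//; lra.
have ej20 : 0 < Num.min (ej / 2) (tau ys) by rewrite lt_min divr_gt0// T0.
have [h [h0 hT xh1 xh2 yh]] := orbit_section O ej20.
move: hT; rewrite lt_min => /andP[_ hT].
pose m := Num.min (Num.min (ej / 2) (r / 2)) (Num.min (s - x (- h)) (x h - s)).
have m0 : 0 < m by rewrite !lt_min !divr_gt0//= !subr_gt0 xh1 xh2.
have [m1 m2 m3 m4] : [/\ m <= ej / 2, m <= r / 2, m <= s - x (- h) & m <= x h - s].
  have : m <= m by [].
  by rewrite {2}/m !le_min => /andP[/andP[? ?] /andP[? ?]].
exists (m / (2 * K)); first by rewrite divr_gt0// mulr_gt0.
set d := m / (2 * K).
have d0 : 0 < d by rewrite divr_gt0// mulr_gt0.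
have Kd : K * d < m.
  have -> : K * d = m / 2 by rewrite /d; field; exact: lt0r_neq0.
  by move: m0; clear; lra.
clearbody d; clear f_sec.
move=> u v S' [t0' [ut0' vt0']].
have [t0 [t00 t0T E1 E2]] := orbit_reduce O t0'.
rewrite E1 E2 {E1 E2 t0'} in ut0' vt0'.
have near0 t : 0 <= t <= 3 * (tau ys) + TM ->
    `|u t - x (t0 + t)| <= K * d /\ `|v t - y (t0 + t)| <= K * d.
  move=> tb; have := near_orbit u v 0 t0 d t S' (ltW d0) (ltW ut0') (ltW vt0').
  by rewrite subr0 add0r; apply.
(* Started at phase [t0], the periodic orbit is on the section at time 2 tau - t0. Two periods are
   used instead of one so that the window begins at a nonnegative time even if [t0] is close to the
   period. *)
pose t1 := 2 * (tau ys) - t0 - h; pose t2 := 2 * (tau ys) - t0 + h.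
have t10 : 0 <= t1 by move: hT t0T T0 t00; rewrite /t1; clear; lra.
have t12 : t1 <= t2 by move: h0; rewrite /t1 /t2; clear; lra.
have t2T : t2 <= 3 * (tau ys) + TM by move: t0T hT TM0 t00; rewrite /t2; clear; lra.
have [uC vC] := sol_cont S'.
have per z : x (t0 + z) = x (z - (2 * (tau ys) - t0)) /\ y (t0 + z) = y (z - (2 * (tau ys) - t0)).
  have := orbit_periodicn O 2 (z - (2 * (tau ys) - t0)).
  by have -> : z - (2 * (tau ys) - t0) + 2%:R * (tau ys) = t0 + z by ring.
have ut1 : u t1 <= s.
  have : 0 <= t1 <= 3 * (tau ys) + TM by rewrite t10 (le_trans t12).
  move=> /near0 []; rewrite (per _).1 /t1.
  have -> : 2 * (tau ys) - t0 - h - (2 * (tau ys) - t0) = - h by ring.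
  by rewrite ler_norml; move: m3 Kd; clear; lra.
have ut2 : s <= u t2.
  have : 0 <= t2 <= 3 * (tau ys) + TM by rewrite t2T (le_trans t10).
  move=> /near0 []; rewrite (per _).1 /t2.
  have -> : 2 * (tau ys) - t0 + h - (2 * (tau ys) - t0) = h by ring.
  by rewrite ler_norml; move: m4 Kd; clear; lra.
have [|t3 t3I ut3] := IVT (v := s) t12 (continuous_subspaceT uC).
  have u12 := le_trans ut1 ut2; by rewrite min_l ?max_r ?ut1 ?ut2.
rewrite in_itv /= in t3I.
have t3B : 0 <= t3 <= 3 * (tau ys) + TM by move: t3I t10 t2T; clear; lra.
have vt3 : `|v t3 - ys| <= ej.
  have [_] := near0 t3 t3B; rewrite (per _).2 => h1.
  have := yh (t3 - (2 * (tau ys) - t0)); rewrite lt_min => /(_ _)/andP.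
  have thh : - h <= t3 - (2 * (tau ys) - t0) <= h by move: t3I; rewrite /t1 /t2; clear; lra.
  move=> /(_ thh)[h2 _].
  have := ler_normD (v t3 - y (t3 - (2 * (tau ys) - t0))) (y (t3 - (2 * (tau ys) - t0)) - ys).
  by move: h1 h2; rewrite addrA subrK; move: m1 Kd; clear; lra.
(* Pairs of hitting time and ordinate at the successive returns. *)
pose st n := iter n (fun q : R * R => (q.1 + tau q.2, P q.2)) (t3, v t3).
have st1S n : (st n.+1).1 = (st n).1 + tau (st n).2 by [].
have stP n : [/\ `|(st n).2 - ys| <= ej / 2 ^+ n, u (st n).1 = s, v (st n).1 = (st n).2 &
    t3 + n%:R * Tm <= (st n).1].
  elim: n => [|n [IH1 IH2 IH3 IH4]]; first by rewrite expr0 divr1 mul0r addr0.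
  have E0 : ej / 2 ^+ n <= ej.
    by rewrite ler_pdivrMr ?exprn_gt0// ler_peMr ?(ltW ej0)// exprn_ege1// ler1n.
  have yJ : `|(st n).2 - yc| <= w by apply: ejJ; rewrite (le_trans IH1).
  have /andP[tm tM] := tauB _ yJ.
  have := Pret _ _ (is_sol_shift (st n).1 S'); rewrite !add0r IH2 IH3 => /(_ erefl yJ)[h1 h2].
  split.
  - rewrite /= -/(st n) -{1}Pys; apply: (le_trans (Pcontr _ _ yJ (ltW ysJ))).
    rewrite exprS invfM mulrCA ler_wpM2l// invr_ge0//.
  - by rewrite st1S addrC.
  - by rewrite st1S addrC.
  - by rewrite st1S -addn1 natrD mulrDl mul1r; move: IH4 tm; clear; lra.
(* Hitting times grow by at least [Tm] at each return, so they exhaust the half-line. *)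
have cover N t : (st N).1 <= t -> exists n, (N <= n)%N /\ (st n).1 <= t <= (st n.+1).1.
  move=> Nt.
  have ex : exists n, t < (st n).1.
    have [_ _ _ _] := stP 0%N.
    exists (Num.truncn (`|t - t3| / Tm)).+1.
    have [_ _ _] := stP (Num.truncn (`|t - t3| / Tm)).+1; apply: lt_le_trans.
    have := truncnS_gt (`|t - t3| / Tm); rewrite ltr_pdivrMr//.
    by have := ler_norm (t - t3); clear; lra.
  have [n nP nmin] := ex_minnP ex.
  have Nn : (N < n)%N.
    rewrite ltnNge; apply/negP => nN.
    have mon k : (st n).1 <= (st (n + k)%N).1.
      elim: k => [|k IH]; first by rewrite addn0.
      rewrite addnS st1S (le_trans IH)// lerDl.
      have [j1 _ _ _] := stP (n + k)%N.
      have E0 : ej / 2 ^+ (n + k) <= ej.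
        by rewrite ler_pdivrMr ?exprn_gt0// ler_peMr ?(ltW ej0)// exprn_ege1// ler1n.
      have /andP[+ _] := tauB _ (ejJ _ (le_trans j1 E0)); move: Tm0; clear; lra.
    by have := mon (N - n)%N; rewrite subnKC//; move: nP Nt; clear; lra.
  case: n nP nmin Nn => // n nP nmin Nn.
  exists n; split => //; rewrite (ltW nP) andbT leNgt; apply/negP => /nmin.
  by rewrite ltnn.
have close N t : (st N).1 <= t -> exists t',
    `|u t - x t'| <= K * (ej / 2 ^+ N) /\ `|v t - y t'| <= K * (ej / 2 ^+ N).
  move=> /cover[n [Nn /andP[nt tn]]].
  have [j1 j2 j3 _] := stP n.
  have E0 : ej / 2 ^+ n <= ej.
    by rewrite ler_pdivrMr ?exprn_gt0// ler_peMr ?(ltW ej0)// exprn_ege1// ler1n.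
  have /andP[_ tM] := tauB _ (ejJ _ (le_trans j1 E0)).
  have p0 : 0 <= ej / 2 ^+ n by rewrite divr_ge0 ?exprn_ge0// ltW.
  have := near_orbit u v (st n).1 0 (ej / 2 ^+ n) t S' p0.
  rewrite j2 j3 x0 y0 subrr normr0 => /(_ p0 j1) [].
    by rewrite nt /=; move: tn; rewrite st1S; move: tM T0; clear; lra.
  move=> h1 h2; exists (0 + (t - (st n).1)).
  have le : K * (ej / 2 ^+ n) <= K * (ej / 2 ^+ N).
    rewrite ler_wpM2l ?(ltW K0)// ler_wpM2l ?(ltW ej0)// lef_pV2 ?posrE ?exprn_gt0//.
    by rewrite ler_eXn2l// ltr1n.
  by rewrite (le_trans h1 le) (le_trans h2 le).
split.
- move=> t tge0; have [tt3|tt3] := leP t t3.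
    have tB : 0 <= t <= 3 * (tau ys) + TM by move: tge0 tt3 t3B; clear; lra.
    have [h1 h2] := near0 t tB; exists (t0 + t).
    by move: h1 h2 Kd m2 r0; clear; split; lra.
  have [t' [h1 h2]] := close 0%N t (ltW tt3).
  by exists t'; move: h1 h2 ejr ej0 K1 r0; rewrite expr0 divr1; clear; split; lra.
- move=> e e0; have [n nE] := halves_lt (K * ej) e0.
  exists (st n).1 => t /close[t' [h1 h2]]; exists t'.
  by move: nE h1 h2; rewrite -mulrA; clear; split; lra.
Qed.

(* A periodic solution close to an attracting cycle stays, by periodicity,
   arbitrarily close to it, hence lies on it. *)
Lemma orbit_isolated f g s yc w Tm TM P tau ys x y
    (O : return_orbit f g s yc w Tm TM P tau ys x y) : exists2 d, 0 < d & forall (u v : R -> R) T', 0 < T' ->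
  is_sol f g u v -> (forall t, u (t + T') = u t /\ v (t + T') = v t) ->
  (exists t0, `|u 0 - x t0| < d /\ `|v 0 - y t0| < d) ->
  exists t1, forall t, u t = x (t + t1) /\ v t = y (t + t1).
Proof.
have [[w0 Tm0 tauB PJ f_sec Pret Pcontr] [L fL gL] ysJ Pys S x0 y0] := O.
have T0 := orbit_T_gt0 O.
have [d d0 Hd] := orbit_attracts O ltr01; exists d => // u v T' T'0 S' per /(Hd _ _ S')[_ H].
have pern n t : u (t + n%:R * T') = u t /\ v (t + n%:R * T') = v t.
  elim: n => [|n [IH1 IH2]]; first by rewrite mul0r addr0.
  by rewrite -addn1 natrD mulrDl mul1r addrA (per _).1 (per _).2.
have [xC yC] := sol_cont S.
have dC : {within `[0, (tau ys)], continuous (fun t => `|u 0 - x t| + `|v 0 - y t|)}.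
  apply: continuous_subspaceT => t; apply: cvgD.
    by apply: cvg_norm; apply: cvgB; [exact: cvg_cst|exact: xC].
  by apply: cvg_norm; apply: cvgB; [exact: cvg_cst|exact: yC].
have [t1 _ t1min] := EVT_min (ltW T0) dC.
have E0 : `|u 0 - x t1| + `|v 0 - y t1| <= 0.
  rewrite leNgt; apply/negP => m0.
  have m20 : 0 < (`|u 0 - x t1| + `|v 0 - y t1|) / 2 by rewrite divr_gt0.
  have [t2 Ht2] := H _ m20.
  have n1 := truncnS_gt (`|t2| / T'); set n := (Num.truncn _).+1 in n1.
  have [|t' []] := Ht2 (0 + n%:R * T').
    by move: n1; rewrite ltr_pdivrMr// add0r; have := ler_norm t2; lra.
  rewrite (pern _ _).1 (pern _ _).2.
  have [t3 [t30 t3T -> ->]] := orbit_reduce O t'.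
  have := t1min t3; rewrite in_itv /= t30 (ltW t3T) => /(_ isT); lra.
exists t1; apply: (sol_unique fL gL S' (is_sol_shift t1 S)); rewrite add0r.
  have : `|u 0 - x t1| <= 0 by have := normr_ge0 (v 0 - y t1); lra.
  by rewrite normr_le0 subr_eq0 => /eqP.
have : `|v 0 - y t1| <= 0 by have := normr_ge0 (u 0 - x t1); lra.
by rewrite normr_le0 subr_eq0 => /eqP.
Qed.

End cycle.

(** * From scalar coordinates to orbits in the plane *)

Section planar_cycle.
Context {R : realType}.

Lemma vec2_0 (a b : R) : vec2 a b 0 0 = a.
Proof. by rewrite mxE. Qed.

Lemma vec2_1 (a b : R) : vec2 a b 0 1 = b.
Proof. by rewrite mxE. Qed.

Lemma vec2_eta (p : 'rV[R]_2) : vec2 (p 0 0) (p 0 1) = p.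
Proof.
apply/rowP => i; rewrite mxE; case: i => [[|[|//]] h] /=;
  by congr (p _ _); apply/val_inj.
Qed.

Lemma ord2 (i : 'I_2) : i = 0 \/ i = 1.
Proof. by case: i => [[|[|//]] h]; [left|right]; apply/val_inj. Qed.

Lemma is_derive_vec2 (x y : R -> R) (t dx dy : R) :
  is_derive t (1:R) x dx -> is_derive t (1:R) y dy ->
  is_derive t (1:R) (fun t => vec2 (x t) (y t)) (vec2 dx dy).
Proof.
move=> [xD xE] [yD yE].
have E0 : (fun t => vec2 (x t) (y t) 0 0) = x by apply/funext => s; rewrite vec2_0.
have E1 : (fun t => vec2 (x t) (y t) 0 1) = y by apply/funext => s; rewrite vec2_1.
have D : derivable (fun t => vec2 (x t) (y t)) t (1:R).
  apply/derivable_mxP => i j; rewrite (ord1 i).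
  case: (ord2 j) => ->.
    exact: (eq_ind_r (fun h : R -> R => derivable h t (1:R)) xD E0).
  exact: (eq_ind_r (fun h : R -> R => derivable h t (1:R)) yD E1).
split=> //; rewrite derive_mx//; apply/rowP => j; rewrite mxE.
by case: (ord2 j) => ->; [rewrite E0 vec2_0|rewrite E1 vec2_1].
Qed.

Lemma is_derive_coord (c : R -> 'rV[R]_2) (t : R) v i :
  is_derive t (1:R) c v -> is_derive t (1:R) (fun t => c t 0 i) (v 0 i).
Proof.
move=> [cD cE]; split; first by move/derivable_mxP : cD.
by rewrite -cE derive_mx// mxE.
Qed.

Lemma eucl_dist_le (p q : 'rV[R]_2) :
  eucl_dist p q <= `|p 0 0 - q 0 0| + `|p 0 1 - q 0 1|.
Proof.
rewrite /eucl_dist -[leRHS]ger0_norm ?addr_ge0// -sqrtr_sqr ler_wsqrtr//.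
rewrite [leRHS]sqrrD !real_normK ?num_real// lerD2r lerDl.
by rewrite mulrn_wge0// mulr_ge0.
Qed.

Lemma eucl_dist_coord (p q : 'rV[R]_2) i : `|p 0 i - q 0 i| <= eucl_dist p q.
Proof.
rewrite /eucl_dist -sqrtr_sqr ler_wsqrtr//.
by case: (ord2 i) => ->; rewrite ?lerDl ?lerDr sqr_ge0.
Qed.

Definition curve (x y : R -> R) (t : R) := vec2 (x t) (y t).

Lemma thickening_curve (x y : R -> R) (p : 'rV[R]_2) r : thickening (range (curve x y)) r p ->
  exists t, `|p 0 0 - x t| < r /\ `|p 0 1 - y t| < r.
Proof.
move=> [_ [t _ <-] pr]; exists t.
have := eucl_dist_coord p (curve x y t) 0; have := eucl_dist_coord p (curve x y t) 1.
rewrite vec2_0 vec2_1 => h1 h2.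
by split; [exact: le_lt_trans h2 pr|exact: le_lt_trans h1 pr].
Qed.

Lemma curve_thickening (x y : R -> R) (p : 'rV[R]_2) r t :
  `|p 0 0 - x t| < r / 2 -> `|p 0 1 - y t| < r / 2 ->
  thickening (range (curve x y)) r p.
Proof.
move=> h1 h2; exists (curve x y t); first by exists t.
rewrite (le_lt_trans (eucl_dist_le _ _))// vec2_0 vec2_1.
move: h1 h2; clear; lra.
Qed.

Variables (X : 'rV[R]_2 -> 'rV[R]_2) (f g : R -> R -> R) (B B' : R).
Hypothesis XE : forall p : 'rV[R]_2, `|p 0 0| < B -> `|p 0 1| < B ->
  X p = vec2 (f (p 0 0) (p 0 1)) (g (p 0 0) (p 0 1)).
Hypothesis BB' : B' < B.

Lemma curve_solution (x y : R -> R) I : is_sol f g x y ->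
  (forall t, I t -> `|x t| < B /\ `|y t| < B) -> solution_on X I (curve x y).
Proof.
move=> S IB.
have D t : is_derive t (1:R) (curve x y) (vec2 (f (x t) (y t)) (g (x t) (y t))).
  by have [xD yD] := S t; exact: is_derive_vec2.
split.
  apply: continuous_subspaceT => t.
  by apply/differentiable_continuous/derivable1_diffP; case: (D t).
move=> t /interior_subset /IB[xB yB].
have E : X (vec2 (x t) (y t)) = vec2 (f (x t) (y t)) (g (x t) (y t)).
  by rewrite XE ?vec2_0 ?vec2_1.
by have := D t; rewrite -E.
Qed.

Lemma solution_curve (c : R -> 'rV[R]_2) : solution_on X setT c ->
  (forall t, `|c t 0 0| < B /\ `|c t 0 1| < B) ->
  is_sol f g (fun t => c t 0 0) (fun t => c t 0 1).
Proof.
move=> [_ cD] cB t; have [c1 c2] := cB t.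
have {}cD : is_derive t (1:R) c (X (c t)) by apply: cD; rewrite interiorT.
rewrite XE// in cD.
by have := is_derive_coord 0 cD; have := is_derive_coord 1 cD; rewrite vec2_0 vec2_1.
Qed.

(** [X] is known to agree with the globally Lipschitz field ([f], [g]) on the open box of size [B],
    and the cycle lies in the box of size [B']. Neighbourhoods of radius at most [B - B'] stay in
    the larger box, so near the cycle solutions of either field, competing periodic orbits included,
    are solutions of the other. *)
Theorem attracting_limit_cycle L s yc w Tm TM P tau :
  lip L f -> lip L g -> return_map f g s yc w Tm TM P tau ->
  (forall x y : R -> R, is_sol f g x y -> x 0 = s -> `|y 0 - yc| <= w ->
     forall t, 0 <= t <= tau (y 0) -> `|x t| <= B' /\ `|y t| <= B') ->
  exists x y : R -> R, [/\ is_sol f g x y, x 0 = s, `|y 0 - yc| <= w,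
    (forall t, exists t', [/\ 0 <= t', t' <= tau (y 0), x t = x t' & y t = y t']) &
    limit_cycle X (range (curve x y)) /\ attracting X (range (curve x y))].
Proof.
move=> fL gL H HB.
have [ys ysJ Pys] := return_fixpoint H.
have [x [y [x0 y0 S]]] := flow_exists s ys fL gL.
have O : return_orbit f g s yc w Tm TM P tau ys x y.
  by split => //; exists L.
have yJ : `|y 0 - yc| <= w by rewrite y0 ltW.
have red t : exists t', [/\ 0 <= t', t' <= tau (y 0), x t = x t' & y t = y t'].
  by have [t' [t0 t1 h1 h2]] := orbit_reduce O t; exists t'; rewrite y0; split => //; exact: ltW.
have cB t : `|x t| <= B' /\ `|y t| <= B'.
  by have [t' [t0 t1 -> ->]] := red t; apply: (HB x y) => //; rewrite t0.
have cBs t : `|x t| < B /\ `|y t| < B.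
  by have [h1 h2] := cB t; rewrite !(le_lt_trans _ BB').
have T0 := orbit_T_gt0 O.
have BB0 : 0 < B - B' by rewrite subr_gt0.
have inB (p : 'rV[R]_2) t : `|p 0 0 - x t| < B - B' -> `|p 0 1 - y t| < B - B' ->
    `|p 0 0| < B /\ `|p 0 1| < B.
  have [h1 h2] := cB t; move=> h3 h4.
  have := ler_normD (p 0 0 - x t) (x t); have := ler_normD (p 0 1 - y t) (y t).
  rewrite !subrK; move: h1 h2 h3 h4; clear; split; lra.
have per : periodic_orbit X (range (curve x y)).
  exists (curve x y), (tau ys); split => //.
  - exact: curve_solution.
  - by move=> t; have [e1 e2] := orbit_periodic O t; rewrite /curve e1 e2.
  - have [h [h0 _ _ xh _]] := orbit_section O ltr01.
    exists h; apply/eqP => /(congr1 (fun p : 'rV[R]_2 => p 0 0)).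
    by rewrite !vec2_0 x0 => E; rewrite E ltxx in xh.
have attr : attracting X (range (curve x y)).
  move=> r r0; pose r' := Num.min (r / 2) (B - B').
  have r'0 : 0 < r' by rewrite lt_min divr_gt0// BB0.
  have [d d0 Hd] := orbit_attracts O r'0.
  exists d => // p /thickening_curve pd.
  have [u [v [u0 v0 S']]] := flow_exists (p 0 0) (p 0 1) fL gL.
  have pd' : exists t0, `|u 0 - x t0| < d /\ `|v 0 - y t0| < d by rewrite u0 v0.
  have [Hr He] := Hd u v S' pd'.
  have Hr2 t : 0 <= t -> exists t', [/\ `|u t - x t'| < r / 2, `|v t - y t'| < r / 2,
      `|u t - x t'| < B - B' & `|v t - y t'| < B - B'].
    by move=> /Hr[t' []]; rewrite !lt_min => /andP[? ?] /andP[? ?]; exists t'.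
  exists (curve u v); split.
  - apply: curve_solution => // t; rewrite /= in_itv /= andbT => /Hr2[t' [_ _ h1 h2]].
    have := @inB (curve u v t) t'; rewrite vec2_0 vec2_1; exact.
  - by rewrite /curve u0 v0 vec2_eta.
  - move=> t /Hr2[t' [h1 h2 _ _]]; apply: (@curve_thickening _ _ _ _ t');
    by rewrite ?vec2_0 ?vec2_1.
  - move=> e e0; have e20 : 0 < e / 2 by rewrite divr_gt0.
    have [t1 Ht1] := He _ e20; exists t1; split; first exact: num_real.
    move=> t t1t; have [t' [h1 h2]] := Ht1 t (ltW t1t).
    by apply: (@curve_thickening _ _ _ _ t'); rewrite ?vec2_0 ?vec2_1.
exists x, y; split => //; split => //; split => //.
have [d d0 Hd] := orbit_isolated O.
pose r := Num.min d (B - B').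
exists r; first by rewrite lt_min d0 BB0.
move=> G' [c [T' [cS T'0 cT _ ->]]] sub.
have nearc t : exists t', [/\ `|c t 0 0 - x t'| < d, `|c t 0 1 - y t'| < d,
      `|c t 0 0 - x t'| < B - B' & `|c t 0 1 - y t'| < B - B'].
  have /sub/thickening_curve[t' []] : range c (c t) by exists t.
  by rewrite !lt_min => /andP[? ?] /andP[? ?]; exists t'.
have cI t : `|c t 0 0| < B /\ `|c t 0 1| < B.
  by have [t' [_ _ h1 h2]] := nearc t; exact: inB h1 h2.
have S' := solution_curve cS cI.
have [||t1 Ht1] := Hd _ _ T' T'0 S'.
- by move=> t; rewrite cT.
- by have [t' [h1 h2 _ _]] := nearc 0; exists t'.
have cE t : c t = curve x y (t + t1).
  by rewrite -[LHS]vec2_eta; have [-> ->] := Ht1 t.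
apply/seteqP; split => _ [t _ <-].
  by exists (t + t1) => //; rewrite cE.
by exists (t - t1) => //; rewrite cE subrK.
Qed.

End planar_cycle.

(** * Passage through a thin strip *)

Section strip.
Context {R : realType}.

Definition clamp (c r z : R) := Num.max (c - r) (Num.min z (c + r)).

Lemma clamp_in c r z : 0 <= r -> `|clamp c r z - c| <= r.
Proof.
move=> r0; have h1 : c - r <= clamp c r z by rewrite le_max lexx.
have h2 : clamp c r z <= c + r by rewrite ge_max ge_min lexx orbT andbT; lra.
by rewrite ler_norml; move: h1 h2; clear; lra.
Qed.

Lemma clamp_id c r z : `|z - c| <= r -> clamp c r z = z.
Proof.
by rewrite ler_norml => /andP[? ?]; rewrite /clamp min_l ?max_r//; lra.
Qed.

Lemma clamp_lip c r z z' : `|clamp c r z - clamp c r z'| <= `|z - z'|.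
Proof.
wlog zz : z z' / z <= z'.
  move=> H; have [h|/ltW h] := leP z z'; first exact: H.
  by rewrite distrC [leRHS]distrC; exact: H.
rewrite [leRHS]distrC [leRHS]ger0_norm ?subr_ge0// ler_norml /clamp.
have [a1|a1] := leP (c - r) (Num.min z (c + r));
have [a2|a2] := leP (c - r) (Num.min z' (c + r)); move: a1 a2;
have [h1|h1] := leP z (c + r); have [h2|h2] := leP z' (c + r) => a1 a2;
  by apply/andP; split; lra.
Qed.

(** As q'/p' is bounded by S, a single factor 1/m is lost instead of 1/m^2; at p^L, [m] is
    proportional to the smallest admissible [eta]. *)
Lemma slope_lip (m S p q p' q' : R) : 0 < m -> m <= p -> m <= p' -> 0 <= S ->
  `|q'| <= S * p' -> `|q / p - q' / p'| <= (`|q - q'| + S * `|p - p'|) / m.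
Proof.
move=> m0 mp mp' S0 qS.
have p0 : 0 < p := lt_le_trans m0 mp; have p'0 : 0 < p' := lt_le_trans m0 mp'.
have -> : q / p - q' / p' = ((q - q') + q' / p' * (p' - p)) / p.
  by field; rewrite !gt_eqF.
have h1 : `|q' / p'| <= S.
  by rewrite normrM normfV (gtr0_norm p'0) ler_pdivrMr.
have h2 : `|(q - q') + q' / p' * (p' - p)| <= `|q - q'| + S * `|p - p'|.
  rewrite (le_trans (ler_normD _ _))// lerD2l normrM (distrC p p').
  by rewrite ler_wpM2r.
rewrite normrM normfV (gtr0_norm p0) (le_trans (ler_wpM2r _ h2))// ?invr_ge0 ?(ltW p0)//.
rewrite ler_wpM2l// ?addr_ge0// ?mulr_ge0//.
by rewrite lef_pV2.
Qed.

Lemma expansion_bound (u du : R -> R) (k T : R) : 0 < k -> 0 <= T -> k * T <= 1 ->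
  (forall t : R, is_derive t (1:R) u (du t)) ->
  (forall t, 0 < t < T -> `|du t| <= k * `|u t|) ->
  `|u T| <= expR 1 * `|u 0|.
Proof.
move=> k0 T0 kT uD ub.
have D (t : R) : is_derive t (1:R) (fun t => u t * u t) (2 * (u t * du t)).
  by have := uD t => D; apply: is_derive_eq; rewrite /GRing.scale/=; ring.
have k20 : 2 * k != 0 by rewrite lt0r_neq0// mulr_gt0.
have := @linear_gronwall _ (fun t => u t * u t) _ (2 * k) 0 0 T T0 k20 (fun t _ => D t)
   (is_derive_within D).
rewrite mul0r !addr0 subr0 => H.
have {}H : u T * u T <= u 0 * u 0 * expR (2 * k * T).
  apply: H => t /ub h; rewrite addr0 -mulrA ler_wpM2l// (le_trans (ler_norm _))//.
  have -> : k * (u t * u t) = `|u t| * (k * `|u t|).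
    by rewrite -[u t * u t]expr2 -real_normK ?num_real// expr2; ring.
  by rewrite normrM ler_wpM2l.
have E1 : expR (2 * k * T) <= expR 1 * expR 1 by rewrite -expRD ler_expR; lra.
have uu : 0 <= u 0 * u 0 by rewrite -expr2 sqr_ge0.
have := ler_wpM2l uu E1 => /(le_trans H) {}H.
have e0 : 0 <= expR 1 * `|u 0| by rewrite mulr_ge0 ?expR_ge0.
rewrite -(ler_pXn2r (n := 2))// ?nnegrE// real_normK ?num_real// exprMn real_normK ?num_real//.
by move: H; rewrite !expr2; lra.
Qed.

(* In the strip x is the independent variable: along orbits dy/dx = F2 / F1. *)
Lemma strip_transit (F1 F2 : R -> R -> R) (LF Ly m S delta w yc : R) :
  lip LF F1 -> lip LF F2 -> 0 < Ly -> 0 < m -> 0 <= S -> 0 < delta -> 0 <= w ->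
  (forall x y, `|x - 1| <= delta -> `|y - yc| <= w ->
     m <= F1 x y /\ `|F2 x y| <= S * F1 x y) ->
  (forall x y y', `|x - 1| <= delta -> `|F1 x y - F1 x y'| <= Ly * `|y - y'| /\
     `|F2 x y - F2 x y'| <= Ly * `|y - y'|) ->
  Ly * (1 + S) / m * (2 * delta) <= 1 ->
  exists Y : R -> R,
  (forall x y : R -> R, is_sol F1 F2 x y -> x 0 = 1 - delta ->
     `|y 0 - yc| + 2 * S * delta <= w ->
     exists t, [/\ 0 < t, t <= 2 * delta / m, x t = 1 + delta, y t = Y (y 0) &
       forall s, 0 <= s <= t -> `|x s - 1| <= delta /\ `|y s - y 0| <= 2 * S * delta]) /\
  (forall a b, `|Y a - Y b| <= expR 1 * `|a - b|).
Proof.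
move=> F1L F2L Ly0 m0 S0 d0 w0 rect Lipy small.
have LF0 := lip_ge0 F1L.
(* Clamping to the rectangle makes the slope q/p globally defined, with denominator at least [m];
   the clamps are inactive on the orbits considered. *)
pose cx := clamp 1 delta; pose cy := clamp yc w.
have cxI z : `|cx z - 1| <= delta by apply: clamp_in; exact: ltW.
have cyI z : `|cy z - yc| <= w by apply: clamp_in.
pose p x y := F1 (cx x) (cy y); pose q x y := F2 (cx x) (cy y).
have pm x y : m <= p x y by have [] := rect _ _ (cxI x) (cyI y).
have qS x y : `|q x y| <= S * p x y by have [] := rect _ _ (cxI x) (cyI y).
have cL h : lip LF h -> lip LF (fun x y => h (cx x) (cy y)).
  move=> hL x y x' y'; rewrite (le_trans (hL _ _ _ _))// ler_wpM2l// lerD//; exact: clamp_lip.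
have pL : lip LF p := cL _ F1L; have qL : lip LF q := cL _ F2L.
pose G x y := q x y / p x y.
have p0 x y : 0 < p x y := lt_le_trans m0 (pm x y).
(* This constant contains [LF], which may be huge, and serves for existence. The expansion factor
   rests on the next bound, in y alone. *)
have GL : lip ((LF + S * LF) / m) G.
  move=> x y x' y'; rewrite (le_trans (slope_lip _ m0 (pm x y) (pm x' y') S0 (qS x' y')))//.
  rewrite mulrAC ler_pM2r ?invr_gt0// mulrDl -mulrA lerD//.
  by rewrite ler_wpM2l//; exact: pL.
have GLy x y y' : `|G x y - G x y'| <= Ly * (1 + S) / m * `|y - y'|.
  rewrite (le_trans (slope_lip _ m0 (pm x y) (pm x y') S0 (qS x y')))//.
  rewrite [leRHS]mulrAC ler_pM2r ?invr_gt0// [Ly * _]mulrC mulrDl mul1r mulrDl.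
  have [h1 h2] := Lipy (cx x) (cy y) (cy y') (cxI x).
  have h3 : Ly * `|cy y - cy y'| <= Ly * `|y - y'| by rewrite ler_wpM2l ?(ltW Ly0)//; exact: clamp_lip.
  rewrite lerD//; first exact: le_trans h2 h3.
  by rewrite -mulrA ler_wpM2l//; exact: le_trans h1 h3.
have GS x y : `|G x y| <= S by rewrite normrM normfV (gtr0_norm (p0 _ _)) ler_pdivrMr.
(* The nonautonomous equation h' = G(1 - delta + s, h) is solved as a planar system whose first
   coordinate moves with unit speed. *)
have exh a : exists h : R -> R, h 0 = a /\ forall s : R, is_derive s (1:R) h (G (1 - delta + s) (h s)).
  have one : lip 0 (fun _ _ : R => (1:R)) by move=> x y x' y'; rewrite subrr normr0 mul0r.
  have GL0 := lip_ge0 GL.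
  have [X [h [X0 h0 Sol]]] := flow_exists (1 - delta) a (lipW GL0 one) GL.
  exists h; split=> // s; have [_ hD] := Sol s.
  suff -> : 1 - delta + s = X s by [].
  have XsD (r : R) : is_derive r (1:R) (fun s => X s - s) 0.
    by have [XD _] := Sol r; apply: is_derive_eq; rewrite subrr.
  have := is_derive_0_is_cst s 0 XsD; rewrite X0; clear; lra.
have [h hP] := choice exh.
have hS a s s' : `|h a s - h a s'| <= S * `|s - s'|.
  wlog ss : s s' / s <= s'.
    move=> H; have [h1|/ltW h1] := leP s s'; first exact: H.
    by rewrite distrC [`|s - s'|]distrC; exact: H.
  have D := (hP a).2.
  have := @der_le _ (h a) _ s s' S ss (fun t _ => D t) (is_derive_within D).
  have := @der_ge _ (h a) _ s s' (- S) ss (fun t _ => D t) (is_derive_within D).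
  have GS' x y : - S <= G x y <= S by rewrite -ler_norml.
  move=> /(_ (fun t _ => proj1 (andP (GS' _ _)))) h1.
  move=> /(_ (fun t _ => proj2 (andP (GS' _ _)))) h2.
  rewrite distrC [`|s - s'|]distrC (ger0_norm (x := s' - s)) ?subr_ge0// ler_norml.
  by move: h1 h2; rewrite mulNr => -> ->.
exists (fun a => h a (2 * delta)); split; last first.
  move=> a b.
  have D (s : R) : is_derive s (1:R) (fun s => h a s - h b s)
      (G (1 - delta + s) (h a s) - G (1 - delta + s) (h b s)).
    by have := (hP a).2 s => D1; have := (hP b).2 s => D2; apply: is_derive_eq.
  have k0 : 0 < Ly * (1 + S) / m by rewrite divr_gt0// mulr_gt0// ltr_wpDr.
  have dd0 : 0 <= 2 * delta by rewrite mulr_ge0// ltW.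
  have := expansion_bound k0 dd0 small D (fun t _ => GLy _ _ _).
  by rewrite (hP a).1 (hP b).1.
move=> x y Sol x0 y0w; set a := y 0 in y0w *.
(* Time is recovered afterwards: [th], the distance travelled in x, solves th' = p along the graph
   of [h a]. The second coordinate is a dummy that puts a scalar equation in planar form. *)
pose Th (th _ : R) := p (1 - delta + th) (h a th).
have ThL : lip (LF * (1 + S)) Th.
  move=> t _u t' u'; rewrite (le_trans (pL _ _ _ _))// -mulrA ler_wpM2l//.
  have -> : 1 - delta + t - (1 - delta + t') = t - t' by ring.
  rewrite mulrDl mul1r lerD ?lerDl//.
  by rewrite (le_trans (hS _ _ _))// mulrDr lerDl mulr_ge0.
have zeroL : lip (LF * (1 + S)) (fun _ _ : R => (0:R)).
  by move=> *; rewrite subrr normr0 mulr_ge0 ?addr_ge0// mulr_ge0// addr_ge0.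
have [th [dum [th0 _ thS]]] := flow_exists 0 0 ThL zeroL.
have thD (t : R) : is_derive t (1:R) th (p (1 - delta + th t) (h a (th t))) := (thS t).1.
have thC := is_derive_within thD.
have T0 : 0 <= 2 * delta / m by rewrite divr_ge0 ?(ltW m0)// mulr_ge0// ltW.
have thm t t' : t <= t' -> m * (t' - t) <= th t' - th t.
  by move=> tt; apply: (der_ge tt (fun t _ => thD t) (thC _ _)) => s _.
have end_ : 2 * delta <= th (2 * delta / m).
  have := thm _ _ T0; rewrite th0 !subr0 mulrC divfK//; exact: lt0r_neq0.
have start : th 0 < 2 * delta by rewrite th0 mulr_gt0.
have [t [t0 tT tht thlt]] := first_hit T0 (thC _ _) start end_.
have thb s : 0 <= s <= t -> 0 <= th s <= 2 * delta.
  move=> /andP[s0 st]; have h1 := thm _ _ s0; have h2 := thm _ _ st.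
  have n1 : 0 <= m * (s - 0) by rewrite mulr_ge0 ?(ltW m0)// subr_ge0.
  have n2 : 0 <= m * (t - s) by rewrite mulr_ge0 ?(ltW m0)// subr_ge0.
  by move: h1 h2 n1 n2; rewrite th0 tht; clear; lra.
have xb s : 0 <= s <= t -> `|1 - delta + th s - 1| <= delta.
  by move=> /thb; rewrite ler_norml; clear; lra.
have yb s : 0 <= s <= t -> `|h a (th s) - a| <= 2 * S * delta.
  move=> /thb /andP[s1 s2]; have := hS a (th s) 0; rewrite (hP a).1 subr0 (ger0_norm s1).
  move=> h1; apply: (le_trans h1); have -> : 2 * S * delta = S * (2 * delta) by ring.
  by rewrite ler_wpM2l//.
have ybc s : 0 <= s <= t -> `|h a (th s) - yc| <= w.
  move=> /yb h1; have := ler_normD (h a (th s) - a) (a - yc).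
  by rewrite addrA subrK; move: h1 y0w; clear; lra.
have XD (s : R) : is_derive s (1:R) (fun s => 1 - delta + th s) (p (1 - delta + th s) (h a (th s))).
  by have := thD s => D; apply: is_derive_eq; rewrite /GRing.scale/=; ring.
have YD (s : R) : is_derive s (1:R) (fun s => h a (th s))
    (G (1 - delta + th s) (h a (th s)) * p (1 - delta + th s) (h a (th s))).
  exact: (@is_derive1_comp R (h a) th s _ _ ((hP a).2 (th s)) (thD s)).
have U : forall s, 0 <= s <= t -> 1 - delta + th s = x s /\ h a (th s) = y s.
  apply: (sol_unique_on F1L F2L (fun s _ => XD s) (fun s _ => YD s) (is_derive_within XD)
    (is_derive_within YD) _ Sol); last 2 first.
  - by rewrite th0 addr0.
  - by rewrite th0 (hP a).1.
  move=> s /andP[s0 st]; have sb : 0 <= s <= t by rewrite !ltW.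
  rewrite /G divfK ?lt0r_neq0//.
  by rewrite /p /q /cx /cy !clamp_id// ?(xb s)// (ybc s).
exists t; split => //.
- have tb : 0 <= t <= t by rewrite lexx ltW.
  by have [<- _] := U t tb; rewrite tht; ring.
- have tb : 0 <= t <= t by rewrite lexx ltW.
  by have [_ <-] := U t tb; rewrite tht.
- move=> s sb; have [<- <-] := U s sb.
  by split; [exact: xb|exact: yb].
Qed.

(** Reflection in the line x = 1 turns a crossing to the left into one to the right, the case
    treated by [strip_transit]. *)
Lemma is_sol_reflect (F1 F2 : R -> R -> R) (x y : R -> R) : is_sol F1 F2 x y ->
  is_sol (fun a b => - F1 (2 - a) b) (fun a b => F2 (2 - a) b) (fun t => 2 - x t) y.
Proof.
move=> S t; have [D1 D2] := S t; rewrite opprB [2 + _]addrC subrK; split=> //.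
by apply: is_derive_eq; rewrite /GRing.scale/=; ring.
Qed.

End strip.

(** * Transit along an arc of the right field *)

Section stage_right.
Context {R : realType}.

(** Arrival ordinates define a map because the Lipschitz estimate, applied to two orbits with the
    same starting ordinate, shows that they arrive at the same point, even if the arrival time is
    not determined. *)
Lemma choose_map (S : (R -> R) -> (R -> R) -> Prop) (adm : R -> Prop)
    (Q : (R -> R) -> (R -> R) -> R -> Prop) K :
  (forall a, exists x y : R -> R, S x y /\ y 0 = a) ->
  (forall x y : R -> R, S x y -> adm (y 0) -> exists t, Q x y t) ->
  (forall (x y : R -> R) t (x' y' : R -> R) t', S x y -> S x' y' -> adm (y 0) -> adm (y' 0) ->
     Q x y t -> Q x' y' t' -> `|y t - y' t'| <= K * `|y 0 - y' 0|) ->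
  exists Y : R -> R,
    (forall x y : R -> R, S x y -> adm (y 0) -> exists t, Q x y t /\ y t = Y (y 0)) /\
    (forall a b, adm a -> adm b -> `|Y a - Y b| <= K * `|a - b|).
Proof.
move=> H3 H1 H2.
have ex a : exists b, adm a -> exists (x y : R -> R) t, [/\ S x y, y 0 = a, Q x y t & y t = b].
  have [x [y [Sxy y0]]] := H3 a.
  have [aa|naa] := pselect (adm a); last by exists 0.
  have aa' : adm (y 0) by rewrite y0.
  have [t Qt] := H1 x y Sxy aa'.
  by exists (y t) => _; exists x, y, t.
have [Y YP] := choice ex; exists Y; split.
  move=> x y Sxy ay; have [t Qt] := H1 x y Sxy ay; exists t; split => //.
  have [x' [y' [t' [S' y'0 Q' <-]]]] := YP _ ay.
  have ay' : adm (y' 0) by rewrite y'0.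
  have := H2 _ _ _ _ _ _ Sxy S' ay ay' Qt Q'.
  by rewrite y'0 subrr normr0 mulr0 normr_le0 subr_eq0 => /eqP.
move=> a b aa ab.
have [x [y [t [Sxy y0 Q1 <-]]]] := YP _ aa.
have [x' [y' [t' [S' y'0 Q' <-]]]] := YP _ ab.
have a1 : adm (y 0) by rewrite y0.
have a2 : adm (y' 0) by rewrite y'0.
by have := H2 _ _ _ _ _ _ Sxy S' a1 a2 Q1 Q'; rewrite y0 y'0.
Qed.

(** Displacement in y is measured against displacement in x. Two orbits that reach a section at
    different times are compared when the first arrives; what the second still has to travel in x is
    already controlled by that comparison. *)
Lemma drift_bound (x y dx dy : R -> R) (m N a b : R) : 0 < m -> 0 <= N -> a <= b ->
  (forall t : R, is_derive t (1:R) x (dx t)) -> (forall t : R, is_derive t (1:R) y (dy t)) ->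
  (forall t, a < t < b -> dx t <= - m) -> (forall t, a < t < b -> `|dy t| <= N) ->
  m * (b - a) <= x a - x b /\ `|y b - y a| <= N / m * (x a - x b).
Proof.
move=> m0 N0 ab xD yD dxm dyN.
have h1 := der_le ab (fun t _ => xD t) (is_derive_within xD) dxm.
have h2 : `|y b - y a| <= N * (b - a).
  have dyN' t : a < t < b -> - N <= dy t <= N by move=> /dyN; rewrite ler_norml.
  have h3 := der_le ab (fun t _ => yD t) (is_derive_within yD) (fun t tab => proj2 (andP (dyN' t tab))).
  have h4 := der_ge ab (fun t _ => yD t) (is_derive_within yD) (fun t tab => proj1 (andP (dyN' t tab))).
  by rewrite ler_norml; move: h3 h4; clear; lra.
have h3 : m * (b - a) <= x a - x b by move: h1; clear; lra.
split=> //; rewrite (le_trans h2)// -mulrA ler_wpM2l// mulrC ler_pdivlMr// mulrC//.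
Qed.

Lemma shadowing (Lz T : R) : 0 <= Lz -> 0 <= T -> exists2 K, 1 <= K &
  forall (f g f' g' : R -> R -> R) (x y x' y' : R -> R) (d e : R), 0 <= d -> 0 <= e ->
  lip Lz f -> lip Lz g -> is_sol f g x y -> is_sol f' g' x' y' ->
  (forall a b, `|f a b - f' a b| <= e) -> (forall a b, `|g a b - g' a b| <= e) ->
  `|x 0 - x' 0| <= d -> `|y 0 - y' 0| <= d ->
  forall t, 0 <= t <= T -> `|x t - x' t| <= K * (d + e) /\ `|y t - y' t| <= K * (d + e).
Proof.
move=> L0 T0; have [K K1 HK] := gronwall L0 T0.
exists K => // f g f' g' x y x' y' d e d0 e0 fL gL S S' ff gg x0 y0 t /andP[t0 tT].
have D1 (r : R) : is_derive r (1:R) (fun r => x r - x' r) (f (x r) (y r) - f' (x' r) (y' r)).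
  by have [A _] := S r; have [A' _] := S' r; apply: is_derive_eq.
have D2 (r : R) : is_derive r (1:R) (fun r => y r - y' r) (g (x r) (y r) - g' (x' r) (y' r)).
  by have [_ A] := S r; have [_ A'] := S' r; apply: is_derive_eq.
have t0T : 0 <= t <= 0 + T by rewrite add0r t0.
apply: (HK _ _ _ _ 0 t d e t0T d0 e0 (fun r _ => D1 r) (fun r _ => D2 r)
  (is_derive_within D1) (is_derive_within D2)) => // r _.
  have -> : f (x r) (y r) - f' (x' r) (y' r) = (f (x r) (y r) - f (x' r) (y' r)) +
    (f (x' r) (y' r) - f' (x' r) (y' r)) by ring.
  by rewrite (le_trans (ler_normD _ _))// lerD.
have -> : g (x r) (y r) - g' (x' r) (y' r) = (g (x r) (y r) - g (x' r) (y' r)) +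
  (g (x' r) (y' r) - g' (x' r) (y' r)) by ring.
by rewrite (le_trans (ler_normD _ _))// lerD.
Qed.

Lemma lip_ball (L : R) (f : R -> R -> R) (a b r x y : R) : lip L f ->
  `|x - a| <= r -> `|y - b| <= r -> `|f x y - f a b| <= 2 * L * r.
Proof.
move=> fL xa yb; rewrite (le_trans (fL _ _ _ _))//.
have := lip_ge0 fL => L0.
have -> : 2 * L * r = L * (r + r) by ring.
by rewrite ler_wpM2l// lerD.
Qed.

(** Each list to which this is applied collects the smallness requirements on one constant. *)
Lemma lt_bounds (S : seq R) : all (fun r => 0 < r) S ->
  exists2 h : R, 0 < h & all (fun r => h <= r) S.
Proof.
elim: S => [|r S IH] /=; first by exists 1.
move=> /andP[r0 /IH[h h0 hS]]; exists (Num.min r h); first by rewrite lt_min r0.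
rewrite ge_min lexx /=; by apply: sub_all hS => x hx; rewrite ge_min hx orbT.
Qed.

(** The orbits shadow the arc ([xr], [yr]) on [0, TR + 1] with error O(s). They leave the section
    with [Z1 >= m], stay beyond it in the middle because the arc does, and come back with
    [Z1 <= - m], hence hit it near [TR]. Two orbits are compared at the earlier of their hitting
    times, and the rest is paid for by [drift_bound]. *)
Lemma return_transit (r1 r2 : R -> R -> R) (Lz M C TR yL yq kap : R) (xr yr : R -> R) :
  lip Lz r1 -> lip Lz r2 -> 0 < M -> 0 <= C ->
  (forall x y, `|r1 x y| <= M) -> (forall x y, `|r2 x y| <= M) ->
  is_sol r1 r2 xr yr -> 0 < TR -> 0 < kap ->
  xr 0 = 1 -> yr 0 = yL -> xr TR = 1 -> yr TR = yq ->
  (forall t, 0 < t < TR -> 1 < xr t) -> 0 < r1 1 yL -> r1 1 yq < 0 ->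
  exists K h, [/\ 1 <= K, 0 < h &
  forall (Z1 Z2 : R -> R -> R) (delta s : R), lip Lz Z1 -> lip Lz Z2 ->
  (forall x y, `|Z1 x y - r1 x y| <= C * s) -> (forall x y, `|Z2 x y - r2 x y| <= C * s) ->
  0 < delta -> delta <= s -> s <= h ->
  exists Y : R -> R,
  (forall x y : R -> R, is_sol Z1 Z2 x y /\ x 0 = 1 + delta -> `|y 0 - yL| <= s ->
    exists t, [/\ TR / 2 <= t <= TR + 1, `|t - TR| <= kap, x t = 1 + delta, `|y t - yq| <= K * s &
      forall r, 0 <= r <= t -> [/\ 1 + delta <= x r, `|x r - xr r| <= kap & `|y r - yr r| <= kap]]
      /\ y t = Y (y 0)) /\
  (forall a b, `|a - yL| <= s -> `|b - yL| <= s -> `|Y a - Y b| <= K * `|a - b|)].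
Proof.
move=> r1L r2L M0 C0 r1M r2M Sr TR0 kap0 xr0 yr0 xrT yrT xr_right r1p r1q.
have Lz0 := lip_ge0 r1L.
have T10 : 0 <= TR + 1 by rewrite addr_ge0// ltW.
have [K1 K11 HK1] := shadowing Lz0 T10.
have [m m0 /= /and3P[mp mq _]] : exists2 m, 0 < m & all (fun r => m <= r) [:: r1 1 yL / 4; - r1 1 yq / 4].
  by apply: lt_bounds; rewrite /= !divr_gt0 ?oppr_gt0.
(* In a ball of this radius [Z1] changes by at most [m]. *)
pose rho := m / (2 * (Lz + 1)).
have rho0 : 0 < rho by rewrite divr_gt0// mulr_gt0// ltr_wpDl.
have rhom : 2 * Lz * rho <= m.
  have Lz1 : 0 < Lz + 1 by rewrite ltr_wpDl.
  have -> : 2 * Lz * rho = m * Lz / (Lz + 1) by rewrite /rho; field; exact: lt0r_neq0.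
  by rewrite ler_pdivrMr// ler_wpM2l ?(ltW m0)// lerDl.
(* The last entry keeps the arc, of speed at most [M], within rho / 2 of an end point for a time
   [t1] before or after it. *)
have [t1 t10 /= /and5P[t1k t11 t1T t1M _]] : exists2 t1, 0 < t1 &
    all (fun r => t1 <= r) [:: kap; 1; TR / 4; rho / (2 * M)].
  by apply: lt_bounds; apply/and5P; split=> //; apply: divr_gt0 => //; apply: mulr_gt0.
have [tm0 tm1] : TR - t1 <= TR + t1 /\ t1 <= TR - t1.
  by move: t10 t1T TR0 => ? ? ?; split; lra.
have [tmin tminI tminP] := EVT_min tm1 (is_derive_within (fun t => (Sr t).1) : {within `[t1, TR - t1], continuous xr}).
(* Gap between the middle part of the arc and x = 1; the shadowing error and [delta] have to fit
   into half of it. *)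
pose d1 := xr tmin - 1.
have d10 : 0 < d1.
  rewrite subr_gt0; apply: xr_right; move: tminI; rewrite in_itv /=; move: t10 TR0 => ? ?; lra.
pose K2 := K1 * (1 + C).
have K20 : 1 <= K2 by rewrite -[leLHS]mulr1 ler_pM// lerDl.
have K2p : 0 < K2 by apply: lt_le_trans K20.
(* Shadowing error [K2], one unit for [delta <= s], and the drift of slope at most 2 M / m until the
   hit. *)
pose K := (K2 + 1) * (1 + 2 * M / m).
have Mm0 : 0 < 2 * M / m by rewrite divr_gt0// mulr_gt0.
have [h h0 /= /and5P[hC hM hrho hkap /and3P[hd hmt _]]] : exists2 h, 0 < h &
    all (fun r => h <= r) [:: m / (C + 1); M / (C + 1); rho / (2 * K2); kap / K2; d1 / (2 * (K2 + 1));
     m * t1 / (2 * K2)].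
  have C1 : 0 < C + 1 by rewrite ltr_wpDl.
  by apply: lt_bounds; apply/and5P; split; last (apply/and3P; split=> //);
    apply: divr_gt0 => //; repeat apply: mulr_gt0 => //; apply: addr_gt0.
exists K, h; split => //.
  rewrite -[leLHS]mulr1 ler_pM//; first by move: K20; clear; lra.
  by rewrite lerDl ltW.
move=> Z1 Z2 delta s Z1L Z2L Z1r Z2r d0 ds sh.
have s0 : 0 < s := lt_le_trans d0 ds.
have C1 : 0 < C + 1 by rewrite ltr_wpDl.
have b1 : C * s <= m.
  rewrite (@le_trans _ _ ((C + 1) * s))//; first by rewrite ler_wpM2r ?(ltW s0)// lerDl.
  by rewrite mulrC -ler_pdivlMr// (le_trans sh).
have b1' : C * s <= M.
  rewrite (@le_trans _ _ ((C + 1) * s))//; first by rewrite ler_wpM2r ?(ltW s0)// lerDl.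
  by rewrite mulrC -ler_pdivlMr// (le_trans sh).
have K22 : 0 < 2 * K2 by exact: mulr_gt0.
have K21 : 0 < 2 * (K2 + 1) by apply: mulr_gt0 => //; exact: addr_gt0.
have b2 : 2 * (K2 * s) <= rho.
  by have := le_trans sh hrho; rewrite (ler_pdivlMr _ _ K22); move: (K2) => k; clear; lra.
have b3 : K2 * s <= kap by rewrite mulrC -(ler_pdivlMr _ _ K2p) (le_trans sh).
have b4 : 2 * ((K2 + 1) * s) <= d1.
  by have := le_trans sh hd; rewrite (ler_pdivlMr _ _ K21); move: (K2) => k; clear; lra.
have b5 : 2 * (K2 * s) <= m * t1.
  by have := le_trans sh hmt; rewrite (ler_pdivlMr _ _ K22); move: (K2) => k; clear; lra.
have Z1M x y : `|Z1 x y| <= 2 * M.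
  have := ler_normD (Z1 x y - r1 x y) (r1 x y); rewrite subrK.
  by move: (Z1r x y) (r1M x y) b1'; clear; lra.
have Z2M x y : `|Z2 x y| <= 2 * M.
  have := ler_normD (Z2 x y - r2 x y) (r2 x y); rewrite subrK.
  by move: (Z2r x y) (r2M x y) b1'; clear; lra.
have xr_near t t' : `|t - t'| <= t1 -> `|xr t - xr t'| <= rho / 2 /\ `|yr t - yr t'| <= rho / 2.
  have tMr : M * t1 <= rho / 2.
    by move: t1M; rewrite ler_pdivlMr ?mulr_gt0//; clear; lra.
  wlog tt : t t' / t' <= t.
    move=> H; have [h1|/ltW h1] := leP t' t; first exact: H.
    by rewrite distrC => /(H _ _ h1); rewrite [`|xr _ - _|]distrC [`|yr _ - _|]distrC.
  rewrite ger0_norm ?subr_ge0// => ht.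
  have gen (z dz : R -> R) : (forall t : R, is_derive t (1:R) z (dz t)) -> (forall t, `|dz t| <= M) ->
      `|z t - z t'| <= rho / 2.
    move=> zD zM.
    have zM' r : - M <= dz r <= M by rewrite -ler_norml.
    have e1 := der_le tt (fun t _ => zD t) (is_derive_within zD) (fun r _ => proj2 (andP (zM' r))).
    have e2 := der_ge tt (fun t _ => zD t) (is_derive_within zD) (fun r _ => proj1 (andP (zM' r))).
    have e3 : M * (t - t') <= M * t1 by rewrite ler_wpM2l// ltW.
    by rewrite ler_norml; move: e1 e2 e3 tMr; clear; lra.
  by split; [apply: (gen _ _ (fun t => (Sr t).1))|apply: (gen _ _ (fun t => (Sr t).2))].
have shadow (x y : R -> R) : is_sol Z1 Z2 x y -> x 0 = 1 + delta -> `|y 0 - yL| <= s ->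
    forall t, 0 <= t <= TR + 1 -> `|x t - xr t| <= K2 * s /\ `|y t - yr t| <= K2 * s.
  move=> S x0 y0 t tT; have -> : K2 * s = K1 * (s + C * s) by rewrite /K2; ring.
  apply: (HK1 Z1 Z2 r1 r2 x y xr yr s (C * s)) => //; rewrite ?mulr_ge0 ?(ltW s0)//.
    by rewrite x0 xr0 [1 + _]addrC addrK gtr0_norm.
  by rewrite yr0.
have late (x y : R -> R) : is_sol Z1 Z2 x y -> x 0 = 1 + delta -> `|y 0 - yL| <= s ->
    forall t, TR - t1 <= t <= TR + t1 -> Z1 (x t) (y t) <= - m.
  move=> S x0 y0 t tT.
  have tb : 0 <= t <= TR + 1 by move: tT t11 t1T TR0; clear; lra.
  have [e1 e2] := shadow x y S x0 y0 t tb.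
  have [|e3 e4] := xr_near t TR; first by rewrite ler_norml; move: tT; clear; lra.
  have xa : `|x t - 1| <= rho.
    have := ler_normD (x t - xr t) (xr t - xr TR); rewrite addrA subrK {1}xrT.
    by move: e1 e3 b2; clear; lra.
  have ya : `|y t - yq| <= rho.
    have := ler_normD (y t - yr t) (yr t - yr TR); rewrite addrA subrK {1}yrT.
    by move: e2 e4 b2; clear; lra.
  have := lip_ball Z1L xa ya; have := Z1r 1 yq; rewrite !ler_norml.
  by move: rhom b1 mq m0; clear; lra.
have early (x y : R -> R) : is_sol Z1 Z2 x y -> x 0 = 1 + delta -> `|y 0 - yL| <= s ->
    forall t, 0 <= t <= t1 -> m <= Z1 (x t) (y t).
  move=> S x0 y0 t tT.
  have tb : 0 <= t <= TR + 1 by move: tT t11 t1T TR0; clear; lra.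
  have [e1 e2] := shadow x y S x0 y0 t tb.
  have [|e3 e4] := xr_near t 0; first by rewrite ler_norml; move: tT; clear; lra.
  have xa : `|x t - 1| <= rho.
    have := ler_normD (x t - xr t) (xr t - xr 0); rewrite addrA subrK {1}xr0.
    by move: e1 e3 b2; clear; lra.
  have ya : `|y t - yL| <= rho.
    have := ler_normD (y t - yr t) (yr t - yr 0); rewrite addrA subrK {1}yr0.
    by move: e2 e4 b2; clear; lra.
  have := lip_ball Z1L xa ya; have := Z1r 1 yL; rewrite !ler_norml.
  by move: rhom b1 mp m0; clear; lra.
pose Q (x y : R -> R) (t : R) := [/\ TR / 2 <= t <= TR + 1, `|t - TR| <= t1, x t = 1 + delta,
  `|y t - yq| <= K * s &
  forall r, 0 <= r <= t -> [/\ 1 + delta <= x r, `|x r - xr r| <= kap & `|y r - yr r| <= kap]].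
have := @choose_map (fun x y => is_sol Z1 Z2 x y /\ x 0 = 1 + delta) (fun a => `|a - yL| <= s) Q K.
case.
- by move=> a; have [x [y [x0 y0 S]]] := flow_exists (1 + delta) a Z1L Z2L; exists x, y.
- move=> x y [S x0] y0.
  have sh' := shadow x y S x0 y0.
  have xD := fun t => (S t).1; have yD := fun t => (S t).2.
  have xC := is_derive_within xD.
  have inc t : 0 <= t <= t1 -> m * t <= x t - (1 + delta).
    move=> /andP[t0 tt1]; rewrite -x0 -[t in leLHS]subr0.
    apply: (der_ge t0 (fun t _ => xD t) (xC _ _)) => r /andP[r0 rt].
    by apply: (early x y S x0 y0); rewrite (ltW r0) (le_trans (ltW rt)).
  have mid t : t1 <= t <= TR - t1 -> 1 + delta < x t.
    move=> tt; have := tminP t; rewrite in_itv => /(_ tt) e1.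
    have [|e2 _] := sh' t; first by move: tt t10 t11; clear; lra.
    by move: e2 e1 b4 ds s0; rewrite ler_norml /d1; clear; lra.
  have endx : x (TR + t1) <= 1 + delta.
    have TT : TR <= TR + t1 by rewrite lerDl ltW.
    have e1 : x (TR + t1) - x TR <= - m * (TR + t1 - TR).
      apply: (der_le TT (fun t _ => xD t) (xC _ _)) => r /andP[ra rb].
      by apply: (late x y S x0 y0); move: ra rb t10; clear; lra.
    have [|e2 _] := sh' TR; first by rewrite (ltW TR0) lerDl ler01.
    have mt : 0 <= m * t1 by rewrite mulr_ge0 ?ltW.
    by move: e1 e2 b5 d0 mt; rewrite xrT ler_norml; clear; lra.
  have t1e : t1 <= TR + t1 by rewrite lerDr ltW.
  have x1 : - x t1 < - (1 + delta).
    by rewrite ltrN2; apply: mid; rewrite lexx.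
  have x2 : - (1 + delta) <= - x (TR + t1) by rewrite lerN2.
  have NC : {within `[t1, TR + t1], continuous (fun t => - x t)}.
    have ND t : is_derive t (1:R) (fun t => - x t) (- Z1 (x t) (y t)).
      by have := xD t => D; apply: is_derive_eq.
    exact: is_derive_within ND.
  have [t [tt1 tT xt xbefore]] := first_hit t1e NC x1 x2.
  have {}xt : x t = 1 + delta by apply: oppr_inj.
  have tlo : TR - t1 < t.
    rewrite ltNge; apply/negP => tle.
    by have := mid t; rewrite (ltW tt1) tle => /(_ isT); rewrite xt ltxx.
  have tTR : `|t - TR| <= t1 by rewrite ler_norml; move: tlo tT; clear; lra.
  exists t; split => //.
  + by move: tlo tT t1T t11 t10; clear; lra.
  + have [|e1 e2] := sh' TR; first by rewrite (ltW TR0) lerDl ler01.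
    rewrite xrT yrT in e1 e2.
    have drift a b : TR - t1 <= a -> a <= b -> b <= TR + t1 ->
        `|y b - y a| <= 2 * M / m * (x a - x b).
      move=> ta ab bt.
      have M20 : 0 <= 2 * M by rewrite mulr_ge0// ltW.
      apply: (drift_bound m0 M20 ab xD yD _ (fun r _ => Z2M _ _)).2 => r /andP[ra rb].
      by apply: (late x y S x0 y0); move: ra rb ta bt; clear; lra.
    have e3 : `|y t - y TR| <= 2 * M / m * ((K2 + 1) * s).
      have [tle|tge] := leP t TR.
        rewrite distrC (le_trans (drift t TR (ltW tlo) tle _))//; first by rewrite lerDl ltW.
        rewrite ler_wpM2l ?(ltW Mm0)//; move: e1; rewrite xt ler_norml; move: ds; clear; lra.
      rewrite (le_trans (drift TR t _ (ltW tge) tT))//; first by rewrite lerBlDr lerDl ltW.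
      rewrite ler_wpM2l ?(ltW Mm0)//; move: e1; rewrite xt ler_norml; move: d0 s0; clear; lra.
    have := ler_normD (y t - y TR) (y TR - yq); rewrite addrA subrK.
    have -> : K * s = (K2 + 1) * s + 2 * M / m * ((K2 + 1) * s) by rewrite /K; ring.
    by move: e2 e3 s0; clear; lra.
  + move=> r /andP[r0 rt].
    have [|e1 e2] := sh' r; first by rewrite r0 (le_trans rt)// (le_trans tT)// lerD2l.
    rewrite (le_trans e1)// (le_trans e2)//; split => //.
    have [rt1|rt1] := leP r t1.
      have := inc r; rewrite r0 rt1 => /(_ isT).
      have : 0 <= m * r by rewrite mulr_ge0// ltW.
      by clear; lra.
    have [rlt|rge] := ltP r t; last by rewrite (le_anti (introT andP (conj rt rge))) xt.
    by rewrite -lerN2 ltW// xbefore// (ltW rt1).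
- move=> x y t x' y' t' [S x0] [S' x'0] y0 y'0 Q1 Q2.
  wlog tt : x y t x' y' t' S x0 S' x'0 y0 y'0 Q1 Q2 / t <= t'.
    move=> H; have [h1|/ltW h1] := leP t t'; first exact: H.
    by rewrite distrC [`|y 0 - _|]distrC; exact: H.
  have [/andP[ta tb] tT xt _ _] := Q1; have [/andP[ta' tb'] tT' xt' _ _] := Q2.
  have t0 : 0 <= t by rewrite (le_trans _ ta)// divr_ge0// ltW.
  have self (f : R -> R -> R) a b : `|f a b - f a b| <= 0 by rewrite subrr normr0.
  have g1 : `|x' 0 - x 0| <= `|y 0 - y' 0| by rewrite x0 x'0 subrr normr0.
  have g2 : `|y' 0 - y 0| <= `|y 0 - y' 0| by rewrite distrC.
  have tb1 : 0 <= t <= TR + 1 by rewrite t0.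
  have [e1 e2] := HK1 Z1 Z2 Z1 Z2 x' y' x y _ 0 (normr_ge0 _) (lexx _) Z1L Z2L S' S
    (self Z1) (self Z2) g1 g2 t tb1.
  rewrite addr0 in e1 e2.
  have M20 : 0 <= 2 * M by rewrite mulr_ge0// ltW.
  have lt' r : t < r < t' -> Z1 (x' r) (y' r) <= - m.
    by move=> rt; apply: (late x' y' S' x'0 y'0); move: rt tT tT'; rewrite !ler_norml; clear; lra.
  have [_ e3] := drift_bound m0 M20 tt (fun t => (S' t).1) (fun t => (S' t).2) lt' (fun r _ => Z2M _ _).
  have e4 : 2 * M / m * (x' t - x' t') <= 2 * M / m * (K1 * `|y 0 - y' 0|).
    by rewrite ler_wpM2l ?(ltW Mm0)// xt' -xt (le_trans (ler_norm _)).
  have := ler_normD (y t - y' t) (y' t - y' t'); rewrite addrA subrK.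
  have e5 : K1 * `|y 0 - y' 0| <= K2 * `|y 0 - y' 0|.
    by rewrite ler_wpM2r// /K2 ler_peMr ?lerDl// (le_trans ler01).
  have e6 : (K1 * `|y 0 - y' 0|) * (1 + 2 * M / m) <= K * `|y 0 - y' 0|.
    have -> : K * `|y 0 - y' 0| = (K2 + 1) * `|y 0 - y' 0| * (1 + 2 * M / m) by rewrite /K; ring.
    rewrite ler_wpM2r ?addr_ge0 ?(ltW Mm0)//.
    by rewrite (le_trans e5)// ler_wpM2r// lerDl.
  rewrite distrC in e2; rewrite distrC in e3.
  by move: e2 e3 e4 e6; clear; lra.
- move=> Y [Y1 Y2]; exists Y; split=> // x y S y0.
  have [t [[q1 q2 q3 q4 q5] q6]] := Y1 x y S y0.
  by exists t; split => //; split => //; exact: le_trans q2 t1k.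
Qed.

End stage_right.

(** * Passage near a stable node *)

Section node.
Context {R : realType}.

Lemma sqr_le_of_abs (z w : R) : `|z| <= w -> z * z <= w * w.
Proof.
move=> zw; rewrite -!expr2 -(real_normK (num_real z)) ler_pXn2r ?nnegrE//.
exact: le_trans zw.
Qed.

Lemma abs_le_of_sqr (z w : R) : 0 <= w -> z * z <= w * w -> `|z| <= w.
Proof.
by move=> w0; rewrite -!expr2 -(real_normK (num_real z)) ler_pXn2r ?nnegrE.
Qed.

Lemma young (g e mu : R) : 0 < mu -> 2 * (g * e) <= mu / 2 * (g * g) + 2 / mu * (e * e).
Proof.
move=> m0; rewrite -subr_ge0.
have -> : mu / 2 * (g * g) + 2 / mu * (e * e) - 2 * (g * e) =
    (mu * g - 2 * e) ^+ 2 / (2 * mu) by field; exact: lt0r_neq0.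
by rewrite divr_ge0 ?sqr_ge0// mulr_ge0// ltW.
Qed.

(* With J the matrix (a11 a12 ; a21 a22) acting on rows and v = (u, w), the
   form |v (J - l2)|^2 + |v (J - l1)|^2 is positive definite, and by
   Cayley-Hamilton v (J - l2) and v (J - l1) are eigenvectors of J for l1, l2. *)
Lemma node_contraction (a11 a12 a21 a22 l1 l2 : R) : l1 < l2 -> l2 < 0 ->
  a11 + a22 = l1 + l2 -> a11 * a22 - a12 * a21 = l1 * l2 ->
  exists k K mu, [/\ 0 < k, 1 <= K, 0 < mu &
  forall (u w du dw : R -> R) (a b d f : R), a <= b -> 0 <= d -> 0 <= f ->
  (forall t : R, is_derive t (1:R) u (du t)) ->
  (forall t : R, is_derive t (1:R) w (dw t)) ->
  (forall t, a < t < b -> `|du t - (a11 * u t + a21 * w t)| <= k * (`|u t| + `|w t|) + f /\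
     `|dw t - (a12 * u t + a22 * w t)| <= k * (`|u t| + `|w t|) + f) ->
  `|u a| <= d -> `|w a| <= d ->
  `|u b| <= K * (expR (- mu * (b - a)) * d + f) /\ `|w b| <= K * (expR (- mu * (b - a)) * d + f)].
Proof.
move=> l12 l20 tr det.
pose g11 u w := a11 * u + a21 * w - l2 * u; pose g12 u w := a12 * u + a22 * w - l2 * w.
pose g21 u w := a11 * u + a21 * w - l1 * u; pose g22 u w := a12 * u + a22 * w - l1 * w.
pose Q u w := g11 u w * g11 u w + g12 u w * g12 u w + (g21 u w * g21 u w + g22 u w * g22 u w).
pose l := l2 - l1; have lp : 0 < l by rewrite subr_gt0.
have sq0 (z : R) : 0 <= z * z by rewrite -expr2 sqr_ge0.
(* Since g11 - g21 = - l u and g12 - g22 = - l w, the form controls l^2 (u^2 + w^2); the deficit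
   consists of the squares of the sums. *)
have Q1 u w : l * l * (u * u + w * w) <= 2 * Q u w.
  have : 0 <= (g11 u w + g21 u w) * (g11 u w + g21 u w) + (g12 u w + g22 u w) * (g12 u w + g22 u w).
    by rewrite addr_ge0.
  move=> h; rewrite -subr_ge0; apply: (le_trans h); apply: eq_ler.
  by rewrite /Q /g11 /g12 /g21 /g22 /l; ring.
pose c1 := `|a11 - l2| + `|a21| + `|a12| + `|a22 - l2| + `|a11 - l1| + `|a22 - l1|.
pose C2 := 8 * (c1 * c1) + 1.
have c10 : 0 <= c1 by rewrite !addr_ge0.
have C20 : 0 < C2 by rewrite ltr_wpDl// mulr_ge0.
have Q2 u w : Q u w <= C2 * (u * u + w * w).
  have lin (p q : R) : `|p| <= c1 -> `|q| <= c1 ->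
      (p * u + q * w) * (p * u + q * w) <= 2 * (c1 * c1) * (u * u + w * w).
    move=> /sqr_le_of_abs pc /sqr_le_of_abs qc.
    have i1 := ler_wpM2r (sq0 u) pc; have i2 := ler_wpM2r (sq0 w) qc.
    have i3 : 0 <= (p * u - q * w) * (p * u - q * w) by [].
    by move: i1 i2 i3; clear; lra.
  have n1 := normr_ge0 (a11 - l2); have n2 := normr_ge0 a21; have n3 := normr_ge0 a12.
  have n4 := normr_ge0 (a22 - l2); have n5 := normr_ge0 (a11 - l1); have n6 := normr_ge0 (a22 - l1).
  have b1 : `|a11 - l2| <= c1 by rewrite /c1; move: n1 n2 n3 n4 n5 n6; clear; lra.
  have b2 : `|a21| <= c1 by rewrite /c1; move: n1 n2 n3 n4 n5 n6; clear; lra.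
  have b3 : `|a12| <= c1 by rewrite /c1; move: n1 n2 n3 n4 n5 n6; clear; lra.
  have b4 : `|a22 - l2| <= c1 by rewrite /c1; move: n1 n2 n3 n4 n5 n6; clear; lra.
  have b5 : `|a11 - l1| <= c1 by rewrite /c1; move: n1 n2 n3 n4 n5 n6; clear; lra.
  have b6 : `|a22 - l1| <= c1 by rewrite /c1; move: n1 n2 n3 n4 n5 n6; clear; lra.
  have i1 := lin _ _ b1 b2; have i2 := lin _ _ b3 b4; have i3 := lin _ _ b5 b2; have i4 := lin _ _ b3 b6.
  have -> : Q u w = ((a11 - l2) * u + a21 * w) * ((a11 - l2) * u + a21 * w) +
    (a12 * u + (a22 - l2) * w) * (a12 * u + (a22 - l2) * w) +
    (((a11 - l1) * u + a21 * w) * ((a11 - l1) * u + a21 * w) +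
    (a12 * u + (a22 - l1) * w) * (a12 * u + (a22 - l1) * w)).
    by rewrite /Q /g11 /g12 /g21 /g22; ring.
  have -> : C2 * (u * u + w * w) = 4 * (2 * (c1 * c1) * (u * u + w * w)) + (u * u + w * w).
    by rewrite /C2; ring.
  by move: i1 i2 i3 i4 (sq0 u) (sq0 w); clear; lra.
(* The weak rate. The form decays at rate 2 mu; a quarter of it goes to Young's inequality and a
   quarter to the linear part of the error, which leaves mu for the form and mu / 2 for the norm. *)
pose mu := - l2; have mu0 : 0 < mu by rewrite oppr_gt0.
have eig u w e1 e2 :
    2 * (g11 u w * g11 (a11 * u + a21 * w + e1) (a12 * u + a22 * w + e2) +
     g12 u w * g12 (a11 * u + a21 * w + e1) (a12 * u + a22 * w + e2) +
     (g21 u w * g21 (a11 * u + a21 * w + e1) (a12 * u + a22 * w + e2) +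
     g22 u w * g22 (a11 * u + a21 * w + e1) (a12 * u + a22 * w + e2))) <=
    - (3 / 2) * mu * Q u w + 2 / mu * Q e1 e2.
  have lin h : h = g11 \/ h = g12 -> h (a11 * u + a21 * w + e1) (a12 * u + a22 * w + e2) =
      l1 * h u w + h e1 e2.
    have E22 : a22 = l1 + l2 - a11 by rewrite -tr; ring.
    have E12 : a12 * a21 = a11 * a22 - l1 * l2 by rewrite -det; ring.
    case=> ->; rewrite /g11 /g12.
      have -> : a11 * (a11 * u + a21 * w + e1) + a21 * (a12 * u + a22 * w + e2) - l2 * (a11 * u + a21 * w + e1)
       = (a11 * a11 + a12 * a21 - l2 * a11) * u + a21 * (a11 + a22 - l2) * w + (a11 * e1 + a21 * e2 - l2 * e1) by ring.
      by rewrite E12 tr E22; ring.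
    have -> : a12 * (a11 * u + a21 * w + e1) + a22 * (a12 * u + a22 * w + e2) - l2 * (a12 * u + a22 * w + e2)
       = a12 * (a11 + a22 - l2) * u + (a12 * a21 + a22 * a22 - l2 * a22) * w + (a12 * e1 + a22 * e2 - l2 * e2) by ring.
    by rewrite E12 tr E22; ring.
  have lin' h : h = g21 \/ h = g22 -> h (a11 * u + a21 * w + e1) (a12 * u + a22 * w + e2) =
      l2 * h u w + h e1 e2.
    have E22 : a22 = l1 + l2 - a11 by rewrite -tr; ring.
    have E12 : a12 * a21 = a11 * a22 - l1 * l2 by rewrite -det; ring.
    case=> ->; rewrite /g21 /g22.
      have -> : a11 * (a11 * u + a21 * w + e1) + a21 * (a12 * u + a22 * w + e2) - l1 * (a11 * u + a21 * w + e1)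
       = (a11 * a11 + a12 * a21 - l1 * a11) * u + a21 * (a11 + a22 - l1) * w + (a11 * e1 + a21 * e2 - l1 * e1) by ring.
      by rewrite E12 tr E22; ring.
    have -> : a12 * (a11 * u + a21 * w + e1) + a22 * (a12 * u + a22 * w + e2) - l1 * (a12 * u + a22 * w + e2)
       = a12 * (a11 + a22 - l1) * u + (a12 * a21 + a22 * a22 - l1 * a22) * w + (a12 * e1 + a22 * e2 - l1 * e2) by ring.
    by rewrite E12 tr E22; ring.
  rewrite (lin g11)//; last by left.
  rewrite (lin g12)//; last by right.
  rewrite (lin' g21)//; last by left.
  rewrite (lin' g22)//; last by right.
  rewrite /Q; move: (g11 u w) (g12 u w) (g21 u w) (g22 u w) (g11 e1 e2) (g12 e1 e2) (g21 e1 e2) (g22 e1 e2).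
  move=> p1 p2 p3 p4 q1 q2 q3 q4.
  have y1 := young p1 q1 mu0; have y2 := young p2 q2 mu0.
  have y3 := young p3 q3 mu0; have y4 := young p4 q4 mu0.
  have d1 : 0 <= (l2 - l1) * (p1 * p1) by rewrite mulr_ge0 ?(ltW lp).
  have d2 : 0 <= (l2 - l1) * (p2 * p2) by rewrite mulr_ge0 ?(ltW lp).
  move: y1 y2 y3 y4 d1 d2; rewrite /mu; set r := 2 / _; clearbody r; clear; lra.
(* Chosen so that the linear part of the error costs at most [mu / 2 * Q]. *)
pose k := mu * l / (8 * C2).
have k0 : 0 < k by rewrite !divr_gt0// mulr_gt0.
pose C3 := 8 * C2 / mu; have C30 : 0 < C3 by rewrite divr_gt0// mulr_gt0.
have C21 : 1 <= C2 by rewrite /C2 lerDr mulr_ge0.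
have eig2 u w e1 e2 f : 0 <= f -> `|e1| <= k * (`|u| + `|w|) + f -> `|e2| <= k * (`|u| + `|w|) + f ->
    - (3 / 2) * mu * Q u w + 2 / mu * Q e1 e2 <= - mu * Q u w + C3 * (f * f).
  move=> f0 /sqr_le_of_abs h1 /sqr_le_of_abs h2.
  set z := k * (`|u| + `|w|) + f in h1 h2.
  have hz : z * z <= 4 * (k * k) * (u * u + w * w) + 2 * (f * f).
    rewrite /z; have s1 : 0 <= (k * (`|u| + `|w|) - f) * (k * (`|u| + `|w|) - f) by [].
    have s2 : 0 <= (k * (`|u| - `|w|)) * (k * (`|u| - `|w|)) by [].
    have nu : `|u| * `|u| = u * u by rewrite -!expr2 real_normK ?num_real.
    have nw : `|w| * `|w| = w * w by rewrite -!expr2 real_normK ?num_real.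
    rewrite -nu -nw; move: s1 s2; clear; lra.
  have q1 : Q e1 e2 <= C2 * (2 * (z * z)).
    by rewrite (le_trans (Q2 _ _))// ler_wpM2l ?(ltW C20)//; move: h1 h2; clear; lra.
  have kk : 2 / mu * (C2 * (2 * (4 * (k * k) * (u * u + w * w)))) <= mu / 2 * Q u w.
    have -> : 2 / mu * (C2 * (2 * (4 * (k * k) * (u * u + w * w)))) =
       mu / (4 * C2) * (l * l * (u * u + w * w)).
      by rewrite /k; field; rewrite !lt0r_neq0.
    rewrite (@le_trans _ _ (mu / 4 * (2 * Q u w)))//; last by apply: eq_ler; field.
    have muc : mu / (4 * C2) <= mu / 4.
      by rewrite ler_pM2l// lef_pV2 ?posrE ?mulr_gt0// ler_peMr.
    apply: ler_pM => //.
      by apply: divr_ge0; [exact: ltW|rewrite mulr_ge0// ltW].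
    by apply: mulr_ge0; [exact: sq0|exact: addr_ge0].
  have m2 : 0 <= 2 / mu by rewrite divr_ge0// ltW.
  have q2 : 2 / mu * Q e1 e2 <= 2 / mu * (C2 * (2 * (4 * (k * k) * (u * u + w * w)))) + C3 * (f * f).
    have -> : 2 / mu * (C2 * (2 * (4 * (k * k) * (u * u + w * w)))) + C3 * (f * f) =
      2 / mu * (C2 * (2 * (4 * (k * k) * (u * u + w * w) + 2 * (f * f)))).
      by rewrite /C3; field; exact: lt0r_neq0.
    rewrite ler_wpM2l// (le_trans q1)// ler_wpM2l ?(ltW C20)// ler_wpM2l//.
  move: q2 kk; set A1 := 2 / mu * Q e1 e2; set A2 := 2 / mu * _; clearbody A1 A2; clear; lra.
pose K := (2 + 4 * C2 + 2 * C3 / mu) / (l * l) + 1.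
have ll0 : 0 < l * l by rewrite mulr_gt0.
have K1 : 1 <= K.
  have c3 : 0 < 2 * C3 / mu by rewrite divr_gt0// mulr_gt0.
  rewrite /K lerDr divr_ge0 ?(ltW ll0)//; move: C20 c3; clear; lra.
have K0 : 0 <= K by rewrite (le_trans ler01).
exists k, (2 * K), (mu / 2); split => //.
- by move: K1; clear; lra.
- by rewrite divr_gt0.
move=> u w du dw a b d f ab d0 f0 uD wD H ua wa.
have uC := is_derive_within uD; have wC := is_derive_within wD.
have gD (h : R -> R -> R) (c1' c2' : R) : (forall x y, h x y = c1' * x + c2' * y) ->
    forall t : R, is_derive t (1:R) (fun t => h (u t) (w t) * h (u t) (w t))
    (2 * (h (u t) (w t) * h (du t) (dw t))).
  move=> hE t; have D1 := uD t; have D2 := wD t.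
  have E : (fun t => h (u t) (w t) * h (u t) (w t)) =
      (fun t => (c1' * u t + c2' * w t) * (c1' * u t + c2' * w t)).
    by apply/funext => r; rewrite !hE.
  by rewrite E !hE; apply: is_derive_eq; rewrite /GRing.scale/=; ring.
have D11 : forall x y, g11 x y = (a11 - l2) * x + a21 * y by move=> x y; rewrite /g11; ring.
have D12 : forall x y, g12 x y = a12 * x + (a22 - l2) * y by move=> x y; rewrite /g12; ring.
have D21 : forall x y, g21 x y = (a11 - l1) * x + a21 * y by move=> x y; rewrite /g21; ring.
have D22 : forall x y, g22 x y = a12 * x + (a22 - l1) * y by move=> x y; rewrite /g22; ring.
pose dQ t := 2 * (g11 (u t) (w t) * g11 (du t) (dw t) + g12 (u t) (w t) * g12 (du t) (dw t) +
     (g21 (u t) (w t) * g21 (du t) (dw t) + g22 (u t) (w t) * g22 (du t) (dw t))).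
have QD (t : R) : is_derive t (1:R) (fun t => Q (u t) (w t)) (dQ t).
  have A1 := gD _ _ _ D11 t; have A2 := gD _ _ _ D12 t.
  have A3 := gD _ _ _ D21 t; have A4 := gD _ _ _ D22 t.
  by rewrite /Q /dQ; apply: is_derive_eq; rewrite /GRing.scale/=; ring.
have dQle t : a < t < b -> dQ t <= - mu * Q (u t) (w t) + C3 * (f * f).
  move=> /H[h1 h2]; apply: le_trans (eig2 _ _ _ _ f f0 h1 h2).
  have E1 : a11 * u t + a21 * w t + (du t - (a11 * u t + a21 * w t)) = du t by ring.
  have E2 : a12 * u t + a22 * w t + (dw t - (a12 * u t + a22 * w t)) = dw t by ring.
  by have := eig (u t) (w t) (du t - (a11 * u t + a21 * w t)) (dw t - (a12 * u t + a22 * w t));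
    rewrite E1 E2.
have mun : - mu != 0 by rewrite oppr_eq0 lt0r_neq0.
have G := linear_gronwall ab mun (fun t _ => QD t) (is_derive_within QD) dQle.
set E := expR (- (mu / 2) * (b - a)).
have EE : expR (- mu * (b - a)) = E * E.
  by rewrite -expRD; congr expR; field.
have E0 : 0 <= E by exact: expR_ge0.
have Qa : Q (u a) (w a) <= C2 * (2 * (d * d)).
  rewrite (le_trans (Q2 _ _))// ler_wpM2l ?(ltW C20)//.
  by have := sqr_le_of_abs ua; have := sqr_le_of_abs wa; clear; lra.
have Qb : Q (u b) (w b) <= C2 * (2 * (d * d)) * (E * E) + C3 / mu * (f * f).
  move: G; rewrite EE invrN mulrN.
  have -> : C3 * (f * f) / mu = C3 / mu * (f * f) by ring.
  set c := C3 / mu * _ => G.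
  have c0 : 0 <= c by exact: (mulr_ge0 (divr_ge0 (ltW C30) (ltW mu0)) (sq0 f)).
  have h1 : 0 <= c * (E * E) by exact: mulr_ge0 c0 (mulr_ge0 E0 E0).
  have h2 : Q (u a) (w a) * (E * E) <= C2 * (2 * (d * d)) * (E * E) by rewrite ler_wpM2r// mulr_ge0.
  move: G h1 h2; clear; lra.
have fin : l * l * (u b * u b + w b * w b) <= l * l * ((2 * K * (E * d + f)) * (2 * K * (E * d + f))).
  apply: (le_trans (Q1 _ _)).
  apply: (@le_trans _ _ (l * l * (K * (E * d * (E * d) + f * f)))).
    have -> : l * l * (K * (E * d * (E * d) + f * f)) =
       (2 + 4 * C2 + 2 * C3 / mu + l * l) * (E * d * (E * d) + f * f).
      by rewrite /K; field; rewrite !lt0r_neq0.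
    have x1 : 0 <= E * d * (E * d) by []; have x2 : 0 <= f * f by [].
    have x3 : 0 <= C3 / mu by rewrite divr_ge0 ?ltW.
    have x4 : 0 <= 2 + l * l by rewrite addr_ge0// ltW.
    have z1 := mulr_ge0 x3 x1; have z2 := mulr_ge0 (ltW C20) x2.
    have z3 := mulr_ge0 x4 (addr_ge0 x1 x2).
    have z4 := mulr_ge0 (ltW C20) x1.
    rewrite (@le_trans _ _ (2 * (C2 * (2 * (d * d)) * (E * E) + C3 / mu * (f * f))))//.
      by rewrite ler_wpM2l.
    have z : 0 <= (2 + l * l) * (E * d * (E * d) + f * f) + 2 * (C3 / mu * (E * d * (E * d))) +
        4 * (C2 * (f * f)) by rewrite !addr_ge0// mulr_ge0.
    by rewrite -subr_ge0; apply: (le_trans z); apply: eq_ler; ring.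
  rewrite ler_wpM2l ?(ltW ll0)//.
  have x0 : 0 <= E * d by rewrite mulr_ge0.
  have -> : 2 * K * (E * d + f) * (2 * K * (E * d + f)) = K * (4 * K * ((E * d + f) * (E * d + f))) by ring.
  rewrite ler_wpM2l//.
  have x1 : E * d * (E * d) + f * f <= (E * d + f) * (E * d + f).
    by have := mulr_ge0 x0 f0; clear; lra.
  rewrite (le_trans x1)// ler_peMl//; move: K1; clear; lra.
have KEf : 0 <= 2 * K * (E * d + f) by rewrite !mulr_ge0// addr_ge0// mulr_ge0.
rewrite ler_pM2l// in fin.
by split; apply: abs_le_of_sqr => //; move: fin (sq0 (u b)) (sq0 (w b)); clear; lra.
Qed.

(** S x + y and S x - y are nondecreasing. As time does not enter, the estimate serves near the
    node, where the speed tends to zero with [eta]. *)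
Lemma slope_drift (x y dx dy : R -> R) (S a b : R) : a <= b ->
  (forall t : R, is_derive t (1:R) x (dx t)) -> (forall t : R, is_derive t (1:R) y (dy t)) ->
  (forall t, a < t < b -> `|dy t| <= S * dx t) -> `|y b - y a| <= S * (x b - x a).
Proof.
move=> ab xD yD H.
have D c (t : R) : is_derive t (1:R) (fun t => S * x t + c * y t) (S * dx t + c * dy t).
  by have := xD t => D1; have := yD t => D2; apply: is_derive_eq; rewrite /GRing.scale/=; ring.
have h1 : 0 * (b - a) <= S * x b + 1 * y b - (S * x a + 1 * y a).
  apply: (der_ge ab (fun t _ => D 1 t) (is_derive_within (D 1))) => t /H.
  by rewrite ler_norml; clear; lra.
have h2 : 0 * (b - a) <= S * x b + -1 * y b - (S * x a + -1 * y a).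
  apply: (der_ge ab (fun t _ => D (-1) t) (is_derive_within (D (-1)))) => t /H.
  by rewrite ler_norml; clear; lra.
by rewrite ler_norml; move: h1 h2; clear; lra.
Qed.

End node.

(** * Transit along the left field to the neighbourhood of its node *)

Section stage_left.
Context {R : realType}.

Lemma expR_small (mu c : R) : 0 < mu -> 0 < c -> exists2 t, 0 <= t & expR (- mu * t) <= c.
Proof.
move=> m0 c0; exists ((c * mu)^-1); first by rewrite invr_ge0 ltW// mulr_gt0.
have -> : - mu * (c * mu)^-1 = - c^-1 by field; rewrite !lt0r_neq0.
rewrite expRN -[leRHS]invrK lef_pV2 ?posrE ?expR_gt0 ?invr_gt0//.
by have := expR_ge1Dx c^-1; apply: le_trans; rewrite lerDr.
Qed.

(** (1, mm) is the weak eigenvector. At the node minus rho (1, mm) the linear part is - lam rho (1,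
    mm); the relative error [eps1] and the nonlinear error [k] each remove at most a quarter of -
    lam rho, so the field points to the right with speed of order rho and bounded slope. *)
Lemma weak_field (f g : R -> R -> R) (a11 a12 a21 a22 lam mm k eps1 zx zy x y rho : R) :
  lam < 0 -> a11 + a21 * mm = lam -> a12 + a22 * mm = lam * mm ->
  f zx zy = 0 -> g zx zy = 0 ->
  `|f x y - f zx zy - (a11 * (x - zx) + a21 * (y - zy))| <= k * (`|x - zx| + `|y - zy|) ->
  `|g x y - g zx zy - (a12 * (x - zx) + a22 * (y - zy))| <= k * (`|x - zx| + `|y - zy|) ->
  0 <= rho -> 0 <= k -> 0 <= eps1 -> eps1 <= 1 ->
  `|x - zx + rho| <= eps1 * rho -> `|y - zy + mm * rho| <= 2 * eps1 * rho ->
  (`|a11| + `|a21| + `|a12| + `|a22|) * (2 * eps1) <= - lam / 4 ->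
  k * (`|mm| + 4) <= - lam / 4 ->
  - lam / 2 * rho <= f x y /\ `|g x y| <= 2 * (`|mm| + 1) * f x y.
Proof.
move=> lam0 e1 e2 -> -> Hf Hg rho0 k0 ep0 ep1 Hx Hy HN Hk.
pose p := x - zx + rho; pose q := y - zy + mm * rho.
have er0 : 0 <= eps1 * rho by rewrite mulr_ge0.
have er1 : eps1 * rho <= rho by rewrite ler_piMl.
have mr0 : 0 <= `|mm| * rho by rewrite mulr_ge0.
have bnd (al be : R) : `|al| + `|be| <= `|a11| + `|a21| + `|a12| + `|a22| ->
    `|al * p + be * q| <= - lam / 4 * rho.
  move=> ab; rewrite (le_trans (ler_normD _ _))// !normrM.
  have i1 : `|al| * `|p| <= `|al| * (2 * eps1 * rho).
    by rewrite ler_wpM2l// (le_trans Hx)// -mulrA; move: er0; clear; lra.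
  have i2 : `|be| * `|q| <= `|be| * (2 * eps1 * rho) by rewrite ler_wpM2l.
  rewrite (le_trans (lerD i1 i2))// -mulrDl mulrA ler_wpM2r//.
  by rewrite (le_trans _ HN)// ler_wpM2r// mulr_ge0.
have N1 := bnd a11 a21; have N2 := bnd a12 a22.
have {}N1 : `|a11 * p + a21 * q| <= - lam / 4 * rho.
  by apply: N1; move: (normr_ge0 a12) (normr_ge0 a22); clear; lra.
have {}N2 : `|a12 * p + a22 * q| <= - lam / 4 * rho.
  by apply: N2; move: (normr_ge0 a11) (normr_ge0 a21); clear; lra.
have dist : k * (`|x - zx| + `|y - zy|) <= - lam / 4 * rho.
  have d1 : `|x - zx| <= rho + eps1 * rho.
    have -> : x - zx = p - rho by rewrite /p; ring.
    by have := ler_normB p rho; rewrite (ger0_norm rho0); move: Hx; rewrite -/p; clear; lra.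
  have d2 : `|y - zy| <= `|mm| * rho + 2 * eps1 * rho.
    have -> : y - zy = q - mm * rho by rewrite /q; ring.
    have := ler_normB q (mm * rho); rewrite normrM (ger0_norm rho0).
    by move: Hy; rewrite -/q; clear; lra.
  have d3 : `|x - zx| + `|y - zy| <= (`|mm| + 4) * rho.
    by move: d1 d2 er1; clear; lra.
  rewrite (le_trans (ler_wpM2l k0 d3))// mulrA ler_wpM2r//.
have E1 : a11 * (x - zx) + a21 * (y - zy) = - lam * rho + (a11 * p + a21 * q).
  by rewrite -e1 /p /q; ring.
have E2 : a12 * (x - zx) + a22 * (y - zy) = - (lam * mm) * rho + (a12 * p + a22 * q).
  by rewrite -e2 /p /q; ring.
rewrite E1 subr0 in Hf; rewrite E2 subr0 in Hg.
have f1 : - lam / 2 * rho <= f x y.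
  by move: Hf N1 dist; rewrite !ler_norml; clear; lra.
split=> //.
have l0 : 0 <= - lam by rewrite oppr_ge0 ltW.
have lm : `|lam * mm * rho| = - lam * (`|mm| * rho).
  by rewrite !normrM (ger0_norm rho0) (ltr0_norm lam0) -mulrA.
have g1 : `|g x y| <= - lam * (`|mm| * rho) - lam / 2 * rho.
  by move: Hg N2 dist; rewrite -lm; have := ler_norm (lam * mm * rho);
    have := ler_norm (- (lam * mm * rho)); rewrite normrN !ler_norml; clear; lra.
have : 2 * (`|mm| + 1) * (- lam / 2 * rho) <= 2 * (`|mm| + 1) * f x y.
  by rewrite ler_wpM2l// mulr_ge0// addr_ge0.
have lr : 0 <= - lam * rho by rewrite mulr_ge0.
by move: g1 lr; clear; lra.
Qed.

(* The deviation D = (x, y) - z - ((xl, yl) - p) of a perturbed solution from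
   the incoming orbit (xl, yl), both measured from their respective nodes. *)
Lemma node_tracking (f g fe ge f0 g0 : R -> R -> R) (a11 a12 a21 a22 yL zx zy r k0 K4 mu c1 eta e us B T0 : R)
    (x y xl yl : R -> R) :
  (forall (u w du dw : R -> R) (a b d f : R), a <= b -> 0 <= d -> 0 <= f ->
    (forall t : R, is_derive t (1:R) u (du t)) ->
    (forall t : R, is_derive t (1:R) w (dw t)) ->
    (forall t, a < t < b -> `|du t - (a11 * u t + a21 * w t)| <= k0 * (`|u t| + `|w t|) + f /\
     `|dw t - (a12 * u t + a22 * w t)| <= k0 * (`|u t| + `|w t|) + f) ->
    `|u a| <= d -> `|w a| <= d ->
    `|u b| <= K4 * (expR (- mu * (b - a)) * d + f) /\ `|w b| <= K4 * (expR (- mu * (b - a)) * d + f)) ->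
  0 < r -> 0 < mu -> 0 <= K4 -> 0 <= c1 -> 0 <= eta -> 0 <= e -> 0 <= us -> 0 <= B -> c1 * r <= k0 ->
  us <= r / 4 -> `|zx - 1| <= r / 4 -> `|zy - yL| <= r / 4 ->
  K4 * (B + (e + c1 * eta * us)) <= r / 8 ->
  is_sol f g x y -> is_sol f0 g0 xl yl ->
  (forall a b, `|f a b - fe a b| <= e) -> (forall a b, `|g a b - ge a b| <= e) ->
  (forall x y x' y', `|x - 1| <= r -> `|y - yL| <= r -> `|x' - 1| <= r -> `|y' - yL| <= r ->
    `|fe x y - fe x' y' - (a11 * (x - x') + a21 * (y - y'))| <= c1 * r * (`|x - x'| + `|y - y'|) /\
    `|ge x y - ge x' y' - (a12 * (x - x') + a22 * (y - y'))| <= c1 * r * (`|x - x'| + `|y - y'|)) ->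
  (forall u w, `|u| <= r -> `|w| <= r ->
    `|fe (zx + u) (zy + w) - f0 (1 + u) (yL + w)| <= c1 * eta * (`|u| + `|w|) /\
    `|ge (zx + u) (zy + w) - g0 (1 + u) (yL + w)| <= c1 * eta * (`|u| + `|w|)) ->
  (forall t, T0 <= t -> `|xl t - 1| + `|yl t - yL| <= us) ->
  `|x T0 - zx - (xl T0 - 1)| <= B -> `|y T0 - zy - (yl T0 - yL)| <= B ->
  forall t, T0 <= t ->
    [/\ `|x t - zx - (xl t - 1)| <= K4 * (expR (- mu * (t - T0)) * B + (e + c1 * eta * us)),
        `|y t - zy - (yl t - yL)| <= K4 * (expR (- mu * (t - T0)) * B + (e + c1 * eta * us)),
        `|x t - 1| <= r & `|y t - yL| <= r].
Proof.
move=> Hnode r0 mu0 K40 c10 eta0 e0 us0 B0 c1k usr zxr zyr small S Sl ff gg star star2 near_p DxT DyT.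
pose u t := x t - zx - (xl t - 1); pose w t := y t - zy - (yl t - yL).
pose fc := e + c1 * eta * us.
have fc0 : 0 <= fc by rewrite addr_ge0// !mulr_ge0.
have uD (t : R) : is_derive t (1:R) u (f (x t) (y t) - f0 (xl t) (yl t)).
  by have [D1 _] := S t; have [D2 _] := Sl t; apply: is_derive_eq; rewrite !subr0.
have wD (t : R) : is_derive t (1:R) w (g (x t) (y t) - g0 (xl t) (yl t)).
  by have [_ D1] := S t; have [_ D2] := Sl t; apply: is_derive_eq; rewrite !subr0.
have ball t : T0 <= t -> `|u t| + `|w t| < r / 2 -> `|x t - 1| <= r /\ `|y t - yL| <= r.
  move=> /near_p np uw.
  have n1 := normr_ge0 (xl t - 1); have n2 := normr_ge0 (yl t - yL).
  have n3 := normr_ge0 (u t); have n4 := normr_ge0 (w t).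
  have -> : x t - 1 = u t + (zx - 1) + (xl t - 1) by rewrite /u; ring.
  have -> : y t - yL = w t + (zy - yL) + (yl t - yL) by rewrite /w; ring.
  have h1 := ler_normD (u t + (zx - 1)) (xl t - 1); have h2 := ler_normD (u t) (zx - 1).
  have h3 := ler_normD (w t + (zy - yL)) (yl t - yL); have h4 := ler_normD (w t) (zy - yL).
  by move: n1 n2 n3 n4 h1 h2 h3 h4 np uw usr zxr zyr; clear; lra.
(* The field at (x, y) is first compared, by linearisation, with the field at the node plus the
   displacement of the incoming orbit, and then with the unperturbed field on that orbit, which
   costs c1 * eta * us. *)
have err t : T0 <= t -> `|u t| + `|w t| < r / 2 ->
    `|f (x t) (y t) - f0 (xl t) (yl t) - (a11 * u t + a21 * w t)| <= k0 * (`|u t| + `|w t|) + fc /\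
    `|g (x t) (y t) - g0 (xl t) (yl t) - (a12 * u t + a22 * w t)| <= k0 * (`|u t| + `|w t|) + fc.
  move=> Tt uw; have [xb yb] := ball t Tt uw; have np := near_p t Tt.
  have n1 := normr_ge0 (xl t - 1); have n2 := normr_ge0 (yl t - yL).
  have u1 : `|xl t - 1| <= r by move: n1 n2 np usr r0; clear; lra.
  have w1 : `|yl t - yL| <= r by move: n1 n2 np usr r0; clear; lra.
  have x'b : `|zx + (xl t - 1) - 1| <= r.
    have -> : zx + (xl t - 1) - 1 = (zx - 1) + (xl t - 1) by ring.
    by have := ler_normD (zx - 1) (xl t - 1); move: n1 n2 np usr r0 zxr; clear; lra.
  have y'b : `|zy + (yl t - yL) - yL| <= r.
    have -> : zy + (yl t - yL) - yL = (zy - yL) + (yl t - yL) by ring.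
    by have := ler_normD (zy - yL) (yl t - yL); move: n1 n2 np usr r0 zyr; clear; lra.
  have [s1 s2] := star _ _ _ _ xb yb x'b y'b.
  have [s3 s4] := star2 _ _ u1 w1.
  have Eu : x t - (zx + (xl t - 1)) = u t by rewrite /u; ring.
  have Ew : y t - (zy + (yl t - yL)) = w t by rewrite /w; ring.
  rewrite Eu Ew in s1 s2.
  have Exl : 1 + (xl t - 1) = xl t by ring.
  have Eyl : yL + (yl t - yL) = yl t by ring.
  rewrite Exl Eyl in s3 s4.
  have cr : c1 * r * (`|u t| + `|w t|) <= k0 * (`|u t| + `|w t|) by rewrite ler_wpM2r// addr_ge0.
  have cu : c1 * eta * (`|xl t - 1| + `|yl t - yL|) <= c1 * eta * us by rewrite ler_wpM2l// mulr_ge0.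
  have tri (p q s v j : R) : `|p - q - j| <= `|p - v| + `|v - s - j| + `|s - q|.
    have -> : p - q - j = (p - v) + (v - s - j) + (s - q) by ring.
    by rewrite (le_trans (ler_normD _ _))// lerD2r ler_normD.
  split.
    have := tri (f (x t) (y t)) (f0 (xl t) (yl t)) (fe (zx + (xl t - 1)) (zy + (yl t - yL)))
      (fe (x t) (y t)) (a11 * u t + a21 * w t).
    by move: s1 s3 cr cu (ff (x t) (y t)); rewrite /fc; clear; lra.
  have := tri (g (x t) (y t)) (g0 (xl t) (yl t)) (ge (zx + (xl t - 1)) (zy + (yl t - yL)))
    (ge (x t) (y t)) (a12 * u t + a22 * w t).
  by move: s2 s4 cr cu (gg (x t) (y t)); rewrite /fc; clear; lra.
have est t : T0 <= t -> (forall s, T0 <= s < t -> `|u s| + `|w s| < r / 2) ->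
    `|u t| <= K4 * (expR (- mu * (t - T0)) * B + fc) /\ `|w t| <= K4 * (expR (- mu * (t - T0)) * B + fc).
  move=> Tt H; apply: (Hnode u w _ _ T0 t B fc Tt B0 fc0 uD wD) => // s /andP[Ts st].
  by apply: err; [exact: ltW|apply: H; rewrite (ltW Ts)].
have bound t : T0 <= t -> K4 * (expR (- mu * (t - T0)) * B + fc) <= r / 8.
  move=> Tt; apply: le_trans small; rewrite ler_wpM2l// lerD2r ler_piMl//.
  rewrite -[leRHS]expR0 ler_expR mulNr oppr_le0 mulr_ge0 ?(ltW mu0)// subr_ge0//.
have uwC b : {within `[T0, b], continuous (fun t => `|u t| + `|w t|)}.
  apply: continuous_subspaceT => s; apply: cvgD; apply: cvg_norm.
    exact: (is_derive_continuous uD).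
  exact: (is_derive_continuous wD).
(* Bootstrap: as long as |u| + |w| < r / 2 the orbit is in the ball where the estimates hold, and
   these give r / 8 for each of the two. *)
have small_uw t : T0 <= t -> `|u t| + `|w t| < r / 2.
  move=> Tt; apply: (continuity_method Tt (uwC t)); last by rewrite Tt lexx.
  move=> s /andP[Ts _] H; have [h1 h2] := est s Ts H.
  by have := bound s Ts; move: h1 h2 r0; clear; lra.
move=> t Tt; have [h1 h2] := est t Tt (fun s sb => small_uw s (proj1 (andP sb))).
by have [b1 b2] := ball t Tt (small_uw t Tt).
Qed.

(* (a11 a12 ; a21 a22) is the jacobian at (1, yL) for eta = 0, acting on rows as
   in Defs, and (zx, zy) the branch of nodes. *)
Record node_family (L1 L2 : R -> R -> R -> R) (a11 a12 a21 a22 yL r0 C1 Kz kz Lz : R)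
    (zx zy : R -> R) : Prop := {
  nf_r0 : 0 < r0;
  nf_C1 : 0 <= C1;
  nf_Kz : 0 <= Kz;
  nf_kz : 0 < kz;
  nf_eta : forall eta x y, 0 <= eta <= r0 ->
    `|L1 eta x y - L1 0 x y| <= Lz * eta /\ `|L2 eta x y - L2 0 x y| <= Lz * eta;
  nf_lin : forall r eta x y x' y', 0 <= eta <= r -> r <= r0 ->
    `|x - 1| <= r -> `|y - yL| <= r -> `|x' - 1| <= r -> `|y' - yL| <= r ->
    `|L1 eta x y - L1 eta x' y' - (a11 * (x - x') + a21 * (y - y'))| <=
      C1 * r * (`|x - x'| + `|y - y'|) /\
    `|L2 eta x y - L2 eta x' y' - (a12 * (x - x') + a22 * (y - y'))| <=
      C1 * r * (`|x - x'| + `|y - y'|);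
  nf_node : forall eta, 0 <= eta <= r0 ->
    [/\ L1 eta (zx eta) (zy eta) = 0, L2 eta (zx eta) (zy eta) = 0,
      `|zx eta - 1| <= Kz * eta, `|zy eta - yL| <= Kz * eta & 1 + kz * eta <= zx eta];
  nf_shift : forall eta u w, 0 <= eta <= r0 -> `|u| <= r0 -> `|w| <= r0 ->
    `|L1 eta (zx eta + u) (zy eta + w) - L1 0 (1 + u) (yL + w)| <= C1 * eta * (`|u| + `|w|) /\
    `|L2 eta (zx eta + u) (zy eta + w) - L2 0 (1 + u) (yL + w)| <= C1 * eta * (`|u| + `|w|) }.

(* The deviation from the incoming orbit, both measured from their nodes, becomes
   small compared with eta while the orbit is still left of x = 1; from then on
   it inherits the weak direction.  The long time spent near the node gives an
   arbitrarily small contraction factor theta. *)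
Theorem left_transit (L1 L2 : R -> R -> R -> R) (a11 a12 a21 a22 yL r0 C1 Kz kz Lz : R)
    (zx zy : R -> R) (l1 l2 lam mm M yq kap : R) (xl yl : R -> R) :
  node_family L1 L2 a11 a12 a21 a22 yL r0 C1 Kz kz Lz zx zy ->
  l1 < l2 -> l2 < 0 -> a11 + a22 = l1 + l2 -> a11 * a22 - a12 * a21 = l1 * l2 ->
  lam < 0 -> a11 + a21 * mm = lam -> a12 + a22 * mm = lam * mm ->
  0 < M -> 0 <= Lz -> (forall x y, `|L1 0 x y| <= M) -> (forall x y, `|L2 0 x y| <= M) ->
  lip Lz (L1 0) -> lip Lz (L2 0) ->
  is_sol (L1 0) (L2 0) xl yl -> xl 0 = 1 -> yl 0 = yq -> (forall t, 0 < t -> xl t < 1) ->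
  L1 0 1 yq < 0 ->
  (forall e, 0 < e -> exists2 T, 0 <= T & forall t, T <= t ->
     1 - xl t <= e /\ `|yl t - yL - mm * (xl t - 1)| <= e * (1 - xl t)) ->
  0 < kap ->
  exists C0 c1 S1, [/\ 0 < C0, 0 < c1, 0 <= S1 &
  forall A theta, 1 <= A -> 0 < theta -> exists2 h, 0 < h &
  forall eta delta e (Z1 Z2 : R -> R -> R), 0 < eta <= h -> 0 < delta <= eta ->
  0 <= e <= h * eta -> lip Lz Z1 -> lip Lz Z2 ->
  (forall x y, `|Z1 x y - L1 eta x y| <= e) -> (forall x y, `|Z2 x y - L2 eta x y| <= e) ->
  (forall x y x' y', `|Z1 x y - L1 eta x y - (Z1 x' y' - L1 eta x' y')| <=
     e * (`|x - x'| + `|y - y'|) /\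
     `|Z2 x y - L2 eta x y - (Z2 x' y' - L2 eta x' y')| <= e * (`|x - x'| + `|y - y'|)) ->
  exists Y : R -> R, exists T2,
  (forall x y : R -> R, is_sol Z1 Z2 x y /\ x 0 = 1 - delta -> `|y 0 - yq| <= A * eta ->
    exists t, [/\ [/\ 0 <= t, t <= T2, x t = 1 - delta & `|y t - yL| <= C0 * eta],
      (forall r, 0 <= r <= t -> [/\ x r <= 1 - delta, `|x r - xl r| <= kap & `|y r - yl r| <= kap]),
      (forall r, t <= r -> `|xl r - 1| <= kap /\ `|yl r - yL| <= kap) &
      c1 * eta <= L1 eta (1 - delta) (y t) /\
      `|L2 eta (1 - delta) (y t)| <= S1 * L1 eta (1 - delta) (y t)]
      /\ y t = Y (y 0)) /\
  (forall a b, `|a - yq| <= A * eta -> `|b - yq| <= A * eta -> `|Y a - Y b| <= theta * `|a - b|)].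
Proof.
move=> [r00 C10 Kz0 kz0 Leta Llin Lnode Lshift] l12 l20 tr det lam0 ev1 ev2 M0 Lz0 L1M L2M L1L L2L
  Sl xl0 yl0 xl_left L1q conv kap0.

(* Constants independent of the entry width and of the contraction factor *)
have [k0 [K4 [mu [k00 K41 mu0 Hnode]]]] := node_contraction l12 l20 tr det.
have K40 : 0 < K4 := lt_le_trans ltr01 K41.
have ml0 : 0 < - lam by rewrite oppr_gt0.
have C11 : 0 < C1 + 1 by rewrite ltr_wpDl.
pose mA := `|mm|; have mA0 : 0 <= mA by exact: normr_ge0.
have mA4 : 0 < mA + 4 by rewrite ltr_wpDl.
have mA2 : 0 < mA + 2 by rewrite ltr_wpDl.
have [r rp /= /and4P[rr0 rk rlam _]] : exists2 r, 0 < r & all (fun z => r <= z)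
    [:: r0; k0 / (2 * (C1 + 1)); (- lam) / (4 * ((C1 + 1) * (mA + 4)))].
  apply: lt_bounds; apply/and4P; split=> //; apply: divr_gt0 => //; repeat apply: mulr_gt0 => //.
have C1r : C1 * r <= (C1 + 1) * r by rewrite ler_wpM2r ?(ltW rp)// lerDl.
have C1rk : 2 * (C1 * r) <= k0.
  have : (C1 + 1) * r * 2 <= k0.
    by move: rk; rewrite ler_pdivlMr ?mulr_gt0//; move: (C1 + 1) => c; clear; lra.
  by move: C1r; clear; lra.
have C1r0 : 0 <= C1 * r by rewrite mulr_ge0// ltW.
have C1rl : C1 * r * (mA + 4) <= - lam / 4.
  have h1 : (C1 + 1) * r * (mA + 4) <= - lam / 4.
    move: rlam; rewrite ler_pdivlMr ?mulr_gt0//.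
    by move: (C1 + 1) (mA + 4) => c m; clear; lra.
  by rewrite (le_trans _ h1)// ler_wpM2r// ltW.
pose N := `|a11| + `|a21| + `|a12| + `|a22|.
have N0 : 0 <= N by rewrite !addr_ge0.
have N1 : 0 < N + 1 by rewrite ltr_wpDl.
have [eps1 ep0 /= /and3P[ep1 epN _]] : exists2 z, 0 < z & all (fun w => z <= w)
    [:: 1; (- lam) / (8 * (N + 1))].
  by apply: lt_bounds; apply/and3P; split=> //; apply: divr_gt0 => //; exact: mulr_gt0.
have NE : N * (2 * eps1) <= - lam / 4.
  have : eps1 * (8 * (N + 1)) <= - lam by rewrite -ler_pdivlMr// mulr_gt0.
  have : 0 <= N * eps1 by rewrite mulr_ge0// ltW.
  by move: ep0; clear; lra.
(* Final accuracy of the tracking, relative to [eta]. With sg <= kz / 2 the incoming orbit is still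
   kz eta / 2 away from x = 1 when the tracked orbit is at x <= 1; with sg <= eps1 kz / 2 the
   deviation is small relative to that distance. *)
have [sg sg0 /= /and4P[sg1 sgk sge _]] : exists2 z, 0 < z & all (fun w => z <= w)
    [:: 1; kz / 2; eps1 * (kz / 2)].
  by apply: lt_bounds; apply/and4P; split=> //; [exact: divr_gt0|apply: mulr_gt0 => //; exact: divr_gt0].
(* Accuracy of the incoming orbit at [T0], in distance and in direction. The last entry keeps the
   error due to the motion of the node, K4 C1 us eta, below a third of sg eta; the other thirds are
   for the initial deviation and for [e]. *)
have [e1 e10 /= /and5P[e1e e1r e1k e1s _]] : exists2 z, 0 < z & all (fun w => z <= w)
    [:: eps1; r / (4 * (mA + 2)); kap / (mA + 2); sg / (3 * (K4 * ((C1 + 1) * (mA + 2))))].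
  apply: lt_bounds; apply/and5P; split=> //; apply: divr_gt0 => //; repeat apply: mulr_gt0 => //.
pose us := (mA + 2) * e1.
have us0 : 0 <= us by rewrite mulr_ge0// ltW.
have usr : us <= r / 4.
  move: e1r; rewrite ler_pdivlMr ?mulr_gt0// /us; move: (mA + 2) => c; clear; lra.
have usk : us <= kap by move: e1k; rewrite ler_pdivlMr// /us mulrC.
have uss : 3 * (K4 * (C1 * us)) <= sg.
  have h1 : 3 * (K4 * ((C1 + 1) * us)) <= sg.
    by move: e1s; rewrite ler_pdivlMr ?mulr_gt0// /us; move: (mA + 2) (C1 + 1) => c c'; clear; lra.
  by rewrite (le_trans _ h1)// ler_wpM2l// ler_wpM2l ?(ltW K40)// ler_wpM2r// lerDl.
have [T0 T00 conv0] := conv e1 e10.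
have xl_lt t : 0 < t -> 0 <= 1 - xl t by move=> /xl_left xt; rewrite subr_ge0 ltW.
have xl_le t : 0 <= t -> 0 <= 1 - xl t.
  by rewrite le_eqVlt => /orP[/eqP <-|/xl_lt//]; rewrite xl0 subrr.
have near_p t : T0 <= t -> `|xl t - 1| + `|yl t - yL| <= us.
  move=> Tt; have t0 := le_trans T00 Tt; have [h1 h2] := conv0 t Tt; have h3 := xl_le t t0.
  have -> : yl t - yL = (yl t - yL - mm * (xl t - 1)) + mm * (xl t - 1) by ring.
  rewrite (distrC (xl t)) (ger0_norm h3).
  have := ler_normD (yl t - yL - mm * (xl t - 1)) (mm * (xl t - 1)).
  rewrite normrM (distrC (xl t)) (ger0_norm h3) -/mA => h4.
  have h5 : e1 * (1 - xl t) <= 1 - xl t by rewrite ler_piMl// (le_trans e1e).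
  have h6 : (mA + 2) * (1 - xl t) <= us by rewrite ler_wpM2l// ltW.
  by move: h2 h4 h5 h6; clear; lra.
pose S1 := 2 * (mA + 1).
have S10 : 0 <= S1 by rewrite mulr_ge0// addr_ge0.
pose S2 := 2 * S1 + 1; have S20 : 0 <= S2 by rewrite /S2; move: S10; clear; lra.
pose c1 := - lam * kz / 4; have c10 : 0 < c1 by rewrite divr_gt0// mulr_gt0.
(* Displacement of the node, then the x-distance (Kz + 2) eta of the incoming orbit from p^L times
   its slope bound mA + 1, then the tracking error. *)
pose C0 := Kz + (mA + 1) * (Kz + 2) + 1.
have C00 : 0 < C0 by rewrite ltr_wpDl// addr_ge0// mulr_ge0// addr_ge0.
exists C0, c1, S1; split => //.

(* Constants depending on the entry width and the contraction factor *)
move=> A theta A1 th0.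
have [K0 K01 HK0] := shadowing Lz0 T00.
have K00 : 0 < K0 := lt_le_trans ltr01 K01.
have A0 : 0 < A := lt_le_trans ltr01 A1.
(* Deviation at [T0] in units of [eta]: shadowing over [0, T0], then the displacement of the
   node. *)
pose B0 := K0 * (A + 1 + Lz) + Kz.
have B00 : 0 < B0 by rewrite ltr_wpDr// mulr_gt0// ltr_wpDr// addr_gt0.
have S21 : 0 < 1 + S2 by rewrite ltr_wpDr.
(* The first demand lets the initial deviation decay below sg eta / 3. The second yields the
   contraction factor: K0 for [0, T0], K4 near the node, 1 + S2 for unequal arrival times. *)
pose cT := Num.min (sg / (3 * (K4 * B0))) (theta / (K4 * K0 * (1 + S2))).
have cT0 : 0 < cT by rewrite lt_min; apply/andP; split; apply: divr_gt0 => //; repeat apply: mulr_gt0 => //.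
have [s s0 Es] := expR_small mu0 cT0.
pose T1 := T0 + s + 1.
have T0T1 : T0 <= T1 by rewrite /T1; move: s0; clear; lra.
have T11 : 1 <= T1 by rewrite /T1; move: s0 T00; clear; lra.
have T10 : 0 <= T1 by move: T11; clear; lra.
have Elate t : T1 <= t -> [/\ 0 <= expR (- mu * (t - T0)),
    3 * (K4 * (expR (- mu * (t - T0)) * B0)) <= sg &
    (1 + S2) * (K4 * (expR (- mu * (t - T0)) * K0)) <= theta].
  move=> Tt; have Et : expR (- mu * (t - T0)) <= cT.
    rewrite (le_trans _ Es)// ler_expR !mulNr lerN2 ler_wpM2l ?(ltW mu0)//.
    by move: Tt; rewrite /T1; clear; lra.
  move: Et; rewrite le_min !ler_pdivlMr ?mulr_gt0// => /andP[h1 h2].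
  split; first exact: expR_ge0.
    by move: h1; move: (expR _) => E; clear; lra.
  by move: h2; move: (expR _) (1 + S2) => E c; clear; lra.
have [K1 K11 HK1] := shadowing Lz0 T10.
have K10 : 0 < K1 := lt_le_trans ltr01 K11.
have [m m0 /= /andP[mq _]] : exists2 m, 0 < m & all (fun z => m <= z) [:: - L1 0 1 yq / 4].
  by apply: lt_bounds; rewrite /= andbT divr_gt0// oppr_gt0.
have Lz1 : 0 < Lz + 1 by rewrite ltr_wpDl.
pose rho := m / (2 * (Lz + 1)).
have rho0 : 0 < rho by rewrite divr_gt0// mulr_gt0.
have rhom : 2 * Lz * rho <= m.
  have -> : 2 * Lz * rho = m * Lz / (Lz + 1) by rewrite /rho; field; exact: lt0r_neq0.
  by rewrite ler_pdivrMr// ler_wpM2l ?(ltW m0)// lerDl.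
have [t1 t10 /= /and3P[t11 t1M _]] : exists2 t1, 0 < t1 & all (fun z => t1 <= z) [:: 1 / 2; rho / (2 * M)].
  by apply: lt_bounds; apply/and3P; split=> //; apply: divr_gt0 => //; exact: mulr_gt0.
have t1T : t1 <= T1 by move: t11 T11; clear; lra.
have [tmax tmaxI tmaxP] := EVT_max t1T (is_derive_within (fun t => (Sl t).1) : {within `[t1, T1], continuous xl}).
pose d1 := 1 - xl tmax.
have d10 : 0 < d1.
  rewrite subr_gt0; apply: xl_left; move: tmaxI; rewrite in_itv /=; move: t10; clear; lra.
pose B1 := K1 * (A + 1 + Lz).
have B10 : 0 < B1 by rewrite mulr_gt0// ltr_wpDr// addr_gt0.
pose G0 := K4 * (B0 + (1 + C1 * us)).
have C1us : 0 <= C1 * us by rewrite mulr_ge0.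
have G00 : 0 < G0 by rewrite mulr_gt0// addr_gt0// ltr_wpDr.
have Kz1 : 0 < Kz + 1 by rewrite ltr_wpDl.
have [h h0 /= /and5P[h1 hr hz hG /and5P[hK hc hk hm /and5P[hrho hd hd' hkap /andP[hkz _]]]]] :
  exists2 h, 0 < h & all (fun z => h <= z)
  [:: 1; r; r / (4 * (Kz + 1)); r / (8 * G0); sg / (3 * K4); c1 / 2; k0 / 2; m / (Lz + 1);
   rho / (2 * B1); d1 / (4 * B1); d1 / 4; kap / B1; kap / (Kz + 1)].
  apply: lt_bounds; apply/and5P; split; [done|done|..|apply/and5P; split; [..|apply/and5P; split; [..|apply/andP; split; [|done]]]];
   (apply: divr_gt0 => //; repeat apply: mulr_gt0 => //).

(* Estimates along the perturbed orbits *)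
exists h => // eta delta e Z1 Z2 /andP[et0 eth] /andP[dl0 dle] /andP[e0 eh] Z1L Z2L Zf Zg Zlip.
have et0' := ltW et0.
have eta1 : eta <= 1 by rewrite (le_trans eth).
have sc X c : 0 < c -> h <= X / c -> c * eta <= X.
  by move=> c0; rewrite ler_pdivlMr// mulrC => /(le_trans _); apply; rewrite ler_wpM2l// ltW.
have etr : 0 <= eta <= r by rewrite et0' (le_trans eth).
have etr0 : 0 <= eta <= r0 by rewrite et0' (le_trans eth)// (le_trans hr).
have ee : e <= eta by rewrite (le_trans eh)// ler_piMl.
have f1 : 4 * (Kz + 1) * eta <= r by apply: sc => //; exact: mulr_gt0.
have f2 : 8 * G0 * eta <= r by apply: sc => //; exact: mulr_gt0.
have f3 : 3 * (K4 * e) <= sg * eta.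
  have : h * (3 * K4) <= sg by rewrite -ler_pdivlMr// mulr_gt0.
  move=> /(ler_wpM2r et0'); apply: le_trans.
  have : K4 * e <= K4 * (h * eta) by rewrite ler_wpM2l// ltW.
  by clear; lra.
have f4 : 2 * e <= c1 * eta.
  have : h * eta <= c1 / 2 * eta by rewrite ler_wpM2r.
  by move: eh; clear; lra.
have f5 : 2 * e <= k0.
  have : h * eta <= h by rewrite ler_piMr// ltW.
  by move: eh hk; clear; lra.
have f6 : (Lz + 1) * eta <= m by exact: sc.
have f7 : 2 * B1 * eta <= rho by apply: sc => //; exact: mulr_gt0.
have f8 : 4 * B1 * eta <= d1 by apply: sc => //; exact: mulr_gt0.
have f9 : 4 * eta <= d1 by exact: sc.
have f10 : B1 * eta <= kap by exact: sc.
have f11 : (Kz + 1) * eta <= kap by exact: sc.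
have [n1 n2 n3 n4 n5] := Lnode eta etr0.
pose fc := e + C1 * eta * us.
have small : K4 * (B0 * eta + fc) <= r / 8.
  have : K4 * (B0 * eta + fc) <= G0 * eta.
    rewrite /G0 -mulrA ler_wpM2l ?(ltW K40)// /fc.
    by move: ee; move: (B0) => b; clear; lra.
  by move: f2; move: (K4 * _) (G0) => a b; clear; lra.
have Z0f x y : `|Z1 x y - L1 0 x y| <= (1 + Lz) * eta.
  have := ler_normD (Z1 x y - L1 eta x y) (L1 eta x y - L1 0 x y).
  rewrite addrA subrK; have [q1 _] := Leta eta x y etr0; have := Zf x y.
  by move: q1 ee; clear; lra.
have Z0g x y : `|Z2 x y - L2 0 x y| <= (1 + Lz) * eta.
  have := ler_normD (Z2 x y - L2 eta x y) (L2 eta x y - L2 0 x y).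
  rewrite addrA subrK; have [_ q1] := Leta eta x y etr0; have := Zg x y.
  by move: q1 ee; clear; lra.
have Aeta0 : 0 <= A * eta by rewrite mulr_ge0// ltW.
have Leta0 : 0 <= (1 + Lz) * eta by rewrite mulr_ge0// addr_ge0.
have init (x y : R -> R) : x 0 = 1 - delta -> `|y 0 - yq| <= A * eta ->
    `|x 0 - xl 0| <= A * eta /\ `|y 0 - yl 0| <= A * eta.
  move=> x0 y0; rewrite x0 xl0 yl0; split=> //.
  rewrite addrC addrA addNr sub0r normrN gtr0_norm// (le_trans dle)//.
  by rewrite ler_peMl.
have sh0 (x y : R -> R) : is_sol Z1 Z2 x y -> x 0 = 1 - delta -> `|y 0 - yq| <= A * eta ->
    `|x T0 - zx eta - (xl T0 - 1)| <= B0 * eta /\ `|y T0 - zy eta - (yl T0 - yL)| <= B0 * eta.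
  move=> S x0 y0; have [i1 i2] := init x y x0 y0.
  have T0b : 0 <= T0 <= T0 by rewrite T00 lexx.
  have [q1 q2] := HK0 _ _ _ _ _ _ _ _ _ _ Aeta0 Leta0 Z1L Z2L S Sl Z0f Z0g i1 i2 T0 T0b.
  have -> : B0 * eta = K0 * (A * eta + (1 + Lz) * eta) + Kz * eta by rewrite /B0; ring.
  have -> : x T0 - zx eta - (xl T0 - 1) = (x T0 - xl T0) - (zx eta - 1) by ring.
  have -> : y T0 - zy eta - (yl T0 - yL) = (y T0 - yl T0) - (zy eta - yL) by ring.
  have t1' := ler_normB (x T0 - xl T0) (zx eta - 1).
  have t2' := ler_normB (y T0 - yl T0) (zy eta - yL).
  by move: q1 q2 t1' t2' n3 n4; clear; lra.
have sh1 (x y : R -> R) : is_sol Z1 Z2 x y -> x 0 = 1 - delta -> `|y 0 - yq| <= A * eta ->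
    forall t, 0 <= t <= T1 -> `|x t - xl t| <= B1 * eta /\ `|y t - yl t| <= B1 * eta.
  move=> S x0 y0 t tb; have [i1 i2] := init x y x0 y0.
  have -> : B1 * eta = K1 * (A * eta + (1 + Lz) * eta) by rewrite /B1; ring.
  exact: HK1 _ _ _ _ _ _ _ _ _ _ Aeta0 Leta0 Z1L Z2L S Sl Z0f Z0g i1 i2 t tb.
have zxr : `|zx eta - 1| <= r / 4 by move: n3 f1 et0'; clear; lra.
have zyr : `|zy eta - yL| <= r / 4 by move: n4 f1 et0'; clear; lra.
have track (x y : R -> R) : is_sol Z1 Z2 x y -> x 0 = 1 - delta -> `|y 0 - yq| <= A * eta ->
    forall t, T0 <= t ->
    [/\ `|x t - zx eta - (xl t - 1)| <= K4 * (expR (- mu * (t - T0)) * (B0 * eta) + fc),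
        `|y t - zy eta - (yl t - yL)| <= K4 * (expR (- mu * (t - T0)) * (B0 * eta) + fc),
        `|x t - 1| <= r & `|y t - yL| <= r].
  move=> S x0 y0; have [i1 i2] := sh0 x y S x0 y0.
  have B0e : 0 <= B0 * eta by rewrite mulr_ge0 ?(ltW B00).
  have c1k : C1 * r <= k0 by move: C1rk C1r0; clear; lra.
  apply: (node_tracking Hnode rp mu0 (ltW K40) C10 et0' e0 us0 B0e c1k usr zxr zyr small S Sl Zf Zg _ _
    near_p i1 i2).
    by move=> *; apply: Llin.
  by move=> u w ur wr; apply: Lshift => //; [exact: le_trans ur rr0|exact: le_trans wr rr0].
have late (x y : R -> R) : is_sol Z1 Z2 x y -> x 0 = 1 - delta -> `|y 0 - yq| <= A * eta ->
    forall t, T1 <= t -> `|x t - zx eta - (xl t - 1)| <= sg * eta /\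
      `|y t - zy eta - (yl t - yL)| <= sg * eta.
  move=> S x0 y0 t Tt; have [d1' d2' _ _] := track x y S x0 y0 t (le_trans T0T1 Tt).
  have [E0 E1 _] := Elate t Tt.
  have E2 := ler_wpM2r et0' E1.
  have E3 := ler_wpM2r et0' uss.
  have bd : K4 * (expR (- mu * (t - T0)) * (B0 * eta) + fc) <= sg * eta.
    by rewrite /fc; move: E2 E3 f3; move: (expR _) (B0) => E b; clear; lra.
  by rewrite (le_trans d1' bd) (le_trans d2' bd).
(* At x <= 1 the node is at least kz eta to the right and the deviation is at most kz eta / 2, so 1
   - xl is at least kz eta / 2. This distance plays the role of rho in [weak_field]. *)
have field_at (x y : R -> R) : is_sol Z1 Z2 x y -> x 0 = 1 - delta -> `|y 0 - yq| <= A * eta ->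
    forall t, T1 <= t -> x t <= 1 ->
    c1 * eta <= L1 eta (x t) (y t) /\ `|L2 eta (x t) (y t)| <= S1 * L1 eta (x t) (y t).
  move=> S x0 y0 t Tt xt1; have T0t := le_trans T0T1 Tt.
  have [_ _ xb yb] := track x y S x0 y0 t T0t.
  have [D1 D2] := late x y S x0 y0 t Tt.
  have [cv1 cv2] := conv0 t T0t.
  have t0 : 0 <= t := le_trans T00 T0t.
  have r1 := xl_le t t0.
  have sgk' := ler_wpM2r et0' sgk.
  have rk' : kz / 2 * eta <= 1 - xl t.
    by move: D1 n5 xt1 sgk'; rewrite ler_norml; clear; lra.
  have sge' : sg * eta <= eps1 * (1 - xl t).
    rewrite (le_trans (ler_wpM2r et0' sge))// -mulrA ler_wpM2l// ltW//.
  have xz : `|zx eta - 1| <= r by move: zxr rp; clear; lra.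
  have yz : `|zy eta - yL| <= r by move: zyr rp; clear; lra.
  have [l1' l2'] := Llin r eta _ _ _ _ etr rr0 xb yb xz yz.
  have Hx : `|x t - zx eta + (1 - xl t)| <= eps1 * (1 - xl t).
    have -> : x t - zx eta + (1 - xl t) = x t - zx eta - (xl t - 1) by ring.
    exact: le_trans sge'.
  have Hy : `|y t - zy eta + mm * (1 - xl t)| <= 2 * eps1 * (1 - xl t).
    have -> : y t - zy eta + mm * (1 - xl t) =
      (y t - zy eta - (yl t - yL)) + (yl t - yL - mm * (xl t - 1)) by ring.
    have e1e' := ler_wpM2r r1 e1e.
    have := ler_normD (y t - zy eta - (yl t - yL)) (yl t - yL - mm * (xl t - 1)).
    by move: D2 cv2 e1e' sge'; clear; lra.
  have [w1 w2] := weak_field lam0 ev1 ev2 n1 n2 l1' l2' r1 C1r0 (ltW ep0) ep1 Hx Hy NE C1rl.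
  split => //; rewrite (le_trans _ w1)//.
  have := ler_wpM2l (ltW ml0) rk'; rewrite /c1; clear; lra.
have slope (x y : R -> R) : is_sol Z1 Z2 x y -> x 0 = 1 - delta -> `|y 0 - yq| <= A * eta ->
    forall t, T1 <= t -> x t <= 1 -> `|Z2 (x t) (y t)| <= S2 * Z1 (x t) (y t).
  move=> S x0 y0 t Tt xt1; have [w1 w2] := field_at x y S x0 y0 t Tt xt1.
  have z1 := Zf (x t) (y t); have z2 := Zg (x t) (y t).
  have h1' : L1 eta (x t) (y t) <= 2 * Z1 (x t) (y t) by move: z1 w1 f4; rewrite ler_norml; clear; lra.
  have h2' : e <= Z1 (x t) (y t) by move: z1 w1 f4; rewrite ler_norml; clear; lra.
  have h3' := ler_wpM2l S10 h1'.
  have := ler_normD (Z2 (x t) (y t) - L2 eta (x t) (y t)) (L2 eta (x t) (y t)).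
  by rewrite subrK /S2; move: w2 z2 h2' h3'; clear; lra.
(* No arrival before [T1]: the orbit moves left with speed at least [m] up to [t1], and afterwards
   the gap [d1] of the incoming orbit absorbs the shadowing error. *)
have early (x y : R -> R) : is_sol Z1 Z2 x y -> x 0 = 1 - delta -> `|y 0 - yq| <= A * eta ->
    forall t, 0 < t -> t <= T1 -> x t < 1 - delta.
  move=> S x0 y0 t t0 tT; have sh := sh1 x y S x0 y0.
  have [tt1|tt1] := leP t t1; last first.
    have tb : 0 <= t <= T1 by rewrite (ltW t0).
    have [q1 _] := sh t tb.
    have := tmaxP t; rewrite in_itv /= (ltW tt1) tT => /(_ isT) q2.
    by move: q1 q2 f8 f9 dle et0; rewrite ler_norml /d1; clear; lra.
  have xD := fun t => (S t).1.
  have : x t - x 0 <= - m * (t - 0).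
    apply: (der_le (ltW t0) (fun t _ => xD t) (is_derive_within xD)) => s' /andP[s0' st'].
    have sb : 0 <= s' <= T1 by rewrite (ltW s0') (le_trans (ltW st')).
    have [q1 q2] := sh s' sb.
    have small_t : M * s' <= rho / 2.
      have : M * s' <= M * t1 by rewrite ler_wpM2l ?(ltW M0)// (le_trans (ltW st')).
      by move: t1M; rewrite ler_pdivlMr ?mulr_gt0//; clear; lra.
    have gen (z dz : R -> R) : (forall t : R, is_derive t (1:R) z (dz t)) -> (forall t, `|dz t| <= M) ->
        `|z s' - z 0| <= rho / 2.
      move=> zD zM; have zM' q : - M <= dz q <= M by rewrite -ler_norml.
      have g1 := der_le (ltW s0') (fun t _ => zD t) (is_derive_within zD) (fun q _ => proj2 (andP (zM' q))).
      have g2 := der_ge (ltW s0') (fun t _ => zD t) (is_derive_within zD) (fun q _ => proj1 (andP (zM' q))).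
      by rewrite ler_norml; move: g1 g2 small_t; clear; lra.
    have g1 := gen _ _ (fun t => (Sl t).1) (fun t => L1M _ _).
    have g2 := gen _ _ (fun t => (Sl t).2) (fun t => L2M _ _).
    rewrite xl0 in g1; rewrite yl0 in g2.
    have xa : `|x s' - 1| <= rho.
      have := ler_normD (x s' - xl s') (xl s' - 1); rewrite addrA subrK.
      by move: q1 g1 f7; clear; lra.
    have ya : `|y s' - yq| <= rho.
      have := ler_normD (y s' - yl s') (yl s' - yq); rewrite addrA subrK.
      by move: q2 g2 f7; clear; lra.
    have := lip_ball Z1L xa ya; have := Z0f 1 yq; rewrite !ler_norml.
    by move: rhom f6 mq m0; clear; lra.
  have : 0 < m * t by rewrite mulr_gt0.
  by rewrite x0; clear; lra.
have kze : 0 < kz * eta / 2 by rewrite divr_gt0// mulr_gt0.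
have [Tc Tc0 convc] := conv _ kze.
(* From [Tc] on the incoming orbit is within kz eta / 2 of x = 1, while the node lies kz eta beyond
   that line; so the tracked orbit has come back by [T2]. *)
pose T2 := Num.max Tc T1.
have T12 : T1 <= T2 by rewrite le_max lexx orbT.
(* The lower bound [T1] on the arrival time is kept because the contraction factor is reached only
   after it. *)
pose Q (x y : R -> R) (t : R) := T1 <= t /\ [/\ [/\ 0 <= t, t <= T2, x t = 1 - delta & `|y t - yL| <= C0 * eta],
      (forall r, 0 <= r <= t -> [/\ x r <= 1 - delta, `|x r - xl r| <= kap & `|y r - yl r| <= kap]),
      (forall r, t <= r -> `|xl r - 1| <= kap /\ `|yl r - yL| <= kap) &
      c1 * eta <= L1 eta (1 - delta) (y t) /\
      `|L2 eta (1 - delta) (y t)| <= S1 * L1 eta (1 - delta) (y t)].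

(* Arrival and contraction *)
have := @choose_map _ (fun x y => is_sol Z1 Z2 x y /\ x 0 = 1 - delta) (fun a => `|a - yq| <= A * eta) Q theta.
case.
- by move=> a; have [x [y [x0 y0 S]]] := flow_exists (1 - delta) a Z1L Z2L; exists x, y.
- move=> x y [S x0] y0.
  have xD := fun t => (S t).1.
  have x1 : x T1 < 1 - delta by apply: (early x y S x0 y0) => //; exact: lt_le_trans T11.
  have x2 : 1 - delta <= x T2.
    have TcT2 : Tc <= T2 by rewrite le_max lexx.
    have [c1' _] := convc T2 TcT2.
    have [D1 _] := late x y S x0 y0 T2 T12.
    have sgk' := ler_wpM2r et0' sgk.
    by move: c1' D1 n5 sgk' dl0; rewrite ler_norml; clear; lra.
  have [t [tT1 tT2 xt bef]] := first_hit T12 (is_derive_within xD) x1 x2.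
  have T1t := ltW tT1; have t0 : 0 <= t := le_trans T10 T1t.
  have left_ r' : 0 <= r' <= t -> x r' <= 1 - delta.
    rewrite le_eqVlt => /andP[/orP[/eqP <-|r0'] rt]; first by rewrite x0.
    have [rT|rT] := leP r' T1; first by rewrite ltW//; exact: (early x y S x0 y0).
    have [rlt|rge] := ltP r' t; last by rewrite (le_anti (introT andP (conj rt rge))) xt.
    by rewrite ltW// bef// (ltW rT).
  have [D1 D2] := late x y S x0 y0 t T1t.
  have T0t := le_trans T0T1 T1t.
  have sge1 := ler_wpM2r et0' sg1.
  exists t; split=> //; split.
  + split => //.
    have [_ cv2] := conv0 t T0t.
    have r1 := xl_le t t0.
    have r2 : 1 - xl t <= (Kz + 2) * eta.
      by move: D1 n3 sge1 dle; rewrite xt !ler_norml; clear; lra.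
    have e1r1 : e1 * (1 - xl t) <= 1 - xl t by rewrite ler_piMl// (le_trans e1e).
    have m1 : `|yl t - yL| <= (mA + 1) * (1 - xl t).
      have -> : yl t - yL = (yl t - yL - mm * (xl t - 1)) + mm * (xl t - 1) by ring.
      have := ler_normD (yl t - yL - mm * (xl t - 1)) (mm * (xl t - 1)).
      rewrite normrM (distrC (xl t)) (ger0_norm r1) -/mA.
      by move: cv2 e1r1; clear; lra.
    have m2 : (mA + 1) * (1 - xl t) <= (mA + 1) * ((Kz + 2) * eta).
      by rewrite ler_wpM2l// addr_ge0.
    have -> : y t - yL = (y t - zy eta - (yl t - yL)) + (zy eta - yL) + (yl t - yL) by ring.
    have j1 := ler_normD (y t - zy eta - (yl t - yL) + (zy eta - yL)) (yl t - yL).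
    have j2 := ler_normD (y t - zy eta - (yl t - yL)) (zy eta - yL).
    by rewrite /C0; move: j1 j2 D2 n4 m1 m2 sge1; clear; lra.
  + move=> r' rb; split; first exact: left_.
    * have [rT|rT] := leP r' T1.
        have [|q1 _] := sh1 x y S x0 y0 r'; first by rewrite rT; case/andP: rb => ->.
        exact: le_trans q1 f10.
      have [q1 _] := late x y S x0 y0 r' (ltW rT).
      have -> : x r' - xl r' = (x r' - zx eta - (xl r' - 1)) + (zx eta - 1) by ring.
      rewrite (le_trans (ler_normD _ _))// (le_trans _ f11)//.
      by move: q1 n3 sge1; clear; lra.
    * have [rT|rT] := leP r' T1.
        have [|_ q1] := sh1 x y S x0 y0 r'; first by rewrite rT; case/andP: rb => ->.
        exact: le_trans q1 f10.
      have [_ q1] := late x y S x0 y0 r' (ltW rT).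
      have -> : y r' - yl r' = (y r' - zy eta - (yl r' - yL)) + (zy eta - yL) by ring.
      rewrite (le_trans (ler_normD _ _))// (le_trans _ f11)//.
      by move: q1 n4 sge1; clear; lra.
  + move=> r' tr'; have := near_p r' (le_trans T0t tr').
    have := normr_ge0 (xl r' - 1); have := normr_ge0 (yl r' - yL).
    by move: usk; clear; lra.
  + have := field_at x y S x0 y0 t T1t; rewrite xt; apply.
    by move: dl0; clear; lra.
- move=> x y t x' y' t' [S x0] [S' x'0] y0 y'0 Q1 Q2.
  wlog tt : x y t x' y' t' S x0 S' x'0 y0 y'0 Q1 Q2 / t <= t'.
    move=> H; have [g1|/ltW g1] := leP t t'; first exact: H.
    by rewrite distrC [`|y 0 - _|]distrC; exact: H.
  have [T1t [[t0 _ xt _] _ _ _]] := Q1; have [T1t' [[_ _ xt' _] left' _ _]] := Q2.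
  have T0t := le_trans T0T1 T1t.
  have self (f : R -> R -> R) a b : `|f a b - f a b| <= 0 by rewrite subrr normr0.
  have g1 : `|x 0 - x' 0| <= `|y 0 - y' 0| by rewrite x0 x'0 subrr normr0.
  have T0b : 0 <= T0 <= T0 by rewrite T00 lexx.
  have [i1 i2] := HK0 Z1 Z2 Z1 Z2 x y x' y' _ 0 (normr_ge0 _) (lexx _) Z1L Z2L S S'
    (self Z1) (self Z2) g1 (lexx _) T0 T0b.
  rewrite addr0 in i1 i2; set d := `|y 0 - y' 0| in i1 i2 *.
  have uD (z : R) : is_derive z (1:R) (fun z => x z - x' z) (Z1 (x z) (y z) - Z1 (x' z) (y' z)).
    by have [A1' _] := S z; have [A2' _] := S' z; apply: is_derive_eq.
  have wD (z : R) : is_derive z (1:R) (fun z => y z - y' z) (Z2 (x z) (y z) - Z2 (x' z) (y' z)).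
    by have [_ A1'] := S z; have [_ A2'] := S' z; apply: is_derive_eq.
  have d0 : 0 <= d by exact: normr_ge0.
  have Kd0 : 0 <= K0 * d by rewrite mulr_ge0 ?(ltW K00).
  (* Two orbits of the same field: there is no forcing term, and their difference decays
     exponentially on [T0, t]. *)
  have [|u1 u2] := Hnode _ _ _ _ T0 t (K0 * d) 0 T0t Kd0 (lexx _) uD wD _ i1 i2.
    move=> z /andP[Tz zt].
    have [_ _ xb yb] := track x y S x0 y0 z (ltW Tz).
    have [_ _ xb' yb'] := track x' y' S' x'0 y'0 z (ltW Tz).
    have [s1' s2'] := Llin r eta _ _ _ _ etr rr0 xb yb xb' yb'.
    have [p1 p2] := Zlip (x z) (y z) (x' z) (y' z).
    set dd := `|x z - x' z| + `|y z - y' z| in s1' s2' p1 p2 *.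
    have dd0 : 0 <= dd by rewrite addr_ge0.
    have kd : (C1 * r + e) * dd <= k0 * dd by rewrite ler_wpM2r//; move: f5 C1rk; clear; lra.
    have tri (p q p' q' j : R) : `|p - q - j| <= `|p' - q' - j| + `|p - p' - (q - q')|.
      have -> : p - q - j = (p' - q' - j) + (p - p' - (q - q')) by ring.
      exact: ler_normD.
    split.
      have := tri (Z1 (x z) (y z)) (Z1 (x' z) (y' z)) (L1 eta (x z) (y z)) (L1 eta (x' z) (y' z))
        (a11 * (x z - x' z) + a21 * (y z - y' z)).
      by move: s1' p1 kd; clear; lra.
    have := tri (Z2 (x z) (y z)) (Z2 (x' z) (y' z)) (L2 eta (x z) (y z)) (L2 eta (x' z) (y' z))
      (a12 * (x z - x' z) + a22 * (y z - y' z)).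
    by move: s2' p2 kd; clear; lra.
  rewrite addr0 in u1 u2.
  have [E0 _ E1] := Elate t T1t.
  (* Between the two arrivals the later orbit moves along a bounded slope, and its x-displacement is
     the deviation already estimated at the earlier arrival. *)
  have drift : `|y' t' - y' t| <= S2 * (x' t' - x' t).
    apply: (slope_drift tt (fun t => (S' t).1) (fun t => (S' t).2)) => z /andP[tz zt].
    apply: (slope x' y' S' x'0 y'0); first by rewrite (le_trans T1t)// ltW.
    have [|q1 _ _] := left' z; first by rewrite (le_trans t0 (ltW tz)) (ltW zt).
    by move: q1 dl0; clear; lra.
  have dr2 : S2 * (x' t' - x' t) <= S2 * (K4 * (expR (- mu * (t - T0)) * (K0 * d))).
    by rewrite ler_wpM2l// xt' -xt (le_trans (ler_norm _)).
  have E2 := ler_wpM2r d0 E1.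
  have := ler_normD (y t - y' t) (y' t - y' t'); rewrite addrA subrK.
  rewrite [`|y' t - y' t'|]distrC.
  by move: u2 drift dr2 E2; move: (expR _) (S2) => E c; clear; lra.
- move=> Y [Y1 Y2]; exists Y, T2; split=> // x y S y0.
  by have [t [[_ Qt] yt]] := Y1 x y S y0; exists t.
Qed.

End stage_left.

(** * The switching layer *)

Section loop.
Context {R : realType}.

(* Inside the layer only 0 <= psi <= 1 enters the estimates: the constant of
   gate_lip, of order 1/eps, is used for existence and uniqueness of orbits only. *)
Record gate (delta sigma : R) (psi : R -> R) : Prop := {
  gate01 : forall x, 0 <= psi x <= 1;
  gate_lip : exists2 k, 0 <= k & forall x x', `|psi x - psi x'| <= k * `|x - x'|;
  gate_left : forall x, x <= 1 - delta -> psi x <= sigma;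
  gate_left_lip : forall x x', x <= 1 - delta -> x' <= 1 - delta ->
    `|psi x - psi x'| <= sigma * `|x - x'|;
  gate_right : forall x, 1 + delta <= x -> 1 - psi x <= sigma;
  gate_right_lip : forall x x', 1 + delta <= x -> 1 + delta <= x' ->
    `|psi x - psi x'| <= sigma * `|x - x'| }.

Definition blend (A B : R -> R -> R) (w : R -> R) (x y : R) := A x y + w x * (B x y - A x y).

Lemma blend_swap A B w x y : blend A B w x y = blend B A (fun x => 1 - w x) x y.
Proof. by rewrite /blend; ring. Qed.

(** The perturbation w (B - A) has a small Lipschitz constant when [s] and [k] are small; this
    first-order smallness preserves the contraction at the node. *)
Lemma blend_sub_lip (A B : R -> R -> R) (w : R -> R) (Lc M s k : R) :
  lip Lc A -> lip Lc B -> (forall x y, `|A x y| <= M) -> (forall x y, `|B x y| <= M) ->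
  (forall x, 0 <= w x <= s) -> (forall x x', `|w x - w x'| <= k * `|x - x'|) ->
  forall x y x' y', `|blend A B w x y - A x y - (blend A B w x' y' - A x' y')| <=
    (2 * Lc * s + 2 * M * k) * (`|x - x'| + `|y - y'|).
Proof.
move=> AL BL AM BM ws wk x y x' y'; rewrite /blend.
have -> : A x y + w x * (B x y - A x y) - A x y - (A x' y' + w x' * (B x' y' - A x' y') - A x' y') =
  w x * ((B x y - B x' y') - (A x y - A x' y')) + (w x - w x') * (B x' y' - A x' y') by ring.
rewrite (le_trans (ler_normD _ _))// [leRHS]mulrDl lerD//.
  rewrite normrM [2 * Lc * s]mulrC -mulrA.
  have /andP[w0 w1] := ws x; rewrite (ger0_norm w0).
  apply: ler_pM => //; rewrite (le_trans (ler_normB _ _))//.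
  by have := AL x y x' y'; have := BL x y x' y'; clear; lra.
have M0 : 0 <= M := le_trans (normr_ge0 _) (AM 0 0).
have k0 : 0 <= k by have := wk 1 0; rewrite subr0 normr1 mulr1; exact: le_trans.
rewrite normrM mulrC [2 * M * k * _]mulrAC -mulrA.
have h1 : `|B x' y' - A x' y'| <= 2 * M.
  by rewrite (le_trans (ler_normB _ _))//; have := AM x' y'; have := BM x' y'; clear; lra.
have h2 : `|w x - w x'| <= k * (`|x - x'| + `|y - y'|).
  by rewrite (le_trans (wk _ _))// ler_wpM2l// lerDl.
rewrite mulrA mulrAC -mulrA; apply: (@le_trans _ _ (2 * M * (k * (`|x - x'| + `|y - y'|)))).
  exact: ler_pM.
by apply: eq_ler; ring.
Qed.

Lemma blend_lip (A B : R -> R -> R) (w : R -> R) (Lc M s k : R) :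
  lip Lc A -> lip Lc B -> (forall x y, `|A x y| <= M) -> (forall x y, `|B x y| <= M) ->
  (forall x, 0 <= w x <= s) -> (forall x x', `|w x - w x'| <= k * `|x - x'|) ->
  lip (Lc + (2 * Lc * s + 2 * M * k)) (blend A B w).
Proof.
move=> AL BL AM BM ws wk x y x' y'.
have h := blend_sub_lip AL BL AM BM ws wk x y x' y'.
have -> : blend A B w x y - blend A B w x' y' = (A x y - A x' y') +
  (blend A B w x y - A x y - (blend A B w x' y' - A x' y')) by ring.
by rewrite (le_trans (ler_normD _ _))// mulrDl lerD.
Qed.

Lemma blend_close (A B : R -> R -> R) (w : R -> R) (M s : R) :
  (forall x y, `|A x y| <= M) -> (forall x y, `|B x y| <= M) -> (forall x, 0 <= w x <= s) ->
  forall x y, `|blend A B w x y - A x y| <= 2 * M * s.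
Proof.
move=> AM BM ws x y; rewrite /blend addrAC subrr add0r normrM mulrC.
have /andP[w0 w1] := ws x; rewrite (ger0_norm w0); apply: ler_pM => //.
by rewrite (le_trans (ler_normB _ _))//; have := AM x y; have := BM x y; clear; lra.
Qed.

Lemma blend_lip_y (A B : R -> R -> R) (w : R -> R) (Lc : R) :
  lip Lc A -> lip Lc B -> (forall x, 0 <= w x <= 1) ->
  forall x y y', `|blend A B w x y - blend A B w x y'| <= (3 * Lc + 1) * `|y - y'|.
Proof.
move=> AL BL w01 x y y'; rewrite /blend.
have -> : A x y + w x * (B x y - A x y) - (A x y' + w x * (B x y' - A x y')) =
  (1 - w x) * (A x y - A x y') + w x * (B x y - B x y') by ring.
have /andP[w0 w1] := w01 x; have Lc0 := lip_ge0 AL.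
have hA := AL x y x y'; have hB := BL x y x y'; rewrite subrr normr0 add0r in hA hB.
rewrite (le_trans (ler_normD _ _))// !normrM (ger0_norm w0) ger0_norm ?subr_ge0//.
have i1 : (1 - w x) * `|A x y - A x y'| <= 1 * (Lc * `|y - y'|).
  by apply: ler_pM; rewrite ?subr_ge0// gerBl.
have i2 : w x * `|B x y - B x y'| <= 1 * (Lc * `|y - y'|) by apply: ler_pM.
have i3 : 0 <= Lc * `|y - y'| by rewrite mulr_ge0.
by have := normr_ge0 (y - y'); move: i1 i2 i3; clear; lra.
Qed.

(** The vectors (a, p) with m <= a and |p| <= S a form a convex set. Hence slope bounds inside the
    layer do not depend on the weight, nor on eps. *)
Lemma convex_slope (a b p q m S t : R) : 0 <= t <= 1 -> m <= a -> m <= b ->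
  `|p| <= S * a -> `|q| <= S * b ->
  m <= a + t * (b - a) /\ `|p + t * (q - p)| <= S * (a + t * (b - a)).
Proof.
move=> /andP[t0 t1] ma mb pa qb; have s0 : 0 <= 1 - t by rewrite subr_ge0.
have i1 := ler_wpM2l s0 ma; have i2 := ler_wpM2l t0 mb.
have i3 := ler_wpM2l s0 pa; have i4 := ler_wpM2l t0 qb.
split; first by move: i1 i2; clear; lra.
have -> : p + t * (q - p) = (1 - t) * p + t * q by ring.
rewrite (le_trans (ler_normD _ _))// !normrM (ger0_norm t0) (ger0_norm s0).
by move: i3 i4; clear; lra.
Qed.

Record crossing_fields (L1 L2 R1 R2 : R -> R -> R -> R) (Lc M r0 : R) : Prop := {
  cf_M : 0 < M;
  cf_r0 : 0 < r0;
  cf_lip : forall eta, 0 <= eta <= r0 ->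
    [/\ lip Lc (L1 eta), lip Lc (L2 eta), lip Lc (R1 eta) & lip Lc (R2 eta)];
  cf_bnd : forall eta, 0 <= eta <= r0 -> forall x y,
    [/\ `|L1 eta x y| <= M, `|L2 eta x y| <= M, `|R1 eta x y| <= M & `|R2 eta x y| <= M];
  cf_eta : forall eta, 0 <= eta <= r0 -> forall x y,
    [/\ `|L1 eta x y - L1 0 x y| <= Lc * eta, `|L2 eta x y - L2 0 x y| <= Lc * eta,
        `|R1 eta x y - R1 0 x y| <= Lc * eta & `|R2 eta x y - R2 0 x y| <= Lc * eta] }.

(** At q^R both fields point to the left with speed bounded below, so the rectangle and all
    constants are chosen before [eta]. The passage is reflected to apply [strip_transit]. *)
Lemma strip_q (L1 L2 R1 R2 : R -> R -> R -> R) (Lc M r0 yq : R) :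
  crossing_fields L1 L2 R1 R2 Lc M r0 -> L1 0 1 yq < 0 -> R1 0 1 yq < 0 ->
  exists w S m h, [/\ 0 < w, 0 <= S, 0 < m, 0 < h &
  forall eta delta sigma psi, 0 <= eta <= h -> 0 < delta <= h -> gate delta sigma psi ->
  exists Y : R -> R,
  (forall x y : R -> R, is_sol (blend (L1 eta) (R1 eta) psi) (blend (L2 eta) (R2 eta) psi) x y ->
     x 0 = 1 + delta -> `|y 0 - yq| + 2 * S * delta <= w ->
     exists t, [/\ 0 < t, t <= 2 * delta / m, x t = 1 - delta, y t = Y (y 0) &
       forall s, 0 <= s <= t -> `|x s - 1| <= delta /\ `|y s - y 0| <= 2 * S * delta]) /\
  (forall a b, `|Y a - Y b| <= expR 1 * `|a - b|)].
Proof.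
move=> [M0 r00 FL FM Feta] Lq Rq.
have z0 : (0:R) <= 0 <= r0 by rewrite lexx ltW.
have Lc0 : 0 <= Lc by have [/lip_ge0] := FL 0 z0.
have [m m0 /= /and3P[mL mR _]] : exists2 m, 0 < m & all (fun r => m <= r) [:: - L1 0 1 yq / 4; - R1 0 1 yq / 4].
  by apply: lt_bounds; apply/and3P; split=> //; rewrite divr_gt0// oppr_gt0.
have Lc1 : 0 < 3 * Lc + 1 by rewrite ltr_wpDl// mulr_ge0.
(* On a rectangle of this size the first components differ by at most 3 Lc w <= m from their values
   at q^R for eta = 0, which are at most - 4 m. *)
pose w := m / (3 * Lc + 1).
have w0 : 0 < w by rewrite divr_gt0.
have S0 : 0 <= M / m by rewrite divr_ge0// ltW.
have c0 : 0 < (3 * Lc + 1) * (1 + M / m) / m * 2.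
  by apply: mulr_gt0 => //; apply: divr_gt0 => //; apply: mulr_gt0 => //; rewrite ltr_wpDr.
have [h h0 /= /and4P[hw hr hc _]] : exists2 h, 0 < h & all (fun r => h <= r)
    [:: w; r0; 1 / ((3 * Lc + 1) * (1 + M / m) / m * 2)].
  by apply: lt_bounds; apply/and4P; split=> //; rewrite divr_gt0.
exists w, (M / m), m, h; split=> // eta delta sigma psi /andP[et0 eth] /andP[d0 dh] [p01 [k k0 pk] _ _ _ _].
have etr : 0 <= eta <= r0 by rewrite et0 (le_trans eth).
have [L1L L2L R1L R2L] := FL eta etr; have Fb := FM eta etr; have Fe := Feta eta etr.
pose F1 := blend (L1 eta) (R1 eta) psi; pose F2 := blend (L2 eta) (R2 eta) psi.
have F1L : lip (Lc + (2 * Lc * 1 + 2 * M * k)) F1.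
  by apply: blend_lip => // x y; have [] := Fb x y.
have F2L : lip (Lc + (2 * Lc * 1 + 2 * M * k)) F2.
  by apply: blend_lip => // x y; have [] := Fb x y.
have refl x x' : `|2 - x - (2 - x')| = `|x - x'|.
  by rewrite [RHS]distrC; congr `|_|; ring.
have FrL (F : R -> R -> R) K : lip K F -> lip K (fun a b => F (2 - a) b).
  by move=> HF x y x' y'; rewrite (le_trans (HF _ _ _ _))// refl.
have Fry (F : R -> R -> R) x y y' : `|F x y - F x y'| = `|- F x y - - F x y'|.
  by rewrite -opprD normrN.
have rect x y : `|x - 1| <= delta -> `|y - yq| <= w ->
    m <= - F1 (2 - x) y /\ `|F2 (2 - x) y| <= M / m * - F1 (2 - x) y.
  move=> x1 yw.
  have x1' : `|(2 - x) - 1| <= w.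
    have -> : 2 - x - 1 = - (x - 1) by ring.
    by rewrite normrN (le_trans x1)// (le_trans dh).
  have neg (F : R -> R -> R -> R) : lip Lc (F eta) -> (forall x y, `|F eta x y - F 0 x y| <= Lc * eta) ->
      m <= - F 0 1 yq / 4 -> m <= - F eta (2 - x) y.
    move=> HF He Hm.
    have h1 := lip_ball HF x1' yw; have h2 := He 1 yq.
    have h3 : Lc * eta <= Lc * w by rewrite ler_wpM2l// (le_trans eth).
    have h4 : 3 * (Lc * w) <= m.
      have -> : 3 * (Lc * w) = m * (3 * Lc) / (3 * Lc + 1) by rewrite /w; field; exact: lt0r_neq0.
      by rewrite ler_pdivrMr// ler_wpM2l ?(ltW m0)// lerDl.
    by move: h1 h2 h3 h4 Hm m0; rewrite !ler_norml; clear; lra.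
  have nL : m <= - L1 eta (2 - x) y by apply: neg => // u v; have [] := Fe u v.
  have nR : m <= - R1 eta (2 - x) y by apply: neg => // u v; have [] := Fe u v.
  have sl a : m <= a -> M <= M / m * a.
    by move=> ma; rewrite -mulrA ler_peMr ?(ltW M0)// mulrC ler_pdivlMr// mul1r.
  have [_ bL2 _ bR2] := Fb (2 - x) y.
  have [] := convex_slope (p01 (2 - x)) nL nR (le_trans bL2 (sl _ nL)) (le_trans bR2 (sl _ nR)).
  have -> : - L1 eta (2 - x) y + psi (2 - x) * (- R1 eta (2 - x) y - - L1 eta (2 - x) y) = - F1 (2 - x) y.
    by rewrite /F1 /blend; ring.
  by [].
have Lyb x y y' : `|x - 1| <= delta ->
   `|- F1 (2 - x) y - - F1 (2 - x) y'| <= (3 * Lc + 1) * `|y - y'| /\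
   `|F2 (2 - x) y - F2 (2 - x) y'| <= (3 * Lc + 1) * `|y - y'|.
  by move=> _; rewrite -Fry; split; apply: blend_lip_y.
have small : (3 * Lc + 1) * (1 + M / m) / m * (2 * delta) <= 1.
  rewrite mulrA [X in X <= _]mulrC -ler_pdivlMr//; exact: le_trans dh hc.
have [Y [Y1 Y2]] := strip_transit (lipN (FrL _ _ F1L)) (FrL _ _ F2L) Lc1 m0 S0 d0 (ltW w0) rect Lyb small.
exists Y; split=> // x y S x0 y0.
have S' := is_sol_reflect S.
have x0' : 2 - x 0 = 1 - delta by rewrite x0; ring.
have [t [t0 tm xt yt Hs]] := Y1 _ _ S' x0' y0.
exists t; split=> //; first by move: xt; clear; lra.
move=> s /Hs[h1 h2]; split=> //.
have -> : x s - 1 = - (2 - x s - 1) by ring.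
by rewrite normrN.
Qed.

(* Here XL points to the right by an amount of order eta >= a only, so the
   width of the layer has to be small compared with a. *)
Lemma strip_p (L1 L2 R1 R2 : R -> R -> R -> R) (Lc M r0 yL C0 c1 S1 : R) :
  crossing_fields L1 L2 R1 R2 Lc M r0 -> 0 < R1 0 1 yL -> 0 < C0 -> 0 < c1 -> 0 <= S1 ->
  exists S, 0 <= S /\ forall A2, 0 <= A2 -> exists th h, [/\ 0 < th, 0 < h &
  forall a, 0 < a <= h -> exists2 d0, 0 < d0 & exists2 TM, 0 <= TM &
  forall eta delta sigma psi yc, a <= eta <= h -> 0 < delta <= d0 -> gate delta sigma psi ->
  `|yc - yL| <= C0 * eta ->
  c1 * eta <= L1 eta (1 - delta) yc -> `|L2 eta (1 - delta) yc| <= S1 * L1 eta (1 - delta) yc ->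
  exists Y : R -> R,
  (forall x y : R -> R, is_sol (blend (L1 eta) (R1 eta) psi) (blend (L2 eta) (R2 eta) psi) x y ->
     x 0 = 1 - delta -> `|y 0 - yc| <= th * (A2 * eta) ->
     exists t, [/\ 0 < t, t <= TM, x t = 1 + delta, y t = Y (y 0) &
       forall s, 0 <= s <= t -> `|x s - 1| <= delta /\ `|y s - y 0| <= 2 * S * delta]) /\
  (forall a b, `|Y a - Y b| <= expR 1 * `|a - b|)].
Proof.
move=> [M0 r00 FL FM Feta] Rp C00 c10 S10.
have z0 : (0:R) <= 0 <= r0 by rewrite lexx ltW.
have Lc0 : 0 <= Lc by have [/lip_ge0] := FL 0 z0.
pose mR := R1 0 1 yL / 2; have mR0 : 0 < mR by rewrite divr_gt0.
have Lc1 : 0 < 3 * Lc + 1 by rewrite ltr_wpDl// mulr_ge0.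
have Lc2 : 0 < Lc + 1 by rewrite ltr_wpDl.
(* A slope bound common to both fields: 2 S1 + 1 for [XL], M / mR for [XR]. *)
pose S := 2 * S1 + 1 + M / mR.
have Mm0 : 0 <= M / mR by rewrite divr_ge0// ltW.
have S0 : 0 <= S by rewrite addr_ge0// addr_ge0// mulr_ge0.
exists S; split=> // A2 A20.
have A21 : 0 < A2 + 1 by rewrite ltr_wpDl.
(* A vertical displacement of th * A2 * eta changes L1 by at most c1 eta / 8. *)
pose th := c1 / (8 * ((Lc + 1) * (A2 + 1))).
have th0 : 0 < th by apply: divr_gt0 => //; repeat apply: mulr_gt0 => //.
have Lth : 8 * (Lc * (th * A2)) <= c1.
  have : 8 * ((Lc + 1) * (th * (A2 + 1))) = c1 by rewrite /th; field; rewrite !lt0r_neq0.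
  have i1 : 0 <= Lc * th by rewrite mulr_ge0 ?(ltW th0).
  have i2 : 0 <= th * A2 by rewrite mulr_ge0 ?(ltW th0).
  by move: i1 i2 th0; clear; lra.
have CC : 0 < (Lc + 1) * (C0 + c1 + 2).
  by apply: mulr_gt0 => //; rewrite !addr_gt0.
have [h h0 /= /and5P[hr h1 hc hR _]] : exists2 h, 0 < h & all (fun r => h <= r)
    [:: r0; 1; 2 * mR / c1; mR / ((Lc + 1) * (C0 + c1 + 2))].
  by apply: lt_bounds; apply/and5P; split=> //; apply: divr_gt0 => //; exact: mulr_gt0.
exists th, h; split=> // a /andP[a0 ah].
have S11 : 0 < 1 + S by rewrite ltr_wpDr.
(* The second entry keeps L1 of order [eta] across the layer, the third bounds the expansion by e;
   both are proportional to [a]. *)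
have [d0 d00 /= /and4P[d01 d0S d0s _]] : exists2 d, 0 < d & all (fun r => d <= r)
    [:: a; c1 * a / (8 * ((Lc + 1) * (2 + 2 * S))); c1 * a / (4 * ((3 * Lc + 1) * (1 + S)))].
  apply: lt_bounds; apply/and4P; split=> //; apply: divr_gt0; repeat apply: mulr_gt0 => //.
  by rewrite ltr_wpDr// mulr_ge0.
have c1a0 : 0 < c1 * a by exact: mulr_gt0.
exists d0 => //; exists (2 * d0 / (c1 * a / 2)); first by rewrite divr_ge0 ?mulr_ge0 ?divr_ge0// ltW.
move=> eta delta sigma psi yc /andP[aet eth] /andP[dl0 dld] [p01 [k k0 pk] _ _ _ _] ycL L1c L2c.
have et0 : 0 < eta := lt_le_trans a0 aet.
have etr : 0 <= eta <= r0 by rewrite (ltW et0) (le_trans eth).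
have [L1L L2L R1L R2L] := FL eta etr; have Fb := FM eta etr; have Fe := Feta eta etr.
pose F1 := blend (L1 eta) (R1 eta) psi; pose F2 := blend (L2 eta) (R2 eta) psi.
have F1L : lip (Lc + (2 * Lc * 1 + 2 * M * k)) F1.
  by apply: blend_lip => // x y; have [] := Fb x y.
have F2L : lip (Lc + (2 * Lc * 1 + 2 * M * k)) F2.
  by apply: blend_lip => // x y; have [] := Fb x y.
pose w := th * (A2 * eta) + 2 * S * delta.
have w0 : 0 <= w.
  exact: (addr_ge0 (mulr_ge0 (ltW th0) (mulr_ge0 A20 (ltW et0))) (mulr_ge0 (mulr_ge0 (ler0n _ 2) S0) (ltW dl0))).
have c1ae : c1 * a <= c1 * eta by rewrite ler_wpM2l ?(ltW c10).
have ds : 8 * ((Lc + 1) * (2 + 2 * S)) * delta <= c1 * eta.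
  have pos : 0 < 8 * ((Lc + 1) * (2 + 2 * S)).
    by repeat apply: mulr_gt0 => //; rewrite ltr_wpDr// mulr_ge0.
  apply: le_trans c1ae; have := le_trans dld d0S; rewrite (ler_pdivlMr _ _ pos) mulrC; exact.
have LD : 4 * (Lc * (2 * delta + w)) <= c1 * eta.
  have i1 := ler_wpM2r (ltW et0) Lth.
  have i2 : 0 <= (2 + 2 * S) * delta by rewrite mulr_ge0 ?(ltW dl0)// addr_ge0// mulr_ge0.
  by rewrite /w; move: i1 ds i2; clear; lra.
have D0 : 0 <= Lc * (2 * delta + w) by rewrite mulr_ge0// addr_ge0// mulr_ge0// ltW.
have m0 : 0 < c1 * a / 2 by exact: divr_gt0.

have rect x y : `|x - 1| <= delta -> `|y - yc| <= w ->
    c1 * a / 2 <= F1 x y /\ `|F2 x y| <= S * F1 x y.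
  move=> x1 yw.
  have x2 : `|x - (1 - delta)| <= 2 * delta.
    by move: x1; rewrite !ler_norml; clear; lra.
  have near_c (F : R -> R -> R) : lip Lc F -> `|F x y - F (1 - delta) yc| <= Lc * (2 * delta + w).
    by move=> HF; rewrite (le_trans (HF _ _ _ _))// ler_wpM2l// lerD.
  have n1 := near_c _ L1L; have n2 := near_c _ L2L.
  have l1 : L1 eta (1 - delta) yc <= 2 * L1 eta x y.
    by move: n1 LD L1c D0; rewrite ler_norml; clear; lra.
  have l2 : `|L2 eta x y| <= (2 * S1 + 1) * L1 eta x y.
    have := ler_normD (L2 eta x y - L2 eta (1 - delta) yc) (L2 eta (1 - delta) yc).
    rewrite subrK; have := ler_wpM2l S10 l1.
    by move: n1 n2 L2c LD L1c D0; rewrite ler_norml; clear; lra.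
  have l1p : c1 * a / 2 <= L1 eta x y by move: l1 L1c c1ae; clear; lra.
  have L1p : 0 <= L1 eta x y by move: l1p m0; clear; lra.
  have l3 : `|L2 eta x y| <= S * L1 eta x y.
    rewrite (le_trans l2)// /S [in leRHS]mulrDl lerDl mulr_ge0//.
  have rR : mR <= R1 eta x y.
    have rl := R1L x y 1 yL; have [_ _ re _] := Fe 1 yL.
    have y2 : `|y - yL| <= w + C0 * eta.
      have := ler_normD (y - yc) (yc - yL); rewrite addrA subrK.
      by move: yw ycL; clear; lra.
    have hR' : (Lc + 1) * (C0 + c1 + 2) * eta <= mR.
      by have := le_trans eth hR; rewrite (ler_pdivlMr _ _ CC) mulrC.
    have lw : Lc * (`|x - 1| + `|y - yL|) <= Lc * (delta + (w + C0 * eta)) by rewrite ler_wpM2l// lerD.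
    have q1 : 0 <= Lc * eta by rewrite mulr_ge0// ltW.
    have q2 : 0 <= c1 * eta by rewrite mulr_ge0// ltW.
    have q3 : 0 <= C0 * eta by rewrite mulr_ge0// ltW.
    have q4 : 0 <= Lc * delta by rewrite mulr_ge0// ltW.
    have q5 : 0 <= Lc * (c1 * eta) by rewrite mulr_ge0.
    by move: rl re lw hR' LD q1 q2 q3 q4 q5 (ltW et0); rewrite /mR !ler_norml; clear; lra.
  have r2 : `|R2 eta x y| <= S * R1 eta x y.
    have [_ _ _ b] := Fb x y; rewrite (le_trans b)//.
    have R1p : 0 <= R1 eta x y by move: rR mR0; clear; lra.
    have : M <= M / mR * R1 eta x y.
      by rewrite -mulrA ler_peMr ?(ltW M0)// mulrC ler_pdivlMr// mul1r.
    have : 0 <= (2 * S1 + 1) * R1 eta x y by rewrite mulr_ge0// addr_ge0// mulr_ge0.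
    by rewrite /S; clear; lra.
  have r1p : c1 * a / 2 <= R1 eta x y.
    rewrite (le_trans _ rR)//.
    have := le_trans ah hc; rewrite ler_pdivlMr//; clear; lra.
  exact: (convex_slope (p01 x) l1p r1p l3 r2).
have Lyb x y y' : `|x - 1| <= delta ->
   `|F1 x y - F1 x y'| <= (3 * Lc + 1) * `|y - y'| /\
   `|F2 x y - F2 x y'| <= (3 * Lc + 1) * `|y - y'|.
  by move=> _; split; apply: blend_lip_y.
have small : (3 * Lc + 1) * (1 + S) / (c1 * a / 2) * (2 * delta) <= 1.
  have pos : 0 < 4 * ((3 * Lc + 1) * (1 + S)) by repeat apply: mulr_gt0 => //.
  have := le_trans dld d0s; rewrite (ler_pdivlMr _ _ pos) => hh.
  have -> : (3 * Lc + 1) * (1 + S) / (c1 * a / 2) * (2 * delta) =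
    delta * (4 * ((3 * Lc + 1) * (1 + S))) / (c1 * a) by field; rewrite !lt0r_neq0.
  by rewrite ler_pdivrMr// mul1r.
have [Y [Y1 Y2]] := strip_transit F1L F2L Lc1 m0 S0 dl0 w0 rect Lyb small.
exists Y; split=> // x y Sol x0 y0.
have y0w : `|y 0 - yc| + 2 * S * delta <= w by rewrite lerD2r.
have [t [t0 tm xt yt Hs]] := Y1 _ _ Sol x0 y0w.
exists t; split=> //; rewrite (le_trans tm)// ler_wpM2r ?invr_ge0 ?(ltW m0)// ler_wpM2l//.
Qed.

End loop.

(** * The return map *)

Section core.
Context {R : realType}.

Lemma sol_transfer (F1 F2 Z1 Z2 : R -> R -> R) LF (x y u v : R -> R) t :
  lip LF F1 -> lip LF F2 -> is_sol Z1 Z2 u v -> is_sol F1 F2 x y ->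
  u 0 = x 0 -> v 0 = y 0 ->
  (forall r, 0 <= r <= t -> Z1 (u r) (v r) = F1 (u r) (v r) /\ Z2 (u r) (v r) = F2 (u r) (v r)) ->
  forall r, 0 <= r <= t -> u r = x r /\ v r = y r.
Proof.
move=> F1L F2L S S' u0 v0 H.
apply: (sol_unique_on F1L F2L (fun r _ => (S r).1) (fun r _ => (S r).2)
  (is_derive_within (fun r => (S r).1)) (is_derive_within (fun r => (S r).2)) _ S' u0 v0).
by move=> r /andP[r0 rt]; apply: H; rewrite !ltW.
Qed.

Definition close_to (d : R) (x y : R -> R) (t : R) (x' y' : R -> R) (t' : R) :=
  `|x t - x' t'| <= d /\ `|y t - y' t'| <= d.

(** The first clause bounds the distance from the cycle to Gamma_0, the other two that from Gamma_0
    to the cycle. The left arc is indexed by all r >= 0 because it approaches p^L only in the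
    limit. *)
Definition follows (d TR : R) (xr yr xl yl x y : R -> R) (tau : R) :=
  [/\ forall t, 0 <= t <= tau ->
      (exists2 r, 0 <= r <= TR & close_to d x y t xr yr r) \/
      (exists2 r, 0 <= r & close_to d x y t xl yl r),
    forall r, 0 <= r <= TR -> exists2 t, 0 <= t <= tau & close_to d x y t xr yr r &
    forall r, 0 <= r -> exists2 t, 0 <= t <= tau & close_to d x y t xl yl r].

(** The return map composes four passages: along [XR], through the layer at q^R, along [XL], through
    the layer at p^L. Its Lipschitz constant is at most e * th * e * KR, where [th] is chosen after
    [KR]. Since [delta] and [sigma] precede [psi], the same range of [eta] serves for all small
    eps. *)
Theorem core_loop (L1 L2 R1 R2 : R -> R -> R -> R) (Lc M r0 : R)
    (a11 a12 a21 a22 yL C1 Kz kz : R) (zx zy : R -> R) (l1 l2 lam mm yq TR kap : R)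
    (xl yl xr yr : R -> R) :
  crossing_fields L1 L2 R1 R2 Lc M r0 ->
  node_family L1 L2 a11 a12 a21 a22 yL r0 C1 Kz kz Lc zx zy ->
  l1 < l2 -> l2 < 0 -> a11 + a22 = l1 + l2 -> a11 * a22 - a12 * a21 = l1 * l2 ->
  lam < 0 -> a11 + a21 * mm = lam -> a12 + a22 * mm = lam * mm ->
  is_sol (L1 0) (L2 0) xl yl -> xl 0 = 1 -> yl 0 = yq -> (forall t, 0 < t -> xl t < 1) ->
  (forall e, 0 < e -> exists2 T, 0 <= T & forall t, T <= t ->
     1 - xl t <= e /\ `|yl t - yL - mm * (xl t - 1)| <= e * (1 - xl t)) ->
  is_sol (R1 0) (R2 0) xr yr -> 0 < TR -> xr 0 = 1 -> yr 0 = yL -> xr TR = 1 -> yr TR = yq ->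
  (forall t, 0 < t < TR -> 1 < xr t) -> 0 < R1 0 1 yL -> R1 0 1 yq < 0 -> L1 0 1 yq < 0 ->
  0 < kap ->
  exists2 eta1, 0 < eta1 & forall a, 0 < a <= eta1 ->
  exists delta sigma, [/\ 0 < delta, 0 < sigma & forall eta psi, a <= eta <= eta1 ->
  gate delta sigma psi ->
  let F1 := blend (L1 eta) (R1 eta) psi in let F2 := blend (L2 eta) (R2 eta) psi in
  exists w Tm TM P tau, return_map F1 F2 (1 + delta) yL w Tm TM P tau /\
    forall x y : R -> R, is_sol F1 F2 x y -> x 0 = 1 + delta -> `|y 0 - yL| <= w ->
    follows kap TR xr yr xl yl x y (tau (y 0))].
Proof.
move=> CF NF l12 l20 tr det lam0 ev1 ev2 Sl xl0 yl0 xl_left conv Sr TR0 xr0 yr0 xrT yrT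
  xr_right R1p R1q L1q kap0.
have [M0 r00 FL FM Feta] := CF.
have z0 : (0:R) <= 0 <= r0 by rewrite lexx ltW.
have [L1L0 L2L0 R1L0 R2L0] := FL 0 z0.
have Lc0 := lip_ge0 L1L0.

(* Constants of the four passages *)
pose Lz := 3 * Lc + 2 * M + 1.
have LcLz : Lc <= Lz by rewrite /Lz; move: Lc0 M0; clear; lra.
have Lz0 : 0 <= Lz := le_trans Lc0 LcLz.
have NF' : node_family L1 L2 a11 a12 a21 a22 yL r0 C1 Kz kz Lz zx zy.
  case: NF => q1 q2 q3 q4 q5 q6 q7 q8; split=> // eta x y etr.
  have [s1 s2] := q5 eta x y etr; have /andP[et0 _] := etr.
  by split; [apply: le_trans s1 _|apply: le_trans s2 _]; rewrite ler_wpM2r.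
have M1 : 0 < 1 + M by rewrite addr_gt0.
(* A part [kR] of the tolerance is for shadowing, the part [M * kR] for the mismatch between the
   arrival time and [TR]. *)
pose kR := kap / (1 + M); have kR0 : 0 < kR by rewrite divr_gt0.
have kRE : kR + M * kR = kap by rewrite /kR; field; exact: lt0r_neq0.
have MkR0 : 0 <= M * kR by rewrite mulr_ge0// ltW.
have C0' : 0 <= 2 * M + Lc by rewrite addr_ge0// mulr_ge0// ltW.
have bR1 x y : `|R1 0 x y| <= M by have [] := FM 0 z0 x y.
have bR2 x y : `|R2 0 x y| <= M by have [] := FM 0 z0 x y.
have bL1 x y : `|L1 0 x y| <= M by have [] := FM 0 z0 x y.
have bL2 x y : `|L2 0 x y| <= M by have [] := FM 0 z0 x y.
have [KR [hR [KR1 hR0 stageR]]] := return_transit (lipW LcLz R1L0) (lipW LcLz R2L0) M0 C0' bR1 bR2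
  Sr TR0 kR0 xr0 yr0 xrT yrT xr_right R1p R1q.
have KR0 : 0 < KR := lt_le_trans ltr01 KR1.
have [wq [Sq [mq [hq [wq0 Sq0 mq0 hq0 stripq]]]]] := strip_q CF L1q R1q.
have kap20 : 0 < kap / 2 by rewrite divr_gt0.
have [C0 [c1 [S1 [C00 c10 S10 stageL]]]] := left_transit NF' l12 l20 tr det lam0 ev1 ev2 M0 Lz0
  bL1 bL2 (lipW LcLz L1L0) (lipW LcLz L2L0) Sl xl0 yl0 xl_left L1q conv kap20.
have [Sp [Sp0 stripp]] := strip_p CF R1p C00 c10 S10.
(* Before the last layer the arrivals lie within C0 eta of [yL], and in it they drift by at most 2
   Sp delta <= 2 Sp eta; the sum is strictly less than A eta, so [P] maps the segment into its
   interior. *)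
pose A := C0 + 2 * Sp + 2.
have A1 : 1 <= A by rewrite /A; move: C00 Sp0; clear; lra.
have A0 : 0 < A := lt_le_trans ltr01 A1.
pose A2 := KR * A + 2 * Sq.
have A21 : 1 <= A2.
  by rewrite ler_wpDr ?mulr_ge0// -[leLHS]mulr1 ler_pM.
have A20 : 0 < A2 := lt_le_trans ltr01 A21.
have [thp [hp [thp0 hp0 strippa]]] := stripp A2 (ltW A20).
pose E : R := expR 1; have E0 : 0 < E by exact: expR_gt0.
(* The second entry gives e * th * e * KR <= 1/2; the first keeps arrivals in the window of
   [strip_p]. *)
have [th th0 /= /and3P[th1 th2 _]] : exists2 th, 0 < th & all (fun r => th <= r)
    [:: thp; 1 / (2 * (KR * (E * E)))].
  by apply: lt_bounds; apply/and3P; split=> //; apply: divr_gt0 => //; repeat apply: mulr_gt0 => //.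
have thE : E * (th * (E * KR)) <= 2^-1.
  move: th2; rewrite ler_pdivlMr; last by repeat apply: mulr_gt0 => //.
  by clear; lra.
have [hL hL0 stageLA] := stageL A2 th A21 th0.
have Rc0 : 0 < 2 * (Lc * (2 + A) + 2 * M + 1).
  have := mulr_ge0 Lc0 (addr_ge0 (ler0n R 2) (ltW A0)).
  by move: M0; move: (Lc * (2 + A)) => B; clear; lra.
have A10 : 0 < 2 * (A + 1) by rewrite mulr_gt0// addr_gt0.
have A210 : 0 < A2 + 1 by rewrite addr_gt0.
have [h h0 /= /and5P[hr0 h1 hhR hhq /and5P[hwq hhp hhL hk1 /and3P[hk2 hRp _]]]] : exists2 h, 0 < h &
    all (fun r => h <= r) [:: r0; 1; hR / A; hq; wq / A2; hp; hL; kap / (2 * (A + 1));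
      kap / (A2 + 1); R1 0 1 yL / (2 * (Lc * (2 + A) + 2 * M + 1))].
  apply: lt_bounds; apply/and5P; split; [done|done|exact: divr_gt0|done|].
  apply/and5P; split; [exact: divr_gt0|done|done|exact: divr_gt0|].
  by apply/and3P; split; [exact: divr_gt0|exact: divr_gt0|done].
exists h => // a /andP[a0 ah].
have ahp : 0 < a <= hp by rewrite a0 (le_trans ah).
have [d0 d00 [T4 T40 stripp4]] := strippa a ahp.
have LM0 : 0 < 2 * Lc + 2 * M + 1.
  by rewrite ltr_wpDl// addr_ge0 ?mulr_ge0 ?(ltW M0).
(* The third entry keeps the perturbation of [XL], a multiple of sigma, below hL * a <= hL * eta. *)
have [sigma sg0 /= /and4P[sg1 sga sgh _]] : exists2 s, 0 < s & all (fun r => s <= r)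
    [:: 1; a; hL * a / (2 * Lc + 2 * M + 1)].
  by apply: lt_bounds; apply/and4P; split=> //; apply: divr_gt0 => //; exact: mulr_gt0.
have [delta dl0 /= /and3P[dla dld _]] : exists2 s, 0 < s & all (fun r => s <= r) [:: a; d0].
  by apply: lt_bounds; apply/and3P.
exists delta, sigma; split=> // eta psi /andP[aet eth] G.

(* The passages for a fixed [eta] and a fixed gate *)
pose F1 := blend (L1 eta) (R1 eta) psi; pose F2 := blend (L2 eta) (R2 eta) psi.
have et0 : 0 < eta := lt_le_trans a0 aet.
have et0' := ltW et0.
have etr : 0 <= eta <= r0 by rewrite et0' (le_trans eth).
have [L1L L2L R1L R2L] := FL eta etr; have Fb := FM eta etr; have Fe := Feta eta etr.
have [p01 [kp kp0 pk] pl pll pr prl] := G.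
have sc X c : 0 < c -> h <= X / c -> c * eta <= X.
  by move=> c0; rewrite ler_pdivlMr// mulrC => /(le_trans _); apply; rewrite ler_wpM2l// ltW.
have dle : delta <= eta := le_trans dla aet.
have sge : sigma <= eta := le_trans sga aet.
have LF : exists2 LF, lip LF F1 & lip LF F2.
  exists (Lc + (2 * Lc * 1 + 2 * M * kp)); apply: blend_lip => // x y; by have [] := Fb x y.
have [Lf F1L F2L] := LF.
(* Freezing psi at its value on the edge of the layer gives fields that are
   sigma-close to XR (below: XL) everywhere and agree with the regularized ones
   on that side of the layer. *)
pose wR x := 1 - psi (Num.max x (1 + delta)).
have wR0 x : 0 <= wR x <= sigma.
  rewrite /wR; have /andP[q1 q2] := p01 (Num.max x (1 + delta)).
  by rewrite subr_ge0 q2 /=; apply: pr; rewrite le_max lexx orbT.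
have max_lip c (x x' : R) : `|Num.max x c - Num.max x' c| <= `|x - x'|.
  have n := normr_ge0 (x - x'); have n1 := ler_norm (x - x'); have n2 := ler_norm (- (x - x')).
  rewrite normrN in n2; rewrite ler_norml.
  by have [a1|a1] := leP x c; have [a2|a2] := leP x' c; apply/andP; split; move: n n1 n2 a1 a2; clear; lra.
have min_lip c (x x' : R) : `|Num.min x c - Num.min x' c| <= `|x - x'|.
  have n := normr_ge0 (x - x'); have n1 := ler_norm (x - x'); have n2 := ler_norm (- (x - x')).
  rewrite normrN in n2; rewrite ler_norml.
  by have [a1|a1] := leP x c; have [a2|a2] := leP x' c; apply/andP; split; move: n n1 n2 a1 a2; clear; lra.
have wRk x x' : `|wR x - wR x'| <= sigma * `|x - x'|.
  have -> : wR x - wR x' = - (psi (Num.max x (1 + delta)) - psi (Num.max x' (1 + delta))) by rewrite /wR; ring.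
  rewrite normrN (le_trans (prl _ _ _ _)) ?le_max ?lexx ?orbT//.
  by rewrite ler_wpM2l ?(ltW sg0)//; exact: max_lip.
pose ZR1 := blend (R1 eta) (L1 eta) wR; pose ZR2 := blend (R2 eta) (L2 eta) wR.
have LzE : Lc + (2 * Lc * sigma + 2 * M * sigma) <= Lz.
  have i1 : Lc * sigma <= Lc by rewrite ler_piMr.
  have i2 : M * sigma <= M by rewrite ler_piMr// ltW.
  by rewrite /Lz; move: i1 i2 Lc0; clear; lra.
have ZR1L : lip Lz ZR1.
  by apply: (lipW LzE); apply: blend_lip => // x y; have [] := Fb x y.
have ZR2L : lip Lz ZR2.
  by apply: (lipW LzE); apply: blend_lip => // x y; have [] := Fb x y.
have AE : eta <= A * eta by rewrite ler_peMl.
have ZRc (Z B r : R -> R -> R) : (forall x y, `|Z x y - B x y| <= 2 * M * sigma) ->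
    (forall x y, `|B x y - r x y| <= Lc * eta) ->
    forall x y, `|Z x y - r x y| <= (2 * M + Lc) * (A * eta).
  move=> ZB Br x y; have := ler_normD (Z x y - B x y) (B x y - r x y).
  rewrite addrA subrK; have := ZB x y; have := Br x y.
  have i1 : M * sigma <= M * (A * eta) by rewrite ler_wpM2l ?(ltW M0)// (le_trans sge).
  have i2 : Lc * eta <= Lc * (A * eta) by rewrite ler_wpM2l.
  by move: i1 i2; clear; lra.
have ZR1c x y : `|ZR1 x y - R1 0 x y| <= (2 * M + Lc) * (A * eta).
  apply: (ZRc _ (R1 eta)) => u v; last by have [] := Fe u v.
  by apply: blend_close => // u' v'; have [] := Fb u' v'.
have ZR2c x y : `|ZR2 x y - R2 0 x y| <= (2 * M + Lc) * (A * eta).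
  apply: (ZRc _ (R2 eta)) => u v; last by have [] := Fe u v.
  by apply: blend_close => // u' v'; have [] := Fb u' v'.
have AehR : A * eta <= hR by exact: sc.
have [YR [YR1 YR2]] := stageR ZR1 ZR2 delta (A * eta) ZR1L ZR2L ZR1c ZR2c dl0 (le_trans dle AE) AehR.
have etq : 0 <= eta <= hq by rewrite et0' (le_trans eth).
have dlq : 0 < delta <= hq by rewrite dl0 (le_trans dle)// (le_trans eth).
have [Yq [Yq1 Yq2]] := stripq eta delta sigma psi etq dlq G.
pose wL x := psi (Num.min x (1 - delta)).
have wL0 x : 0 <= wL x <= sigma.
  rewrite /wL; have /andP[-> _] := p01 (Num.min x (1 - delta)).
  by apply: pl; rewrite ge_min lexx orbT.
have wLk x x' : `|wL x - wL x'| <= sigma * `|x - x'|.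
  rewrite (le_trans (pll _ _ _ _)) ?ge_min ?lexx ?orbT//.
  by rewrite ler_wpM2l ?(ltW sg0)//; exact: min_lip.
pose ZL1 := blend (L1 eta) (R1 eta) wL; pose ZL2 := blend (L2 eta) (R2 eta) wL.
have ZL1L : lip Lz ZL1.
  by apply: (lipW LzE); apply: blend_lip => // x y; have [] := Fb x y.
have ZL2L : lip Lz ZL2.
  by apply: (lipW LzE); apply: blend_lip => // x y; have [] := Fb x y.
pose e := 2 * Lc * sigma + 2 * M * sigma.
have e0 : 0 <= e by rewrite addr_ge0 ?mulr_ge0 ?(ltW sg0) ?(ltW M0).
have eh : 0 <= e <= hL * eta.
  rewrite e0 /=; move: sgh; rewrite ler_pdivlMr// => sgh.
  have : hL * a <= hL * eta by rewrite ler_wpM2l// ltW.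
  by move: sgh sg0; rewrite /e; clear; lra.
have eM : 2 * M * sigma <= e by rewrite lerDr !mulr_ge0// ltW.
have ZL1c x y : `|ZL1 x y - L1 eta x y| <= e.
  by apply: le_trans eM; apply: blend_close => // u' v'; have [] := Fb u' v'.
have ZL2c x y : `|ZL2 x y - L2 eta x y| <= e.
  by apply: le_trans eM; apply: blend_close => // u' v'; have [] := Fb u' v'.
have ZLl x y x' y' : `|ZL1 x y - L1 eta x y - (ZL1 x' y' - L1 eta x' y')| <= e * (`|x - x'| + `|y - y'|) /\
    `|ZL2 x y - L2 eta x y - (ZL2 x' y' - L2 eta x' y')| <= e * (`|x - x'| + `|y - y'|).
  by split; apply: blend_sub_lip => // u' v'; have [] := Fb u' v'.
have etL : 0 < eta <= hL by rewrite et0 (le_trans eth).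
have dle' : 0 < delta <= eta by rewrite dl0.
have [YL [T3 [YL1 YL2]]] := stageLA eta delta e ZL1 ZL2 etL dle' eh ZL1L ZL2L ZL1c ZL2c ZLl.
(* The passage at p^L is centred at the arrival point of the orbit from q^R: all
   arrivals are within thp * A2 * eta of it. *)
have A2e0 : 0 <= A2 * eta by rewrite mulr_ge0// ltW.
have qadm : `|yq - yq| <= A2 * eta by rewrite subrr normr0.
have [xc [ycf [xc0 yc0 Sc]]] := flow_exists (1 - delta) yq ZL1L ZL2L.
have qadm' : `|ycf 0 - yq| <= A2 * eta by rewrite yc0.
have [tc [[[_ _ _ ycC] _ _ [ycf1 ycf2]] ycE]] := YL1 xc ycf (conj Sc xc0) qadm'.
rewrite yc0 in ycE; rewrite ycE in ycC ycf1 ycf2.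
have etp : a <= eta <= hp by rewrite aet (le_trans eth).
have dlp : 0 < delta <= d0 by rewrite dl0.
have [Yp [Yp1 Yp2]] := stripp4 eta delta sigma psi (YL yq) etp dlp G ycC ycf1 ycf2.
pose P y := Yp (YL (Yq (YR y))).
pose w := A * eta.
have w0 : 0 < w by exact: mulr_gt0.
have kp1 : 2 * (A + 1) * eta <= kap by exact: sc.
have kp2 : (A2 + 1) * eta <= kap by exact: sc.
have Sqd : 2 * Sq * delta <= 2 * Sq * eta by rewrite ler_wpM2l// mulr_ge0.
have Spd : 2 * Sp * delta <= 2 * Sp * eta by rewrite ler_wpM2l// mulr_ge0.
have xr_near t : `|t - TR| <= kR -> forall r, Num.min t TR <= r <= Num.max t TR ->
   `|xr t - xr r| <= M * kR /\ `|yr t - yr r| <= M * kR.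
  move=> tk r rb.
  have tr' : `|t - r| <= kR.
    move: tk rb; rewrite !ler_norml; have [q|q] := leP t TR; clear - q; move=> /andP[? ?] /andP[? ?]; apply/andP; split; lra.
  have gen (z dz : R -> R) : (forall t : R, is_derive t (1:R) z (dz t)) -> (forall t, `|dz t| <= M) ->
      `|z t - z r| <= M * kR.
    move=> zD zM; have zM' q : - M <= dz q <= M by rewrite -ler_norml.
    have Mk : M * `|t - r| <= M * kR by rewrite ler_wpM2l// ltW.
    apply: le_trans Mk.
    wlog le : t r {tk rb tr'} / r <= t.
      move=> H; have [g1|/ltW g1] := leP r t; first exact: H.
      by rewrite distrC [`|t - _|]distrC; exact: H.
    have g1 := der_le le (fun t _ => zD t) (is_derive_within zD) (fun q _ => proj2 (andP (zM' q))).
    have g2 := der_ge le (fun t _ => zD t) (is_derive_within zD) (fun q _ => proj1 (andP (zM' q))).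
    by rewrite [`|t - r|]ger0_norm ?subr_ge0// ler_norml; move: g1 g2; clear; lra.
  by split; [apply: (gen _ _ (fun t => (Sr t).1))|apply: (gen _ _ (fun t => (Sr t).2))].
pose TM := TR + 1 + 2 * delta / mq + T3 + T4.

(* One turn of an orbit *)
have loop (x y : R -> R) : is_sol F1 F2 x y -> x 0 = 1 + delta -> `|y 0 - yL| <= w ->
  exists tau, [/\ TR / 2 <= tau <= TM, x tau = 1 + delta, y tau = P (y 0) &
    follows kap TR xr yr xl yl x y tau].
  move=> S x0 y0.
  have [u [v [u0 v0 SZ]]] := flow_exists (1 + delta) (y 0) ZR1L ZR2L.
  have v0adm : `|v 0 - yL| <= A * eta by rewrite v0.
  have [t1 [[/andP[tb1 tb1'] tk1 ut1 vt1 Ht1] yE1]] := YR1 u v (conj SZ u0) v0adm.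
  have t10 : 0 <= t1 by rewrite (le_trans _ tb1)// divr_ge0// ltW.
  have eq1 : forall r, 0 <= r <= t1 -> u r = x r /\ v r = y r.
    apply: (sol_transfer F1L F2L SZ S) => //; first by rewrite u0 x0.
    move=> r /Ht1[q _ _].
    split; first by rewrite /F1 blend_swap /ZR1 /blend /wR max_l.
    by rewrite /F2 blend_swap /ZR2 /blend /wR max_l.
  have t1b : 0 <= t1 <= t1 by rewrite t10 lexx.
  have [ux1 vy1] := eq1 t1 t1b.
  rewrite ux1 in ut1; rewrite v0 vy1 in yE1; rewrite vy1 in vt1.
  have S1' := is_sol_shift t1 S.
  have [||t2 [t20 t2m]] := Yq1 _ _ S1'; rewrite ?add0r//.
    apply: (@le_trans _ _ (A2 * eta)); last exact: sc.
    by rewrite /A2; move: vt1 Sqd; clear; lra.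
  set s2 := t2 + t1; move=> xs2 ys2 H2.
  have t2b : 0 <= t2 <= t2 by rewrite (ltW t20) lexx.
  have s20 : 0 <= s2 by rewrite addr_ge0// ltW.
  have [_ ys2d] := H2 t2 t2b; rewrite -/s2 in ys2d.
  have ys2q : `|y s2 - yq| <= A2 * eta.
    have := ler_normD (y s2 - y t1) (y t1 - yq); rewrite addrA subrK /A2.
    by move: ys2d vt1 Sqd; clear; lra.
  have S2' := is_sol_shift s2 S.
  have [u2 [v2 [u20 v20 SL]]] := flow_exists (1 - delta) (y s2) ZL1L ZL2L.
  have v2adm : `|v2 0 - yq| <= A2 * eta by rewrite v20.
  have [t3 [[[t30 t3T u2t v2c] Hin Haft _] y3E]] := YL1 u2 v2 (conj SL u20) v2adm.
  have eq2 : forall r, 0 <= r <= t3 -> u2 r = x (r + s2) /\ v2 r = y (r + s2).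
    apply: (sol_transfer F1L F2L SL S2') => //; rewrite ?add0r ?u20//.
    by move=> r /Hin[q _ _]; split; rewrite ?/F1 ?/F2 ?/ZL1 ?/ZL2 /blend /wL min_l.
  have t3b : 0 <= t3 <= t3 by rewrite t30 lexx.
  have [ux3 vy3] := eq2 t3 t3b.
  set s3 := t3 + s2 in ux3 vy3.
  rewrite ux3 in u2t; rewrite v20 vy3 in y3E; rewrite vy3 in v2c.
  have s30 : 0 <= s3 by rewrite addr_ge0.
  have ys3 : `|y s3 - YL yq| <= thp * (A2 * eta).
    rewrite y3E (le_trans (YL2 _ _ ys2q qadm))//.
    by apply: ler_pM => //; exact: ltW.
  have S3' := is_sol_shift s3 S.
  have [||t4 [t40 t4T]] := Yp1 _ _ S3'; rewrite ?add0r//.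
  set tau := t4 + s3; move=> xtau ytau H4.
  have tau_ge : s3 <= tau by rewrite lerDr ltW.
  have t1tau : t1 <= tau by rewrite (le_trans _ tau_ge)// /s3 /s2; move: t30 t20; clear; lra.
  have s2s3 : s2 <= s3 by rewrite lerDr.
  exists tau; split.
  - rewrite (le_trans tb1)//= /TM /tau /s3 /s2.
    by move: t4T t3T t2m tb1'; clear; lra.
  - by [].
  - by rewrite ytau /P -yE1 -ys2 -y3E.
  have kRk : kR <= kap by rewrite -kRE lerDl.
  have in1 t : 0 <= t <= t1 -> `|x t - xr t| <= kR /\ `|y t - yr t| <= kR.
    by move=> tb; have [_ q1 q2] := Ht1 t tb; have [<- <-] := eq1 t tb.
  have min_max r : TR <= r <= t1 \/ t1 <= r <= TR -> Num.min t1 TR <= r <= Num.max t1 TR.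
    by rewrite ge_min le_max; case=> /andP[-> ->]; rewrite ?orbT.
  have tri (p q s' : R) : `|p - q| <= kR -> `|q - s'| <= M * kR -> `|p - s'| <= kap.
    move=> h1' h2'; rewrite -kRE; have := ler_normD (p - q) (q - s'); rewrite addrA subrK.
    by move: h1' h2'; clear; lra.
  have inL r : 0 <= r <= t3 -> close_to kap x y (r + s2) xl yl r.
    move=> rb; have [_ q1 q2] := Hin r rb; rewrite /close_to; have [<- <-] := eq2 r rb.
    by split; [apply: le_trans q1 _|apply: le_trans q2 _]; move: kap0; clear; lra.
  split.
  - move=> t /andP[t0 tt].
    have [tt1|tt1] := leP t t1.
      left; have tb : 0 <= t <= t1 by rewrite t0.
      have [q1 q2] := in1 t tb.
      have [tTR|tTR] := leP t TR.
        by exists t; [rewrite t0|split; [exact: le_trans q1 kRk|exact: le_trans q2 kRk]].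
      exists TR; first by rewrite lexx ltW.
      have tk : `|t - TR| <= kR.
        by move: tk1 tt1 tTR; rewrite !ler_norml; clear; lra.
      have [|p1 p2] := xr_near t tk TR; first by rewrite ge_min le_max lexx !orbT.
      by split; [exact: tri q1 p1|exact: tri q2 p2].
    have [tt2|tt2] := leP t s2.
      right; exists 0 => //.
      have [|q1 q2] := H2 (t - t1).
        by rewrite /s2 in tt2; move: tt1 tt2; clear; lra.
      rewrite subrK in q1 q2; rewrite /close_to xl0 yl0; split.
        apply: (le_trans q1); apply: (le_trans dle); move: kp2; move: A20 et0'.
        by move=> h1' h2'; have := mulr_ge0 (ltW h1') h2'; clear; lra.
      have := ler_normD (y t - y t1) (y t1 - yq); rewrite addrA subrK.
      by move: q2 vt1 Sqd kp2 et0'; rewrite /A2; clear; lra.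
    have [tt3|tt3] := leP t s3.
      right; exists (t - s2); first by rewrite subr_ge0 ltW.
      have := inL (t - s2); rewrite subrK; apply.
      by rewrite /s3 in tt3; move: tt2 tt3; clear; lra.
    (* During the last passage through the layer the orbit is near p^L, the starting point of the
       right arc. *)
    left; exists 0; first by rewrite lexx ltW.
    have [|q1 q2] := H4 (t - s3).
      by rewrite /tau in tt; move: tt3 tt; clear; lra.
    rewrite subrK in q1 q2; rewrite /close_to xr0 yr0; split.
      apply: (le_trans q1); apply: (le_trans dle); move: kp2; move: A20 et0'.
      by move=> h1' h2'; have := mulr_ge0 (ltW h1') h2'; clear; lra.
    have := ler_normD (y t - y s3) (y s3 - yL); rewrite addrA subrK.
    have C0e : 0 <= C0 * eta by rewrite mulr_ge0// ltW.
    have Spe : 0 <= Sp * eta by rewrite mulr_ge0.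
    by move: q2 v2c Spd kp1 et0' C0e Spe; rewrite /A; clear; lra.
  - move=> r /andP[r0' rT].
    have [rt|rt] := leP r t1.
      exists r; first by rewrite r0' (le_trans rt).
      have rb : 0 <= r <= t1 by rewrite r0'.
      by have [q1 q2] := in1 r rb; split; [exact: le_trans q1 kRk|exact: le_trans q2 kRk].
    exists t1; first by rewrite t10.
    have [q1 q2] := in1 t1 t1b.
    have [|p1 p2] := xr_near t1 tk1 r; first by apply: min_max; right; rewrite (ltW rt).
    by split; [exact: tri q1 p1|exact: tri q2 p2].
  - move=> r r0'; have [rt|rt] := leP r t3.
      exists (r + s2).
        by rewrite addr_ge0//= (le_trans _ tau_ge)// /s3 lerD2r.
      by apply: inL; rewrite r0'.
    (* Beyond [t3] the left arc stays within kap / 2 of p^L, and the orbit at time [s3] is close to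
       p^L as well. *)
    exists s3; first by rewrite s30.
    have [p1 p2] := Haft r (ltW rt).
    have C0e : 0 <= C0 * eta by rewrite mulr_ge0// ltW.
    have Spe : 0 <= Sp * eta by rewrite mulr_ge0.
    rewrite /close_to u2t; split.
      have -> : 1 - delta - xl r = - (xl r - 1) - delta by ring.
      have := ler_normB (- (xl r - 1)) delta; rewrite normrN (gtr0_norm dl0).
      by move: p1 dle kp1 C0e Spe et0'; rewrite /A; clear; lra.
    have -> : y s3 - yl r = (y s3 - yL) - (yl r - yL) by ring.
    have := ler_normB (y s3 - yL) (yl r - yL).
    by move: p2 v2c kp1 C0e Spe et0'; rewrite /A; clear; lra.
(* [tau] has to be a function of the starting ordinate; it is read off one orbit and transferred to
   all others by uniqueness. *)
have exT y0 : exists tau, `|y0 - yL| <= w -> TR / 2 <= tau <= TM /\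
   forall x y : R -> R, is_sol F1 F2 x y -> x 0 = 1 + delta -> y 0 = y0 ->
   [/\ x tau = 1 + delta, y tau = P y0 & follows kap TR xr yr xl yl x y tau].
  have [ya|nya] := pselect (`|y0 - yL| <= w); last by exists 0.
  have [x [y [x0 y0E S]]] := flow_exists (1 + delta) y0 F1L F2L.
  have ya' : `|y 0 - yL| <= w by rewrite y0E.
  have [tau [tb xt yt fol]] := loop x y S x0 ya'.
  exists tau => _; split=> // x' y' S' x'0 y'0.
  have U := sol_unique F1L F2L S' S (etrans x'0 (esym x0)) (etrans y'0 (esym y0E)).
  have -> : x' = x by apply/funext => t; have [] := U t.
  have -> : y' = y by apply/funext => t; have [] := U t.
  by rewrite -y0E.
have [tau tauP] := choice exT.
have KRAe y0 : `|y0 - yL| <= w -> `|YR y0 - yq| <= KR * (A * eta).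
  move=> ya; have [u [v [u0 v0 SZ]]] := flow_exists (1 + delta) y0 ZR1L ZR2L.
  have v0adm : `|v 0 - yL| <= A * eta by rewrite v0.
  by have [t1 [[_ _ _ vt1 _] yE1]] := YR1 u v (conj SZ u0) v0adm; rewrite -v0 -yE1.
have Yq_adm y0 : `|y0 - yL| <= w -> `|Yq (YR y0) - yq| <= A2 * eta.
  move=> ya; have [x [y [x0 y0E S]]] := flow_exists (1 + delta) (YR y0) F1L F2L.
  have adm : `|y 0 - yq| + 2 * Sq * delta <= wq.
    apply: (@le_trans _ _ (A2 * eta)); last exact: sc.
    by rewrite y0E /A2; have := KRAe y0 ya; move: Sqd; clear; lra.
  have [t [t0 _ _ yt Hs]] := Yq1 x y S x0 adm.
  have tb : 0 <= t <= t by rewrite (ltW t0) lexx.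
  have [_ q] := Hs t tb; rewrite yt y0E in q.
  have := ler_normD (Yq (YR y0) - YR y0) (YR y0 - yq); rewrite addrA subrK /A2.
  by have := KRAe y0 ya; move: q Sqd; clear; lra.
have YL_near y2 : `|y2 - yq| <= A2 * eta -> `|YL y2 - yL| <= C0 * eta /\
    `|YL y2 - YL yq| <= thp * (A2 * eta).
  move=> ya; split.
    have [u [v [u0 v0 SZ]]] := flow_exists (1 - delta) y2 ZL1L ZL2L.
    have v0adm : `|v 0 - yq| <= A2 * eta by rewrite v0.
    by have [t [[[_ _ _ vc] _ _ _] yE]] := YL1 u v (conj SZ u0) v0adm; rewrite -v0 -yE.
  rewrite (le_trans (YL2 _ _ ya qadm))//.
  by apply: ler_pM => //; exact: ltW.

(* Properties of the return map *)
exists w, (TR / 2), TM, P, tau; split.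
  split => //.
  - by rewrite divr_gt0.
  - by move=> y0 ya; have [] := tauP y0 ya.
  - move=> y0 ya; rewrite /P.
    have [n1 n2] := YL_near _ (Yq_adm y0 ya).
    have [x [y [x0 y0E S]]] := flow_exists (1 - delta) (YL (Yq (YR y0))) F1L F2L.
    have adm : `|y 0 - YL yq| <= thp * (A2 * eta) by rewrite y0E.
    have [t [t0 _ _ yt Hs]] := Yp1 x y S x0 adm.
    have tb : 0 <= t <= t by rewrite (ltW t0) lexx.
    have [_ q] := Hs t tb; rewrite yt y0E in q.
    have := ler_normD (Yp (YL (Yq (YR y0))) - YL (Yq (YR y0))) (YL (Yq (YR y0)) - yL).
    rewrite addrA subrK /w /A.
    by move: q n1 Spd et0; clear; lra.
  - move=> y0 ya.
    (* At x = 1 + delta the weight of [XL] is at most sigma, so F1 is close to the positive value of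
       R1 at p^L. This is why the section is placed on that edge of the layer. *)
    have xr' : 1 + delta <= 1 + delta by [].
    have pr' := pr _ xr'; have /andP[_ p1'] := p01 (1 + delta).
    have [Lb _ Rb _] := Fb (1 + delta) y0.
    have rl := R1L (1 + delta) y0 1 yL; have [_ _ re _] := Fe 1 yL.
    rewrite [1 + delta - 1]addrAC subrr add0r (gtr0_norm dl0) in rl.
    have q0 : 0 <= 1 - psi (1 + delta) by rewrite subr_ge0.
    have bnd : `|(1 - psi (1 + delta)) * (L1 eta (1 + delta) y0 - R1 eta (1 + delta) y0)| <= sigma * (2 * M).
      rewrite normrM (ger0_norm q0); apply: ler_pM => //.
      by rewrite (le_trans (ler_normB _ _))//; move: Lb Rb; clear; lra.
    have FE : F1 (1 + delta) y0 = R1 eta (1 + delta) y0 +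
       (1 - psi (1 + delta)) * (L1 eta (1 + delta) y0 - R1 eta (1 + delta) y0).
      by rewrite /F1 /blend; ring.
    have lw : Lc * (delta + `|y0 - yL|) <= Lc * (eta + A * eta) by rewrite ler_wpM2l// lerD.
    have sM : sigma * M <= eta * M by rewrite ler_wpM2r// ltW.
    have hR' : 2 * (Lc * (2 + A) + 2 * M + 1) * eta <= R1 0 1 yL by exact: sc.
    change (0 < F1 (1 + delta) y0); rewrite FE.
    move: bnd; set z := (1 - psi _) * _; clearbody z.
    by move: rl re lw sM hR' et0 R1p; rewrite !ler_norml; move: (A) => A'; clear; lra.
  - move=> x y S x0 ya; have [_ H] := tauP (y 0) ya.
    by have [h1' h2' _] := H x y S x0 erefl.
  - move=> y1 y2 ya1 ya2; rewrite /P.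
    apply: (le_trans (Yp2 _ _)).
    have i1 := YL2 _ _ (Yq_adm _ ya1) (Yq_adm _ ya2).
    have i2 := Yq2 (YR y1) (YR y2).
    have i3 := YR2 _ _ ya1 ya2.
    have j3 := ler_wpM2l (ltW E0) i3.
    have j2 := ler_wpM2l (ltW th0) (le_trans i2 j3).
    have j1 := ler_wpM2l (ltW E0) (le_trans i1 j2).
    apply: (le_trans j1); apply: (@le_trans _ _ (E * (th * (E * KR)) * `|y1 - y2|)).
      by apply: eq_ler; ring.
    by rewrite ler_wpM2r.
move=> x y S x0 ya; have [_ H] := tauP (y 0) ya.
by have [_ _] := H x y S x0 erefl.
Qed.

End core.

(** * Estimates for smooth fields *)

Section smoothness_estimates.
Context {R : realType}.

Lemma line_derive (V : normedModType R) (g : V -> R) (Q v : V) (s : R) :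
  differentiable g (Q + s *: v) ->
  is_derive s (1:R) (fun s : R => g (Q + s *: v)) ('D_v g (Q + s *: v)).
Proof.
move=> gD.
have E : (fun h : R => h^-1 *: (g (Q + (h *: (1:R) + s) *: v) - g (Q + s *: v))) =
    (fun h : R => h^-1 *: (g (h *: v + (Q + s *: v)) - g (Q + s *: v))).
  by apply/funext => h; rewrite scalerDl addrCA [h *: 1]mulr1.
split; first by rewrite /derivable E; exact: diff_derivable.
by rewrite /derive E.
Qed.

Lemma mvt_line (V : normedModType R) (g : V -> R) (Q v : V) :
  (forall x, differentiable g x) ->
  exists2 s, 0 <= s <= 1 & g (Q + v) - g Q = 'D_v g (Q + s *: v).
Proof.
move=> gD; have D (s : R) := line_derive (gD (Q + s *: v)).
have [s] := MVT_segment ler01 (fun s _ => D s) (is_derive_within D).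
rewrite in_itv /= scale1r scale0r addr0 subr0 mulr1 => sI E.
by exists s.
Qed.

Lemma class_C_coord (V : normedModType R) n (f : V -> 'rV[R]_2) i :
  class_C n f -> class_C n (fun u => f u 0 i).
Proof.
elim: n f => [f fC x|n IH f [fD fC]] /=.
  have H := @coord_continuous R 1 2 0 i (f x).
  exact: (continuous_comp (fC x) H).
split=> [x|v].
  have H := @differentiable_coord R 1 2 (f x) 0 i.
  exact: (differentiable_comp (fD x) H).
have E : (fun x => 'D_v (fun u => f u 0 i) x) = (fun x => ('D_v f x) 0 i).
  apply/funext => x; have fv : derivable f x v by exact: diff_derivable.
  by rewrite (derive_mx fv) mxE.
by rewrite E; exact: (IH _ (fC v)).
Qed.

Local Notation V := ('rV[R]_2 * R)%type.

Definition pt (x y eta : R) : V := (vec2 x y, eta).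

Lemma ptD x y e x' y' e' : pt x y e + pt x' y' e' = pt (x + x') (y + y') (e + e').
Proof.
congr pair; apply/rowP => j; rewrite !mxE.
by case: j => [[|[|//]] ?].
Qed.

Lemma ptZ a x y e : a *: pt x y e = pt (a * x) (a * y) (a * e).
Proof.
congr pair; apply/rowP => j; rewrite !mxE.
by case: j => [[|[|//]] ?].
Qed.

Definition D1 (g : V -> R) p := 'D_(pt 1 0 0) g p.
Definition D2 (g : V -> R) p := 'D_(pt 0 1 0) g p.
Definition D3 (g : V -> R) p := 'D_(pt 0 0 1) g p.

Lemma derive_pt (g : V -> R) p a b c : differentiable g p ->
  'D_(pt a b c) g p = a * D1 g p + b * D2 g p + c * D3 g p.
Proof.
move=> gD; rewrite /D1 /D2 /D3 !deriveE//.
have -> : pt a b c = a *: pt 1 0 0 + b *: pt 0 1 0 + c *: pt 0 0 1.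
  by rewrite !ptZ !ptD !mulr1 !mulr0 !addr0 !add0r.
by rewrite !linearD !linearZ.
Qed.

Lemma pt_continuous_box (G : V -> R) B : continuous G ->
  exists2 K, 0 <= K & forall x y e, `|x| <= B -> `|y| <= B -> `|e| <= B -> `|G (pt x y e)| <= K.
Proof.
move=> GC.
pose A : set V := [set v : 'rV[R]_2 | forall i, `[- B, B]%classic (v ord0 i)] `*` `[- B, B]%classic.
have Ac : compact A.
  apply: compact_setX; last exact: segment_compact.
  by apply: (rV_compact (A := fun=> `[- B, B]%classic)) => _; exact: segment_compact.
have := compact_bounded (continuous_compact (continuous_subspaceT GC) Ac).
move=> [M [_ HM]]; exists (`|M| + 1); first by rewrite addr_ge0.
move=> x y e xB yB eB; apply: HM.
  by rewrite (le_lt_trans (ler_norm _))// ltrDl.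
exists (pt x y e) => //; split => /=; last by rewrite in_itv /= -ler_norml.
move=> i; rewrite /= in_itv /= -ler_norml.
by have [->|->] := ord2 i; rewrite ?vec2_0 ?vec2_1.
Qed.

Lemma between_le (x x' s : R) B : 0 <= s <= 1 -> `|x| <= B -> `|x'| <= B -> `|x' + s * (x - x')| <= B.
Proof.
move=> /andP[s0 s1] xB x'B; have t0 : 0 <= 1 - s by rewrite subr_ge0.
have -> : x' + s * (x - x') = (1 - s) * x' + s * x by ring.
rewrite (le_trans (ler_normD _ _))// !normrM (ger0_norm s0) (ger0_norm t0).
have := ler_wpM2l s0 xB; have := ler_wpM2l t0 x'B; clear; lra.
Qed.

Lemma pt_mvt (G : V -> R) x y e x' y' e' : (forall p, differentiable G p) ->
  exists2 s, 0 <= s <= 1 & let p := pt (x' + s * (x - x')) (y' + s * (y - y')) (e' + s * (e - e')) in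
  G (pt x y e) - G (pt x' y' e') = (x - x') * D1 G p + (y - y') * D2 G p + (e - e') * D3 G p.
Proof.
move=> GD; have [s sI] := mvt_line (pt x' y' e') (pt (x - x') (y - y') (e - e')) GD.
rewrite ptD !subrKC ptZ ptD derive_pt// => E.
by exists s.
Qed.

Lemma pt_lip (G : V -> R) B : class_C 1 G ->
  exists2 K, 0 <= K & forall x y e x' y' e', `|x| <= B -> `|y| <= B -> `|e| <= B ->
   `|x'| <= B -> `|y'| <= B -> `|e'| <= B ->
   `|G (pt x y e) - G (pt x' y' e')| <= K * (`|x - x'| + `|y - y'| + `|e - e'|).
Proof.
move=> [GD GC].
have [K1 K10 H1] := pt_continuous_box B (GC (pt 1 0 0) : continuous (D1 G)).
have [K2 K20 H2] := pt_continuous_box B (GC (pt 0 1 0) : continuous (D2 G)).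
have [K3 K30 H3] := pt_continuous_box B (GC (pt 0 0 1) : continuous (D3 G)).
exists (K1 + K2 + K3); first by rewrite !addr_ge0.
move=> x y e x' y' e' xB yB eB x'B y'B e'B.
have [s sI] := pt_mvt x y e x' y' e' GD.
set x2 := x' + _; set y2 := y' + _; set e2 := e' + _ => /= ->.
have x2B : `|x2| <= B by exact: between_le.
have y2B : `|y2| <= B by exact: between_le.
have e2B : `|e2| <= B by exact: between_le.
have h1 := H1 _ _ _ x2B y2B e2B; have h2 := H2 _ _ _ x2B y2B e2B.
have h3 := H3 _ _ _ x2B y2B e2B.
move: (D1 G _) (D2 G _) (D3 G _) h1 h2 h3 => g1 g2 g3 h1 h2 h3.
rewrite (le_trans (ler_normD _ _))//.
have n := ler_normD ((x - x') * g1) ((y - y') * g2).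
rewrite !normrM in n *.
have i1 := ler_wpM2l (normr_ge0 (x - x')) h1.
have i2 := ler_wpM2l (normr_ge0 (y - y')) h2.
have i3 := ler_wpM2l (normr_ge0 (e - e')) h3.
have nn (p q : R) : 0 <= p -> 0 <= `|q| * p by move=> p0; rewrite mulr_ge0.
have := nn K1 (y - y') K10; have := nn K1 (e - e') K10; have := nn K2 (x - x') K20.
have := nn K2 (e - e') K20; have := nn K3 (x - x') K30; have := nn K3 (y - y') K30.
move: n i1 i2 i3; clear; lra.
Qed.

Lemma linear_form_bound (a b g1 g2 k1 k2 m : R) : `|g1| <= k1 * m -> `|g2| <= k2 * m ->
  `|a * g1 + b * g2| <= (k1 + k2) * m * (`|a| + `|b|).
Proof.
move=> h1 h2; rewrite (le_trans (ler_normD _ _))// !normrM.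
have j1 := ler_wpM2l (normr_ge0 a) h1; have j2 := ler_wpM2l (normr_ge0 b) h2.
have n1 := mulr_ge0 (normr_ge0 a) (le_trans (normr_ge0 _) h2).
have n2 := mulr_ge0 (normr_ge0 b) (le_trans (normr_ge0 _) h1).
by move: j1 j2 n1 n2; clear; lra.
Qed.

(** By the mean value theorem the increment is a derivative at an intermediate point, where the
    partial derivatives differ from those at (x0, y0, 0) by a multiple of 3 r, one r for each of x,
    y and eta. *)
Lemma pt_lin (G : V -> R) B x0 y0 : class_C 2 G -> `|x0| <= B -> `|y0| <= B ->
  exists2 K, 0 <= K & forall r x y e x' y', 0 <= r -> `|x| <= B -> `|y| <= B -> `|e| <= B ->
   `|x'| <= B -> `|y'| <= B -> `|x - x0| <= r -> `|y - y0| <= r -> `|e| <= r ->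
   `|x' - x0| <= r -> `|y' - y0| <= r ->
   `|G (pt x y e) - G (pt x' y' e) - (D1 G (pt x0 y0 0) * (x - x') + D2 G (pt x0 y0 0) * (y - y'))| <=
     K * r * (`|x - x'| + `|y - y'|).
Proof.
move=> [GD GC] x0B y0B.
have [K1 K10 H1] := pt_lip B (GC (pt 1 0 0) : class_C 1 (D1 G)).
have [K2 K20 H2] := pt_lip B (GC (pt 0 1 0) : class_C 1 (D2 G)).
exists (3 * (K1 + K2)); first by rewrite mulr_ge0 ?addr_ge0.
move=> r x y e x' y' r0 xB yB eB x'B y'B xr yr er x'r y'r.
have [s sI] := pt_mvt x y e x' y' e GD.
rewrite /= subrr mul0r mulr0 !addr0.
set x2 := x' + _; set y2 := y' + _ => /= ->.
have x2B : `|x2| <= B by exact: between_le.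
have y2B : `|y2| <= B by exact: between_le.
have x2r : `|x2 - x0| <= r.
  have -> : x2 - x0 = (x' - x0) + s * ((x - x0) - (x' - x0)) by rewrite /x2; ring.
  exact: between_le.
have y2r : `|y2 - y0| <= r.
  have -> : y2 - y0 = (y' - y0) + s * ((y - y0) - (y' - y0)) by rewrite /y2; ring.
  exact: between_le.
have B0 : `|0 : R| <= B by rewrite normr0 (le_trans _ xB).
have h1 := H1 _ _ _ _ _ _ x2B y2B eB x0B y0B B0.
have h2 := H2 _ _ _ _ _ _ x2B y2B eB x0B y0B B0.
rewrite subr0 in h1 h2.
have sum : `|x2 - x0| + `|y2 - y0| + `|e| <= 3 * r by move: x2r y2r er; clear; lra.
have i1 := le_trans h1 (ler_wpM2l K10 sum); have i2 := le_trans h2 (ler_wpM2l K20 sum).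
have -> : (x - x') * D1 G (pt x2 y2 e) + (y - y') * D2 G (pt x2 y2 e) -
   (D1 G (pt x0 y0 0) * (x - x') + D2 G (pt x0 y0 0) * (y - y')) =
   (x - x') * (D1 G (pt x2 y2 e) - D1 G (pt x0 y0 0)) +
   (y - y') * (D2 G (pt x2 y2 e) - D2 G (pt x0 y0 0)) by ring.
have -> : 3 * (K1 + K2) * r = (K1 + K2) * (3 * r) by ring.
exact: (linear_form_bound _ _ i1 i2).
Qed.

(** A mixed second-order difference: the mean value theorem along (u, w), applied to the difference
    of two translates of G, gives (u, w) times a difference of derivatives at nearby points. When G
    vanishes at both base points, as at the nodes, the error is of order [eta] times the
    displacement, as the tracking near the node requires. *)
Lemma pt_shift (G : V -> R) B x0 y0 : class_C 2 G ->
  exists2 K, 0 <= K & forall e zx zy u w, `|x0| <= B -> `|y0| <= B -> `|e| <= B ->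
   `|zx| <= B -> `|zy| <= B -> `|zx + u| <= B -> `|zy + w| <= B -> `|x0 + u| <= B -> `|y0 + w| <= B ->
   `|G (pt (zx + u) (zy + w) e) - G (pt (x0 + u) (y0 + w) 0) - (G (pt zx zy e) - G (pt x0 y0 0))| <=
     K * (`|zx - x0| + `|zy - y0| + `|e|) * (`|u| + `|w|).
Proof.
move=> [GD GC].
have [K1 K10 H1] := pt_lip B (GC (pt 1 0 0) : class_C 1 (D1 G)).
have [K2 K20 H2] := pt_lip B (GC (pt 0 1 0) : class_C 1 (D2 G)).
exists (K1 + K2); first by rewrite addr_ge0.
move=> e zx zy u w x0B y0B eB zxB zyB zuB zwB xuB ywB.
pose h (s : R) := G (pt zx zy e + s *: pt u w 0) - G (pt x0 y0 0 + s *: pt u w 0).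
pose dh (s : R) := 'D_(pt u w 0) G (pt zx zy e + s *: pt u w 0) -
  'D_(pt u w 0) G (pt x0 y0 0 + s *: pt u w 0).
have hD (s : R) : is_derive s (1:R) h (dh s).
  exact: (is_deriveB (line_derive (GD (pt zx zy e + s *: pt u w 0)))
    (line_derive (GD (pt x0 y0 0 + s *: pt u w 0)))).
have [s] := MVT_segment ler01 (fun s _ => hD s) (is_derive_within hD).
rewrite in_itv /= subr0 mulr1 => sI.
have h1E : h 1 = G (pt (zx + u) (zy + w) e) - G (pt (x0 + u) (y0 + w) 0).
  by rewrite /h !scale1r !ptD !addr0.
have h0E : h 0 = G (pt zx zy e) - G (pt x0 y0 0) by rewrite /h !scale0r !addr0.
have dhE : dh s = u * D1 G (pt (zx + s * u) (zy + s * w) e) + w * D2 G (pt (zx + s * u) (zy + s * w) e) -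
   (u * D1 G (pt (x0 + s * u) (y0 + s * w) 0) + w * D2 G (pt (x0 + s * u) (y0 + s * w) 0)).
  have dp z : 'D_(pt u w 0) G z = u * D1 G z + w * D2 G z.
    by rewrite (derive_pt _ _ _ (GD z)) mul0r addr0.
  by rewrite /dh !dp ptZ !ptD mulr0 !addr0.
rewrite h1E h0E dhE => ->.
have cl (z u' : R) : `|z| <= B -> `|z + u'| <= B -> `|z + s * u'| <= B.
  move=> a b; have -> : z + s * u' = z + s * ((z + u') - z) by ring.
  exact: between_le.
have B0 : `|0 : R| <= B by rewrite normr0 (le_trans _ x0B).
have h1 := H1 _ _ _ _ _ _ (cl _ _ zxB zuB) (cl _ _ zyB zwB) eB (cl _ _ x0B xuB) (cl _ _ y0B ywB) B0.
have h2 := H2 _ _ _ _ _ _ (cl _ _ zxB zuB) (cl _ _ zyB zwB) eB (cl _ _ x0B xuB) (cl _ _ y0B ywB) B0.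
have Ex (a b c : R) : a + c - (b + c) = a - b by ring.
rewrite !Ex subr0 in h1 h2.
set d := `|zx - x0| + _ + _ in h1 h2 *.
set p := pt _ _ e in h1 h2 *; set q := pt _ _ 0 in h1 h2 *.
have -> : u * D1 G p + w * D2 G p - (u * D1 G q + w * D2 G q) =
  u * (D1 G p - D1 G q) + w * (D2 G p - D2 G q) by ring.
exact: (linear_form_bound _ _ h1 h2).
Qed.

Lemma smooth_lip (f : R -> R) B : class_C 1 f ->
  exists2 K, 0 <= K & forall x x', `|x| <= B -> `|x'| <= B -> `|f x - f x'| <= K * `|x - x'|.
Proof.
move=> [fD fC].
have fd (t : R) : is_derive t (1:R) f ('D_1 f t) by split=> //; exact: diff_derivable.
have := compact_bounded (continuous_compact (continuous_subspaceT (fC 1)) (@segment_compact _ (- B) B)).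
move=> [M [_ HM]]; exists (`|M| + 1); first by rewrite addr_ge0.
have bd t : `|t| <= B -> `|'D_1 f t| <= `|M| + 1.
  move=> tB; apply: HM; first by rewrite (le_lt_trans (ler_norm _))// ltrDl.
  by exists t => //=; rewrite in_itv /= -ler_norml.
move=> x x'; wlog le : x x' / x' <= x.
  move=> H; have [h|/ltW h] := leP x' x; first exact: H.
  by rewrite distrC [`|x - _|]distrC => *; exact: H.
move=> xB x'B.
have bd' t : x' < t < x -> - (`|M| + 1) <= 'D_1 f t <= `|M| + 1.
  move=> tb; rewrite -ler_norml; apply: bd; move: tb xB x'B; rewrite !ler_norml; clear; lra.
have g1 := der_le le (fun t _ => fd t) (is_derive_within fd) (fun q qb => proj2 (andP (bd' q qb))).
have g2 := der_ge le (fun t _ => fd t) (is_derive_within fd) (fun q qb => proj1 (andP (bd' q qb))).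
by rewrite [`|x - x'|]ger0_norm ?subr_ge0// ler_norml; move: g1 g2; clear; lra.
Qed.

End smoothness_estimates.

(** * Tails of the sigmoidal function *)

Section sigmoid_gate.
Context {R : realType}.

Lemma expn_lip (w w' : R) k : 0 <= w <= 1 -> 0 <= w' <= 1 ->
  `|w ^+ k - w' ^+ k| <= k%:R * `|w - w'|.
Proof.
move=> /andP[w0 w1] /andP[w'0 w'1]; elim: k => [|k IH].
  by rewrite !expr0 subrr normr0 mul0r.
have -> : w ^+ k.+1 - w' ^+ k.+1 = w * (w ^+ k - w' ^+ k) + (w - w') * w' ^+ k.
  by rewrite !exprS; ring.
rewrite (le_trans (ler_normD _ _))// !normrM (ger0_norm w0).
have i1 : w * `|w ^+ k - w' ^+ k| <= `|w ^+ k - w' ^+ k| by rewrite ler_piMl.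
have i2 : `|w - w'| * `|w' ^+ k| <= `|w - w'|.
  by rewrite ler_piMr// ger0_norm ?exprn_ge0// exprn_ile1.
by rewrite -addn1 natrD mulrDl mul1r; move: i1 i2 IH; clear; lra.
Qed.

(** In w = 1/t the tail is w^k h(w) with [h] smooth up to w = 0, hence bounded and Lipschitz on
    [0, 1]; on t >= Z, w is at most 1/Z and is Lipschitz in t with constant 1/Z^2. *)
Lemma power_tail (f g : R -> R) k : (0 < k)%N -> smooth_halfline g ->
  (forall t, 0 < t -> f t = t ^- k * g t^-1) ->
  exists2 C, 0 < C & forall Z, 1 <= Z ->
    (forall t, Z <= t -> `|f t| <= C / Z) /\
    (forall t t', Z <= t -> Z <= t' -> `|f t - f t'| <= C / (Z * Z) * `|t - t'|).
Proof.
move=> k0 [h hS hE] fE.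
have [K K0 HK] := smooth_lip 1 (hS 1%N).
pose G := `|h 0| + K.
have hG w : 0 <= w <= 1 -> `|h w| <= G.
  move=> /andP[w0 w1]; have h1 : `|w| <= 1 by rewrite ger0_norm.
  have := HK w 0 h1; rewrite normr0 ler01 subr0 => /(_ isT) h2.
  have := ler_normD (h w - h 0) (h 0); rewrite subrK /G.
  have := ler_wpM2l K0 h1; move: h2; clear; lra.
have G0 : 0 <= G by rewrite addr_ge0.
pose C := k%:R * G + K + G + 1.
have kG : 0 <= k%:R * G by rewrite mulr_ge0.
exists C; first by rewrite /C; move: kG K0 G0; clear; lra.
move=> Z Z1; have Z0 : 0 < Z := lt_le_trans ltr01 Z1.
have fw t : Z <= t -> [/\ 0 < t, 0 <= t^-1 <= 1, t^-1 <= Z^-1 & f t = (t^-1) ^+ k * h t^-1].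
  move=> Zt; have t0 : 0 < t := lt_le_trans Z0 Zt.
  split=> //.
  - by rewrite invr_ge0 (ltW t0) invf_le1// (le_trans Z1).
  - by rewrite lef_pV2.
  - by rewrite fE// hE ?invr_ge0 ?(ltW t0)// exprVn.
split.
  move=> t /fw[t0 tb tZ ->]; have /andP[w0 w1] := tb.
  rewrite normrM (ger0_norm (exprn_ge0 _ w0)) [C / Z]mulrC.
  have i1 : t^-1 ^+ k <= Z^-1.
    apply: le_trans tZ; case: k k0 {fE fw C kG} => // k _.
    by rewrite exprS ler_piMr// exprn_ile1.
  apply: ler_pM => //; first exact: exprn_ge0.
  by rewrite (le_trans (hG _ tb))// /C; move: kG K0; clear; lra.
move=> t t' /fw[t0 tb tZ ->] /fw[t'0 t'b t'Z ->].
have /andP[w0 w1] := tb; have /andP[w'0 w'1] := t'b.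
have D : `|t^-1 - t'^-1| <= (Z * Z)^-1 * `|t - t'|.
  have -> : t^-1 - t'^-1 = (t' - t) * (t^-1 * t'^-1) by field; rewrite !lt0r_neq0.
  rewrite normrM mulrC (distrC t') ler_wpM2r// ger0_norm ?mulr_ge0// invfM.
  by apply: ler_pM.
rewrite -mulrA.
apply: (@le_trans _ _ (C * `|t^-1 - t'^-1|)); last first.
  rewrite ler_wpM2l//; rewrite /C; move: kG K0 G0; clear; lra.
have -> : t^-1 ^+ k * h t^-1 - t'^-1 ^+ k * h t'^-1 =
   (t^-1 ^+ k - t'^-1 ^+ k) * h t^-1 + t'^-1 ^+ k * (h t^-1 - h t'^-1) by ring.
rewrite (le_trans (ler_normD _ _))// !normrM.
have i1 : `|t^-1 ^+ k - t'^-1 ^+ k| * `|h t^-1| <= k%:R * `|t^-1 - t'^-1| * G.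
  by apply: ler_pM => //; [exact: expn_lip|exact: hG].
have i2 : `|t'^-1 ^+ k| * `|h t^-1 - h t'^-1| <= 1 * (K * `|t^-1 - t'^-1|).
  apply: ler_pM => //; first by rewrite ger0_norm ?exprn_ge0// exprn_ile1.
  by apply: HK; rewrite ger0_norm.
have n := normr_ge0 (t^-1 - t'^-1); have n2 : 0 <= G * `|t^-1 - t'^-1| by rewrite mulr_ge0.
by move: i1 i2 n n2; rewrite /C; move: `|t^-1 - t'^-1| => z; clear; lra.
Qed.

(** Outside the layer the argument of [phi] is at least Z = delta / eps in modulus, so the tail is
    O(eps / delta) and its Lipschitz constant, 1/eps times O(1/Z^2), is O(eps / delta^2). Clamping
    keeps the argument in a compact set, where [phi] is Lipschitz; with B >= 2 and delta <= 1 it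
    moves no point into the layer. *)
Lemma gate_of_sigmoidal (phi : R -> R) B delta sigma : sigmoidal phi -> 2 <= B ->
  0 < delta -> 0 < sigma -> exists2 eps0, 0 < eps0 & forall eps, 0 < eps <= eps0 ->
  gate delta sigma (fun x => phi (eps^-1 * (clamp 0 B x - 1))).
Proof.
move=> [phiS phi01 _ _ _ [k [fL [fR [k0 [fLS fRS] _ _ [EL ER]]]]]] B2.
(* A gate of width 1 is a gate of any larger width. *)
wlog d1 : delta / delta <= 1.
  move=> H d0 s0; have [d1|d1] := leP delta 1; first exact: H.
  have [eps0 e0 He] := H 1 (lexx _) ltr01 s0; exists eps0 => // eps /He[g1 g2 g3 g4 g5 g6].
  have l1 x : x <= 1 - delta -> x <= 1 - 1 by move: d1; clear; lra.
  have l2 x : 1 + delta <= x -> 1 + 1 <= x by move: d1; clear; lra.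
  split=> //.
  - by move=> x /l1; exact: g3.
  - by move=> x x' /l1 ? /l1 ?; exact: g4.
  - by move=> x /l2; exact: g5.
  - by move=> x x' /l2 ? /l2 ?; exact: g6.
move=> d0 s0.
have ELm t : 0 < t -> phi (- t) = t ^- k * fL t^-1.
  by move=> t0; rewrite EL ?opprK// oppr_lt0.
have ERm t : 0 < t -> 1 - phi t = t ^- k * fR t^-1.
  by move=> t0; rewrite ER// opprB addrC subrK.
have [CL CL0 HL] := power_tail k0 fLS ELm; have [CR CR0 HR] := power_tail k0 fRS ERm.
pose C := CL + CR; have C0 : 0 < C by exact: addr_gt0.
have [eps0 e0 /= /and4P[ed e1 e2 _]] : exists2 e, 0 < e & all (fun r => e <= r)
    [:: delta; sigma * delta / C; sigma * (delta * delta) / C].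
  by apply: lt_bounds; apply/and4P; split=> //; apply: divr_gt0 => //; repeat apply: mulr_gt0 => //.
exists eps0 => // eps /andP[ep0 epe].
have epd : eps <= delta := le_trans epe ed.
pose Z := delta / eps; have Z1 : 1 <= Z by rewrite ler_pdivlMr// mul1r.
have Z0 : 0 < Z by apply: lt_le_trans Z1.
have [HL1 HL2] := HL Z Z1; have [HR1 HR2] := HR Z Z1.
have CZ : C / Z <= sigma.
  rewrite ler_pdivrMr// /Z mulrA ler_pdivlMr// -ler_pdivlMl// mulrC (le_trans epe)//.
have CZZ : C / (Z * Z) * eps^-1 <= sigma.
  have -> : C / (Z * Z) * eps^-1 = C * eps / (delta * delta).
    by rewrite /Z; field; rewrite !lt0r_neq0.
  by rewrite ler_pdivrMr ?mulr_gt0// -ler_pdivlMl// mulrC (le_trans epe).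
have CLC : CL <= C by rewrite lerDl ltW.
have CRC : CR <= C by rewrite lerDr ltW.
have cl_left x : x <= 1 - delta -> Z <= - (eps^-1 * (clamp 0 B x - 1)).
  move=> xd; have cx : clamp 0 B x <= 1 - delta.
    rewrite /clamp ge_max ge_min xd /= andbT; move: B2 d1; clear; lra.
  by rewrite /Z mulrC -mulrN ler_wpM2l ?invr_ge0 ?(ltW ep0)//; move: cx; clear; lra.
have cl_right x : 1 + delta <= x -> Z <= eps^-1 * (clamp 0 B x - 1).
  move=> xd; have cx : 1 + delta <= clamp 0 B x.
    rewrite /clamp le_max le_min xd /=; apply/orP; right; move: B2 d1; clear; lra.
  by rewrite /Z mulrC ler_wpM2l ?invr_ge0 ?(ltW ep0)//; move: cx; clear; lra.
have arg_lip x x' : `|eps^-1 * (clamp 0 B x - 1) - eps^-1 * (clamp 0 B x' - 1)| <= eps^-1 * `|x - x'|.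
  have -> : eps^-1 * (clamp 0 B x - 1) - eps^-1 * (clamp 0 B x' - 1) =
    eps^-1 * (clamp 0 B x - clamp 0 B x') by ring.
  rewrite normrM gtr0_norm ?invr_gt0// ler_wpM2l ?invr_ge0 ?(ltW ep0)//; exact: clamp_lip.
have iZZ : 0 <= (Z * Z)^-1 by rewrite invr_ge0 mulr_ge0// ltW.
split.
- by move=> x; have /andP[p0 p1] := phi01 (eps^-1 * (clamp 0 B x - 1)); rewrite !ltW.
- have [K K0 HK] := smooth_lip (eps^-1 * (B + 1)) (phiS 1%N).
  exists (K * eps^-1); first by rewrite mulr_ge0// invr_ge0 ltW.
  have bd x : `|eps^-1 * (clamp 0 B x - 1)| <= eps^-1 * (B + 1).
    rewrite normrM gtr0_norm ?invr_gt0// ler_wpM2l ?invr_ge0 ?(ltW ep0)//.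
    rewrite (le_trans (ler_normB _ _))// normr1 lerD2r.
    have B0 : 0 <= B by move: B2; clear; lra.
    by have := @clamp_in R 0 B x B0; rewrite subr0.
  move=> x x'; rewrite (le_trans (HK _ _ (bd x) (bd x')))// -mulrA ler_wpM2l//.
- move=> x /cl_left Zx; have := HL1 _ Zx; rewrite opprK => h.
  rewrite (le_trans (ler_norm _))// (le_trans h)// (le_trans _ CZ)//.
  by rewrite ler_wpM2r// invr_ge0 ltW.
- move=> x x' /cl_left Zx /cl_left Zx'; have := HL2 _ _ Zx Zx'; rewrite -opprD normrN !opprK => h.
  rewrite (le_trans h)//.
  apply: (@le_trans _ _ (C / (Z * Z) * (eps^-1 * `|x - x'|))).
    by apply: ler_pM => //; rewrite ?mulr_ge0 ?(ltW CL0)// ler_wpM2r.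
  by rewrite mulrA ler_wpM2r.
- move=> x /cl_right Zx; have h := HR1 _ Zx.
  rewrite (le_trans (ler_norm _))// (le_trans h)// (le_trans _ CZ)//.
  by rewrite ler_wpM2r// invr_ge0 ltW.
- move=> x x' /cl_right Zx /cl_right Zx'; have h := HR2 _ _ Zx Zx'.
  have -> : phi (eps^-1 * (clamp 0 B x - 1)) - phi (eps^-1 * (clamp 0 B x' - 1)) =
    - (1 - phi (eps^-1 * (clamp 0 B x - 1)) - (1 - phi (eps^-1 * (clamp 0 B x' - 1)))) by ring.
  rewrite normrN (le_trans h)//; apply: (@le_trans _ _ (C / (Z * Z) * (eps^-1 * `|x - x'|))).
    by apply: ler_pM => //; rewrite ?mulr_ge0 ?(ltW CR0)// ler_wpM2r.
  by rewrite mulrA ler_wpM2r.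
Qed.

End sigmoid_gate.

(** * Spectral data of the node *)

Section node_data.
Context {R : realType}.

Lemma row2_eq (v w : 'rV[R]_2) : v 0 0 = w 0 0 -> v 0 1 = w 0 1 -> v = w.
Proof. by move=> h0 h1; rewrite -(vec2_eta v) -(vec2_eta w) h0 h1. Qed.

Definition coordf (X : R -> 'rV[R]_2 -> 'rV[R]_2) i (u : 'rV[R]_2 * R) : R := X u.2 u.1 0 i.

Lemma coordf_class X i n : smooth (fun u : 'rV[R]_2 * R => X u.2 u.1) -> class_C n (coordf X i).
Proof. by move=> XS; exact: class_C_coord (XS n). Qed.

Lemma jacobian_coord X (x y : R) (v : 'rV[R]_2) i : smooth (fun u : 'rV[R]_2 * R => X u.2 u.1) ->
  (v *m jacobian (X 0) (vec2 x y)) 0 i =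
  v 0 0 * D1 (coordf X i) (pt x y 0) + v 0 1 * D2 (coordf X i) (pt x y 0).
Proof.
move=> XS; have [fD _] := XS 1%N; have [gD _] := coordf_class i 1 XS.
set f := (fun u : 'rV[R]_2 * R => X u.2 u.1) in fD.
have E : (fun h : R => h^-1 *: (X 0 (h *: v + vec2 x y) - X 0 (vec2 x y))) =
   (fun h : R => h^-1 *: (f (h *: (v, 0) + pt x y 0) - f (pt x y 0))).
  apply/funext => h; congr (_ *: (_ - _)).
  have P : h *: ((v, 0) : 'rV[R]_2 * R) + (vec2 x y, 0) = (h *: v + vec2 x y, h * 0 + 0) by [].
  by rewrite /f /pt P mulr0 addr0.
have XD : differentiable (X 0) (vec2 x y).
  have -> : X 0 = f \o (fun u => (u, 0)) by [].
  apply: differentiable_comp; last exact: fD.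
  by apply: differentiable_pair => //; exact: differentiable_cst.
rewrite -(deriveEjacobian v XD).
have -> : 'D_v (X 0) (vec2 x y) = 'D_((v, 0) : 'rV[R]_2 * R) f (pt x y 0) by rewrite /derive E.
have fv : derivable f (pt x y 0) ((v, 0) : 'rV[R]_2 * R) by exact: diff_derivable.
rewrite (derive_mx fv) mxE.
have -> : ((v, 0) : 'rV[R]_2 * R) = pt (v 0 0) (v 0 1) 0 by rewrite /pt vec2_eta.
by rewrite (derive_pt _ _ _ (gD _)) mul0r addr0.
Qed.

Section matrix2.
Variables (J : 'M[R]_2) (a11 a12 a21 a22 : R).
Hypothesis JE0 : forall v : 'rV[R]_2, (v *m J) 0 0 = v 0 0 * a11 + v 0 1 * a21.
Hypothesis JE1 : forall v : 'rV[R]_2, (v *m J) 0 1 = v 0 0 * a12 + v 0 1 * a22.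

Lemma eigen_coord l (v : 'rV[R]_2) : v *m J = l *: v ->
  v 0 0 * a11 + v 0 1 * a21 = l * v 0 0 /\ v 0 0 * a12 + v 0 1 * a22 = l * v 0 1.
Proof. by move=> E; rewrite -JE0 -JE1 E !mxE. Qed.

(** Multiplying the eigenvector equations by the adjugate matrix shows that both coordinates of [v],
    times the characteristic polynomial, vanish. *)
Lemma eigen_char l : eigenvalue J l -> (a11 - l) * (a22 - l) - a12 * a21 = 0.
Proof.
move=> /eigenvalueP[v /eigen_coord[e0 e1] v0].
have h0 : v 0 0 * ((a11 - l) * (a22 - l) - a12 * a21) = 0.
  have -> : v 0 0 * ((a11 - l) * (a22 - l) - a12 * a21) =
    (v 0 0 * a11 + v 0 1 * a21 - l * v 0 0) * (a22 - l) -
    (v 0 0 * a12 + v 0 1 * a22 - l * v 0 1) * a21 by ring.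
  by rewrite e0 e1 !subrr !mul0r subr0.
have h1 : v 0 1 * ((a11 - l) * (a22 - l) - a12 * a21) = 0.
  have -> : v 0 1 * ((a11 - l) * (a22 - l) - a12 * a21) =
    (v 0 0 * a12 + v 0 1 * a22 - l * v 0 1) * (a11 - l) -
    (v 0 0 * a11 + v 0 1 * a21 - l * v 0 0) * a12 by ring.
  by rewrite e0 e1 !subrr !mul0r subr0.
apply/eqP; apply: contraT => d0; case/negP: v0; apply/eqP.
move/eqP: h0; rewrite mulf_eq0 (negbTE d0) orbF => /eqP h0.
move/eqP: h1; rewrite mulf_eq0 (negbTE d0) orbF => /eqP h1.
by apply: row2_eq; rewrite mxE.
Qed.

Lemma eigen_trace_det l1 l2 : l1 < l2 -> eigenvalue J l1 -> eigenvalue J l2 ->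
  a11 + a22 = l1 + l2 /\ a11 * a22 - a12 * a21 = l1 * l2.
Proof.
move=> l12 /eigen_char e1 /eigen_char e2.
have tr : a11 + a22 = l1 + l2.
  have : (l1 - l2) * (l1 + l2 - (a11 + a22)) = 0.
    have -> : (l1 - l2) * (l1 + l2 - (a11 + a22)) =
      ((a11 - l1) * (a22 - l1) - a12 * a21) - ((a11 - l2) * (a22 - l2) - a12 * a21) by ring.
    by rewrite e1 e2 subrr.
  move/eqP; rewrite mulf_eq0 subr_eq0 (lt_eqF l12) /= subr_eq0 => /eqP <- //.
split=> //.
have -> : a11 * a22 - a12 * a21 = ((a11 - l1) * (a22 - l1) - a12 * a21) + l1 * (a11 + a22) - l1 * l1 by ring.
by rewrite e1 tr; ring.
Qed.

Lemma eigen_two l1 l2 l : l1 < l2 -> eigenvalue J l1 -> eigenvalue J l2 -> eigenvalue J l ->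
  l = l1 \/ l = l2.
Proof.
move=> l12 e1 e2 /eigen_char e; have [tr det] := eigen_trace_det l12 e1 e2.
have : (l - l1) * (l - l2) = 0.
  have -> : (l - l1) * (l - l2) = l * l - l * (l1 + l2) + l1 * l2 by ring.
  by rewrite -tr -det -e; ring.
by move/eqP; rewrite mulf_eq0 !subr_eq0 => /orP[/eqP|/eqP]; [left|right].
Qed.

(** A vertical eigenvector forces a21 = 0 and a22 = l; as the eigenvalues are distinct, a11 != l,
    and the eigenspace is exactly the vertical line. Condition (ii) excludes this for the weak
    direction. *)
Lemma vertical_eigenvector l1 l2 l (v : 'rV[R]_2) : l1 < l2 -> eigenvalue J l1 -> eigenvalue J l2 ->
  v != 0 -> v *m J = l *: v -> v 0 0 = 0 -> (eigenspace J l == vec2 0 1)%MS.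
Proof.
move=> l12 e1 e2 v0 /eigen_coord[c0 c1] v00; have [tr det] := eigen_trace_det l12 e1 e2.
have v01 : v 0 1 != 0.
  by apply: contraNneq v0 => v01; apply/eqP/row2_eq; rewrite ?v00 ?v01 mxE.
rewrite v00 !mul0r !add0r mulr0 in c0; rewrite v00 mul0r add0r mulrC in c1.
have a210 : a21 = 0 by move/eqP: c0; rewrite mulf_eq0 (negbTE v01) /= => /eqP.
have a22l : a22 = l by apply: (mulIf v01).
have a11l : a11 != l.
  apply/eqP => a11l; rewrite a11l a22l a210 mulr0 subr0 in tr det.
  have : (l1 - l2) ^+ 2 = 0.
    have -> : (l1 - l2) ^+ 2 = (l1 + l2) ^+ 2 - 4 * (l1 * l2) by ring.
    by rewrite -tr -det; ring.
  by move/eqP; rewrite sqrf_eq0 subr_eq0 (lt_eqF l12).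
apply/andP; split.
  apply/row_subP => i; set r := row i _.
  have /eigenspaceP/eigen_coord[d0 _] : (r <= eigenspace J l)%MS by exact: row_sub.
  have r0 : r 0 0 = 0.
    move: d0; rewrite a210 mulr0 addr0 mulrC => /eqP.
    rewrite -subr_eq0 -mulrBl mulf_eq0 subr_eq0 (negbTE a11l) => /eqP //.
  have -> : r = r 0 1 *: vec2 0 1.
    apply: row2_eq; first by rewrite r0 mxE vec2_0 mulr0.
    by rewrite [RHS]mxE vec2_1 mulr1.
  exact: scalemx_sub.
apply/eigenspaceP; apply: row2_eq.
  by rewrite JE0 vec2_0 vec2_1 a210 mxE vec2_0 !mulr0 mul0r addr0.
by rewrite JE1 vec2_0 vec2_1 a22l mxE vec2_1 mul0r add0r mul1r mulr1.
Qed.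

End matrix2.

Lemma near_pinftyP (P : R -> Prop) : (\forall t \near +oo, P t) -> exists2 T : R, 0 <= T & forall t, T <= t -> P t.
Proof.
move=> [M [_ HM]]; exists (`|M| + 1); first by rewrite addr_ge0.
move=> t Mt; apply: HM; apply: lt_le_trans Mt.
by rewrite (le_lt_trans (ler_norm _))// ltrDl.
Qed.

Lemma cvg_coord (T : Type) (F : set_system T) (c : T -> 'rV[R]_2) (v : 'rV[R]_2) i : Filter F ->
  c t @[t --> F] --> v -> c t 0 i @[t --> F] --> v 0 i.
Proof.
move=> FF cv.
have H : {for v, continuous (fun M : 'rV[R]_2 => M 0 i)} by exact: coord_continuous.
exact: (continuous_cvg FF H cv).
Qed.

(** The normalised displacement tends to [v], whose first coordinate is negative since it is nonzero
    and the orbit stays in x < 1. Dividing by the first coordinate gives the slope [mm], with an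
    error relative to 1 - x instead of the norm. *)
Lemma weak_direction (c : R -> 'rV[R]_2) (yL : R) (v : 'rV[R]_2) :
  c t @[t --> +oo] --> vec2 1 yL -> (\forall t \near +oo, c t != vec2 1 yL) ->
  `|c t - vec2 1 yL|^-1 *: (c t - vec2 1 yL) @[t --> +oo] --> v ->
  (forall t, 0 < t -> c t 0 0 < 1) -> v 0 0 != 0 ->
  forall e, 0 < e -> exists2 T, 0 <= T & forall t, T <= t ->
    1 - c t 0 0 <= e /\ `|c t 0 1 - yL - v 0 1 / v 0 0 * (c t 0 0 - 1)| <= e * (1 - c t 0 0).
Proof.
move=> cp cne cv cl v0 e e0.
pose n t := `|c t - vec2 1 yL|.
have E0 t : (`|c t - vec2 1 yL|^-1 *: (c t - vec2 1 yL)) 0 0 = (n t)^-1 * (c t 0 0 - 1).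
  by rewrite /n; move: `|_|^-1 => z; rewrite !mxE.
have E1 t : (`|c t - vec2 1 yL|^-1 *: (c t - vec2 1 yL)) 0 1 = (n t)^-1 * (c t 0 1 - yL).
  by rewrite /n; move: `|_|^-1 => z; rewrite !mxE.
have u0 : (n t)^-1 * (c t 0 0 - 1) @[t --> +oo] --> v 0 0.
  rewrite (_ : (fun t => _) = (fun t => (`|c t - vec2 1 yL|^-1 *: (c t - vec2 1 yL)) 0 0)).
    exact: cvg_coord.
  by apply/funext.
have u1 : (n t)^-1 * (c t 0 1 - yL) @[t --> +oo] --> v 0 1.
  rewrite (_ : (fun t => _) = (fun t => (`|c t - vec2 1 yL|^-1 *: (c t - vec2 1 yL)) 0 1)).
    exact: cvg_coord.
  by apply/funext.
have cx : c t 0 0 @[t --> +oo] --> (1:R) by rewrite -(vec2_0 1 yL); exact: cvg_coord.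
have vn : v 0 0 < 0.
  rewrite lt_neqAle v0 /= leNgt; apply/negP => vp.
  have /cvgrPdist_lt/(_ _ vp)/near_pinftyP[T T0 HT] := u0.
  have Tp : 0 < T + 1 by rewrite ltr_wpDl.
  have := HT (T + 1); rewrite lerDl ler01 => /(_ isT).
  have : (n (T + 1))^-1 * (c (T + 1) 0 0 - 1) <= 0.
    have i0 : 0 <= (n (T + 1))^-1 by rewrite invr_ge0 normr_ge0.
    have i1 : c (T + 1) 0 0 - 1 <= 0 by rewrite subr_le0 ltW// cl.
    exact: mulr_ge0_le0.
  by rewrite ltr_norml; clear; lra.
pose al := - v 0 0; have al0 : 0 < al by rewrite oppr_gt0.
pose mm := v 0 1 / v 0 0.
have mmE : mm * v 0 0 = v 0 1 by rewrite /mm divfK.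
pose e2 := Num.min (al / 2) (e * al / (4 * (1 + `|mm|))).
have mm1 : 0 < 1 + `|mm| by rewrite ltr_wpDr.
have e20 : 0 < e2.
  have p1 : 0 < al / 2 by exact: divr_gt0.
  have p2 : 0 < e * al / (4 * (1 + `|mm|)) by apply: divr_gt0; exact: mulr_gt0.
  by rewrite lt_min p1 p2.
have /cvgrPdist_lt/(_ _ e20)/near_pinftyP[T0 T00 HT0] := u0.
have /cvgrPdist_lt/(_ _ e20)/near_pinftyP[T1 T10 HT1] := u1.
have /cvgrPdist_lt/(_ _ e0)/near_pinftyP[T2 T20 HT2] := cx.
have /near_pinftyP[T3 T30 HT3] := cne.
pose T := T0 + T1 + T2 + T3.
exists T; first by rewrite !addr_ge0.
move=> t Tt.
have [t0 t1 t2 t3] : [/\ T0 <= t, T1 <= t, T2 <= t & T3 <= t].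
  by move: Tt T00 T10 T20 T30; rewrite /T; clear; split; lra.
have h0 := HT0 t t0; have h1 := HT1 t t1; have h2 := HT2 t t2; have h3 := HT3 t t3.
split; first by move: h2; rewrite ltr_norml; clear; lra.
have n0 : 0 < n t by rewrite normr_gt0 subr_eq0.
set x := (n t)^-1 * (c t 0 0 - 1) in h0; set y := (n t)^-1 * (c t 0 1 - yL) in h1.
have xE : c t 0 0 - 1 = n t * x by rewrite /x mulVKf// lt0r_neq0.
have yE : c t 0 1 - yL = n t * y by rewrite /y mulVKf// lt0r_neq0.
have -> : 1 - c t 0 0 = n t * (- x) by rewrite mulrN -xE opprB.
rewrite -/mm xE yE (_ : n t * y - mm * (n t * x) = n t * (y - mm * x)); last by ring.
have -> : e * (n t * - x) = n t * (e * - x) by ring.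
rewrite normrM (gtr0_norm n0); apply: ler_wpM2l; first exact: ltW.
have e21 : e2 <= al / 2 by rewrite ge_min lexx.
have e22 : e2 * (1 + `|mm|) * 4 <= e * al.
  have : e2 <= e * al / (4 * (1 + `|mm|)) by rewrite ge_min lexx orbT.
  by rewrite ler_pdivlMr ?mulr_gt0//; move: `|mm| => z; clear; lra.
have xa : al / 2 <= - x by move: h0 e21; rewrite /al ltr_norml; clear; lra.
have -> : y - mm * x = - (v 0 1 - y) + mm * (v 0 0 - x) by rewrite mulrBr mmE; ring.
rewrite (le_trans (ler_normD _ _))// normrN normrM.
have i1 : `|mm| * `|v 0 0 - x| <= `|mm| * e2 by rewrite ler_wpM2l// ltW.
have i2 : e * (al / 2) <= e * (- x) by rewrite ler_wpM2l// ltW.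
have i3 : 0 < e * al by exact: mulr_gt0.
by move: h1 i1 i2 i3 e22; move: `|mm| `|v 0 1 - y| `|v 0 0 - x| => z1 z2 z3; clear; lra.
Qed.

Lemma derivable_linear_bound (z : R -> R) : derivable z 0 1 ->
  forall e, 0 < e -> exists2 r, 0 < r & forall h, `|h| < r -> `|z h - z 0 - 'D_1 z 0 * h| <= e * `|h|.
Proof.
move=> zD e e0.
have /cvgrPdist_le/(_ _ e0)[r /= r0 H] : h^-1 *: (z (h *: (1:R) + 0) - z 0) @[h --> 0^'] --> 'D_1 z 0.
  exact: zD.
exists r => // h hr; have [->|h0] := eqVneq h 0.
  by rewrite subrr mulr0 subrr normr0 mulr0.
have := H h; rewrite /= sub0r normrN => /(_ hr h0).
rewrite addr0 [h *: 1]mulr1 /GRing.scale /= => H1.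
have -> : z h - z 0 - 'D_1 z 0 * h = - ('D_1 z 0 - h^-1 * (z h - z 0)) * h by field.
by rewrite normrM normrN ler_wpM2r.
Qed.

End node_data.

(** * The limit cycle of the regularization *)

Section assembly.
Context {R : realType}.
Implicit Types X : R -> 'rV[R]_2 -> 'rV[R]_2.

Definition clamped X (B : R) i (eta x y : R) : R :=
  X eta (vec2 (clamp 0 B x) (clamp 0 B y)) 0 i.

Lemma clamped_id X B i eta x y : `|x| <= B -> `|y| <= B -> clamped X B i eta x y = X eta (vec2 x y) 0 i.
Proof. by move=> xB yB; rewrite /clamped !clamp_id ?subr0. Qed.

Lemma clamp0_le (B x : R) : 0 <= B -> `|clamp 0 B x| <= B.
Proof. by move=> B0; have := @clamp_in R 0 B x B0; rewrite subr0. Qed.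

Lemma clamped_bounds X B i : 1 <= B -> smooth (fun u : 'rV[R]_2 * R => X u.2 u.1) ->
  exists K M, [/\ 0 <= K, 0 <= M,
    forall eta eta' x y x' y', `|eta| <= 1 -> `|eta'| <= 1 ->
      `|clamped X B i eta x y - clamped X B i eta' x' y'| <= K * (`|x - x'| + `|y - y'| + `|eta - eta'|) &
    forall eta x y, `|eta| <= 1 -> `|clamped X B i eta x y| <= M].
Proof.
move=> B1 XS; have B0 : 0 <= B := le_trans ler01 B1.
have [K K0 HK] := pt_lip B (coordf_class i 1 XS).
have [M M0 HM] := pt_continuous_box B (coordf_class i 0 XS).
exists K, M; split=> //.
  move=> eta eta' x y x' y' e1 e1'.
  have := HK _ _ _ _ _ _ (clamp0_le x B0) (clamp0_le y B0) (le_trans e1 B1)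
    (clamp0_le x' B0) (clamp0_le y' B0) (le_trans e1' B1).
  move=> h; apply: (le_trans h); rewrite ler_wpM2l// lerD2r lerD//; exact: clamp_lip.
by move=> eta x y e1; apply: HM; rewrite ?clamp0_le// (le_trans e1).
Qed.

Lemma clamped_crossing_fields XL XR B : 1 <= B ->
  smooth (fun u : 'rV[R]_2 * R => XL u.2 u.1) -> smooth (fun u : 'rV[R]_2 * R => XR u.2 u.1) ->
  exists Lc M, forall r0, 0 < r0 <= 1 ->
    crossing_fields (clamped XL B 0) (clamped XL B 1) (clamped XR B 0) (clamped XR B 1) Lc M r0.
Proof.
move=> B1 LS RS.
have [K1 [M1 [K10 M10 l1 b1]]] := clamped_bounds 0 B1 LS.
have [K2 [M2 [K20 M20 l2 b2]]] := clamped_bounds 1 B1 LS.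
have [K3 [M3 [K30 M30 l3 b3]]] := clamped_bounds 0 B1 RS.
have [K4 [M4 [K40 M40 l4 b4]]] := clamped_bounds 1 B1 RS.
pose K := K1 + K2 + K3 + K4.
exists K, (M1 + M2 + M3 + M4 + 1) => r0 /andP[r00 r01].
have [k1 k2 k3 k4] : [/\ K1 <= K, K2 <= K, K3 <= K & K4 <= K].
  by rewrite /K; move: K10 K20 K30 K40; clear; split; lra.
have e1 (eta : R) : 0 <= eta <= r0 -> `|eta| <= 1.
  by move=> /andP[a b]; rewrite ger0_norm// (le_trans b).
have lipK (F : R -> R -> R -> R) k : k <= K ->
    (forall eta eta' x y x' y', `|eta| <= 1 -> `|eta'| <= 1 ->
      `|F eta x y - F eta' x' y'| <= k * (`|x - x'| + `|y - y'| + `|eta - eta'|)) ->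
    forall eta, 0 <= eta <= r0 -> lip K (F eta).
  move=> kK HF eta /e1 h x y x' y'; have := HF eta eta x y x' y' h h.
  rewrite subrr normr0 addr0 => /le_trans; apply; rewrite ler_wpM2r// addr_ge0//.
have etaK (F : R -> R -> R -> R) k : k <= K ->
    (forall eta eta' x y x' y', `|eta| <= 1 -> `|eta'| <= 1 ->
      `|F eta x y - F eta' x' y'| <= k * (`|x - x'| + `|y - y'| + `|eta - eta'|)) ->
    forall eta x y, 0 <= eta <= r0 -> `|F eta x y - F 0 x y| <= K * eta.
  move=> kK HF eta x y et; have h := e1 _ et; have := HF eta 0 x y x y h.
  rewrite !subrr subr0 normr0 !add0r => /(_ ler01)/le_trans; apply.
  by have /andP[a b] := et; rewrite ger0_norm// ler_wpM2r.
split=> //.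
- by move: M10 M20 M30 M40; clear; lra.
- by move=> eta et; split; [apply: (lipK _ K1)|apply: (lipK _ K2)|apply: (lipK _ K3)|apply: (lipK _ K4)].
- move=> eta /e1 h x y; have := b1 eta x y h; have := b2 eta x y h; have := b3 eta x y h; have := b4 eta x y h.
  by move: M10 M20 M30 M40; clear; split; lra.
- by move=> eta et x y; split; [apply: (etaK _ K1)|apply: (etaK _ K2)|apply: (etaK _ K3)|apply: (etaK _ K4)].
Qed.

Lemma within_coord (A : set R) (c : R -> 'rV[R]_2) i : {within A, continuous c} ->
  {within A, continuous (fun t => c t 0 i)}.
Proof.
move=> cC t.
have H : {for (from_subspace A c t), continuous (fun M : 'rV[R]_2 => M 0 i)} by exact: coord_continuous.
exact: (continuous_cvg _ H (cC t)).
Qed.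

Lemma solution_is_flow X B (c : R -> 'rV[R]_2) (b Lf : R) (x y : R -> R) :
  lip Lf (clamped X B 0 0) -> lip Lf (clamped X B 1 0) ->
  {within `[0, b], continuous c} -> (forall t : R, 0 < t < b -> is_derive t (1:R) c (X 0 (c t))) ->
  (forall t, 0 <= t <= b -> `|c t 0 0| <= B /\ `|c t 0 1| <= B) ->
  is_sol (clamped X B 0 0) (clamped X B 1 0) x y -> x 0 = c 0 0 0 -> y 0 = c 0 0 1 ->
  forall t, 0 <= t <= b -> c t = vec2 (x t) (y t).
Proof.
move=> fL gL cC cD cB S x0 y0 t tb.
have F r : 0 < r < b -> X 0 (c r) 0 0 = clamped X B 0 0 (c r 0 0) (c r 0 1) /\
    X 0 (c r) 0 1 = clamped X B 1 0 (c r 0 0) (c r 0 1).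
  move=> /andP[r0 rb]; have rb' : 0 <= r <= b by rewrite !ltW.
  by have [b1 b2] := cB r rb'; rewrite !clamped_id// vec2_eta.
have [h1 h2] := sol_unique_on fL gL (fun r rb => is_derive_coord 0 (cD r rb))
  (fun r rb => is_derive_coord 1 (cD r rb)) (within_coord (i := 0) cC) (within_coord (i := 1) cC)
  F S (esym x0) (esym y0) tb.
by rewrite -[LHS]vec2_eta h1 h2.
Qed.

Lemma within_bounded (f : R -> R) (a b : R) : {within `[a, b], continuous f} ->
  exists2 K, 0 <= K & forall t, a <= t <= b -> `|f t| <= K.
Proof.
move=> fC; have := compact_bounded (continuous_compact fC (@segment_compact _ a b)).
move=> [M [_ HM]]; exists (`|M| + 1); first by rewrite addr_ge0.
move=> t tb; apply: HM; first by rewrite (le_lt_trans (ler_norm _))// ltrDl.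
by exists t => //=; rewrite in_itv.
Qed.

Lemma orbit_bounded (c : R -> 'rV[R]_2) (p : 'rV[R]_2) : {within `[0, +oo[, continuous c} ->
  c t @[t --> +oo] --> p -> exists2 K, 0 <= K & forall t, 0 <= t -> `|c t 0 0| <= K /\ `|c t 0 1| <= K.
Proof.
move=> cC cp.
have one i : exists2 K, 0 <= K & forall t, 0 <= t -> `|c t 0 i| <= K.
  have ci : c t 0 i @[t --> +oo] --> p 0 i by exact: cvg_coord.
  have /cvgrPdist_lt/(_ _ ltr01)/near_pinftyP[T T0 HT] := ci.
  have cT : {within `[0, T], continuous (fun t => c t 0 i)}.
    apply: within_coord; apply: continuous_subspaceW cC => t /=.
    by rewrite !in_itv /= => /andP[-> _].
  have [K K0 HK] := within_bounded cT.
  exists (K + `|p 0 i| + 1); first by rewrite !addr_ge0.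
  move=> t t0; have [tT|tT] := leP t T.
    have tb : 0 <= t <= T by rewrite t0.
    by have := HK t tb; have := normr_ge0 (p 0 i); clear; lra.
  have := HT t (ltW tT); have := ler_normB (p 0 i) (p 0 i - c t 0 i).
  have -> : p 0 i - (p 0 i - c t 0 i) = c t 0 i by ring.
  by move: K0; clear; lra.
have [K1 K10 H1] := one 0; have [K2 K20 H2] := one 1.
exists (K1 + K2); first exact: addr_ge0.
move=> t t0; have := H1 t t0; have := H2 t t0; move: K10 K20; clear; split; lra.
Qed.

(** Transversality gives the x-coordinate of the node a nonzero derivative [d0] at 0. Were it
    negative, the node would be an equilibrium in x < 1 for small eta > 0; hence d0 > 0, and the
    node lies at least d0 eta / 2 to the right of x = 1. *)
Lemma node_branch (XL : R -> 'rV[R]_2 -> 'rV[R]_2) (zL : R -> 'rV[R]_2) (yL : R) :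
  (\forall eta \near (0 : R), proper_stable_node (XL eta) (zL eta)) ->
  zL 0 = vec2 1 yL -> derivable zL 0 1 -> derive1 zL 0 0 0 != 0 ->
  (\forall eta \near (0 : R)^'+ & z \near vec2 1 yL, ~ (XL eta z = 0 /\ z 0 0 < 1)) ->
  exists r Kz kz, [/\ 0 < r, 0 <= Kz, 0 < kz & forall eta, 0 <= eta < r ->
    [/\ XL eta (zL eta) = 0, `|zL eta 0 0 - 1| <= Kz * eta, `|zL eta 0 1 - yL| <= Kz * eta &
      1 + kz * eta <= zL eta 0 0]].
Proof.
move=> node z0 zD zt noeq.
have zDi i : derivable (fun t => zL t 0 i) 0 1 by move/derivable_mxP : zD.
have dE i : derive1 zL 0 0 i = 'D_1 (fun t => zL t 0 i) 0.
  by rewrite derive1E (derive_mx zD) mxE.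
pose d0 : R := 'D_1 (fun t => zL t 0 0) 0; pose d1 : R := 'D_1 (fun t => zL t 0 1) 0.
have d00 : d0 != 0 by rewrite /d0 -dE.
have e0 : 0 < `|d0| / 2 by rewrite divr_gt0// normr_gt0.
have [ra ra0 Ha] := derivable_linear_bound (zDi 0) e0.
have [rb rb0 Hb] := derivable_linear_bound (zDi 1) ltr01.
have zC : zL eta @[eta --> 0^'+] --> vec2 1 yL.
  rewrite -z0; apply: cvg_at_right_filter.
  by apply/differentiable_continuous/derivable1_diffP.
have [rc rc0 Hc] : exists2 rc, 0 < rc & forall eta, `|eta| < rc -> XL eta (zL eta) = 0.
  have [rc /= rc0 H] := node; exists rc => // eta er.
  by have [] : proper_stable_node (XL eta) (zL eta) by apply: H; rewrite /= sub0r normrN.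
(* The exclusion holds on a whole neighbourhood of p^L, which contains the node for small eta by
   continuity. *)
have right_ : \forall eta \near (0:R)^'+, ~ (XL eta (zL eta) = 0 /\ zL eta 0 0 < 1).
  have [[A C] /= [FA FC] AC] := noeq.
  have FC' : \forall eta \near (0:R)^'+, C (zL eta) := zC _ FC.
  apply: filterS2 FA FC' => eta aA aC; exact: (AC (eta, zL eta)).
have [rd rd0 Hd] : exists2 rd, 0 < rd & forall eta, 0 < eta < rd -> ~ (XL eta (zL eta) = 0 /\ zL eta 0 0 < 1).
  have [rd /= rd0 H] := right_; exists rd => // eta /andP[et0 er].
  by apply: H => //=; rewrite sub0r normrN gtr0_norm.
have [r r0 /= /and5P[rra rrb rrc rrd _]] : exists2 r, 0 < r & all (fun z => r <= z) [:: ra; rb; rc; rd].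
  by apply: lt_bounds; apply/and5P.
have ge1 eta : 0 < eta < r -> 1 <= zL eta 0 0.
  move=> /andP[et0 er]; rewrite leNgt; apply/negP => lt1.
  apply: (Hd eta); first by rewrite et0 (lt_le_trans er).
  by split=> //; apply: Hc; rewrite gtr0_norm// (lt_le_trans er).
have dpos : 0 < d0.
  rewrite lt_neqAle eq_sym d00 /= leNgt; apply/negP => dn.
  have r2 : 0 < r / 2 < r by move: r0; clear; lra.
  have := ge1 _ r2; have := Ha (r / 2); have /andP[p _] := r2.
  rewrite (gtr0_norm p) z0 vec2_0 -/d0 (ltr0_norm dn) => /(_ _)h g.
  have : `|zL (r / 2) 0 0 - 1 - d0 * (r / 2)| <= - d0 / 2 * (r / 2).
    by apply: h; move: rra r0; clear; lra.
  have : d0 * (r / 2) < 0 by rewrite nmulr_rlt0.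
  by move: g; rewrite ler_norml; clear; lra.
exists r, (2 * `|d0| + `|d1| + 1), (d0 / 2); split=> //.
- by rewrite divr_gt0.
move=> eta /andP[et0 er].
have en : `|eta| = eta by rewrite ger0_norm.
have h0 := Ha eta; have h1 := Hb eta; rewrite en z0 vec2_0 -/d0 in h0.
rewrite en z0 vec2_1 -/d1 mul1r in h1.
have {}h0 := h0 (lt_le_trans er rra); have {}h1 := h1 (lt_le_trans er rrb).
rewrite (gtr0_norm dpos) in h0 *.
have n0 : 0 <= d0 * eta by rewrite mulr_ge0// ltW.
have n1 : 0 <= `|d1| * eta by rewrite mulr_ge0.
have n2 : `|d1 * eta| = `|d1| * eta by rewrite normrM en.
split.
- by apply: Hc; rewrite en (lt_le_trans er).
- by move: h0 n0 n1 et0; rewrite !ler_norml; clear; lra.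
- have := ler_normD (zL eta 0 1 - yL - d1 * eta) (d1 * eta); rewrite subrK n2.
  by move: h1 n0 n1 et0; clear; lra.
- by move: h0; rewrite ler_norml; clear; lra.
Qed.

Lemma hausdorff_lt (A C : set 'rV[R]_2) (d c : R) : d < c ->
  (forall a, A a -> exists2 b, C b & eucl_dist a b <= d) ->
  (forall b, C b -> exists2 a, A a & eucl_dist a b <= d) ->
  (hausdorff_dist A C < c%:E)%E.
Proof.
move=> dc AC CA; apply: (@le_lt_trans _ _ d%:E); last by rewrite lte_fin.
rewrite ge_max; apply/andP; split; apply: ge_ereal_sup => _ [p pA <-].
  have [b bC h] := AC p pA; apply: (@le_trans _ _ (eucl_dist p b)%:E); last by rewrite lee_fin.
  by apply: ereal_inf_lbound; exists b.
have [a aA h] := CA p pA; apply: (@le_trans _ _ (eucl_dist a p)%:E); last by rewrite lee_fin.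
by apply: ereal_inf_lbound; exists a.
Qed.

End assembly.

Section closing.
Context {R : realType}.
Implicit Types X XL XR : R -> 'rV[R]_2 -> 'rV[R]_2.

(** The node moves by at most 1 per coordinate and the shifts are at most r0 <= 1, so with
    [|yL| + 3 <= B] all points involved lie where the clamps are inactive. *)
Lemma clamped_node_family XL (zL : R -> 'rV[R]_2) (yL B Lc : R) :
  smooth (fun u : 'rV[R]_2 * R => XL u.2 u.1) -> `|yL| + 3 <= B ->
  (forall eta x y, 0 <= eta <= 1 ->
    `|clamped XL B 0 eta x y - clamped XL B 0 0 x y| <= Lc * eta /\
    `|clamped XL B 1 eta x y - clamped XL B 1 0 x y| <= Lc * eta) ->
  (\forall eta \near (0 : R), proper_stable_node (XL eta) (zL eta)) ->
  zL 0 = vec2 1 yL -> derivable zL 0 1 -> derive1 zL 0 0 0 != 0 ->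
  (\forall eta \near (0 : R)^'+ & z \near vec2 1 yL, ~ (XL eta z = 0 /\ z 0 0 < 1)) ->
  exists r0 C1 Kz kz, 0 < r0 <= 1 /\
    node_family (clamped XL B 0) (clamped XL B 1)
      (D1 (coordf XL 0) (pt 1 yL 0)) (D1 (coordf XL 1) (pt 1 yL 0))
      (D2 (coordf XL 0) (pt 1 yL 0)) (D2 (coordf XL 1) (pt 1 yL 0))
      yL r0 C1 Kz kz Lc (fun eta => zL eta 0 0) (fun eta => zL eta 0 1).
Proof.
move=> XS yB HLc node z0 zD zt noeq.
have [r [Kz [kz [r_0 Kz0 kz0 HN]]]] := node_branch node z0 zD zt noeq.
have yL0 := normr_ge0 yL.
have n1 : `|1 : R| = 1 by rewrite normr1.
have oneB : `|1 : R| <= B by rewrite n1; move: yL0 yB; clear; lra.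
have yLB : `|yL| <= B by move: yB; clear; lra.
have [C0 C00 lin0] := pt_lin (coordf_class 0 2 XS) oneB yLB.
have [C1 C10 lin1] := pt_lin (coordf_class 1 2 XS) oneB yLB.
have [S0 S00 sh0] := pt_shift B 1 yL (coordf_class 0 2 XS).
have [S1 S10 sh1] := pt_shift B 1 yL (coordf_class 1 2 XS).
have Kz1 : 0 < (Kz + 1)^-1 by rewrite invr_gt0 ltr_wpDl.
have [r0 r00 /= /and4P[r01 r0r r0K _]] :
    exists2 r0, 0 < r0 & all (fun z => r0 <= z) [:: 1; r / 2; (Kz + 1)^-1].
  by apply: lt_bounds; rewrite /= ltr01 divr_gt0// Kz1.
have Kr0 eta : 0 <= eta <= r0 -> Kz * eta <= 1.
  move=> /andP[et0 er]; have := le_trans er r0K.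
  rewrite -div1r ler_pdivlMr ?ltr_wpDl//; move: et0; clear; lra.
have node_at eta : 0 <= eta <= r0 -> [/\ XL eta (zL eta) = 0, `|zL eta 0 0 - 1| <= Kz * eta,
    `|zL eta 0 1 - yL| <= Kz * eta & 1 + kz * eta <= zL eta 0 0].
  move=> /andP[et0 er]; apply: HN; rewrite et0 /=; move: r_0 er r0r; clear; lra.
have X00 : XL 0 (vec2 1 yL) = 0.
  have z00 : (0:R) <= 0 <= r0 by rewrite lexx ltW.
  by have [e _ _ _] := node_at 0 z00; rewrite -z0.
have near1 u : `|u| <= r0 -> `|1 + u| <= B.
  by move=> ur; rewrite (le_trans (ler_normD _ _))// n1; move: ur r01 yL0 yB; clear; lra.
have neary u : `|u| <= r0 -> `|yL + u| <= B.
  by move=> ur; rewrite (le_trans (ler_normD _ _))//; move: ur r01 yL0 yB; clear; lra.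
have near1' x : `|x - 1| <= r0 -> `|x| <= B by move=> /near1; rewrite subrKC.
have neary' x : `|x - yL| <= r0 -> `|x| <= B by move=> /neary; rewrite subrKC.
have etaB eta : 0 <= eta <= r0 -> `|eta| <= B.
  by move=> /andP[e0 e1]; rewrite ger0_norm//; move: e1 r01 yL0 yB; clear; lra.
have zB eta u : 0 <= eta <= r0 -> `|u| <= r0 -> `|zL eta 0 0 + u| <= B /\ `|zL eta 0 1 + u| <= B.
  move=> er ur; have [_ h1 h2 _] := node_at _ er; have h := Kr0 _ er.
  have := ler_normD (zL eta 0 0 - 1) (1 + u); have := ler_normD (zL eta 0 1 - yL) (yL + u).
  have := ler_normD 1 u; have := ler_normD yL u; rewrite n1 !addrA !subrK.
  by move: h h1 h2 ur r01 yL0 yB; clear; split; lra.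
have zB0 eta : 0 <= eta <= r0 -> `|zL eta 0 0| <= B /\ `|zL eta 0 1| <= B.
  by move=> er; have := zB eta 0 er; rewrite !addr0 normr0; apply; exact: ltW.
have compE i eta x y : `|x| <= B -> `|y| <= B -> clamped XL B i eta x y = coordf XL i (pt x y eta).
  by move=> *; rewrite clamped_id.
have shift i S : (forall e zx zy u w, `|1 : R| <= B -> `|yL| <= B -> `|e| <= B ->
   `|zx| <= B -> `|zy| <= B -> `|zx + u| <= B -> `|zy + w| <= B -> `|1 + u| <= B -> `|yL + w| <= B ->
   `|coordf XL i (pt (zx + u) (zy + w) e) - coordf XL i (pt (1 + u) (yL + w) 0) -
     (coordf XL i (pt zx zy e) - coordf XL i (pt 1 yL 0))| <=
     S * (`|zx - 1| + `|zy - yL| + `|e|) * (`|u| + `|w|)) -> 0 <= S ->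
   forall eta u w, 0 <= eta <= r0 -> `|u| <= r0 -> `|w| <= r0 ->
   `|clamped XL B i eta (zL eta 0 0 + u) (zL eta 0 1 + w) - clamped XL B i 0 (1 + u) (yL + w)| <=
   S * (2 * Kz + 1) * eta * (`|u| + `|w|).
  move=> H S_0 eta u w er ur wr.
  have [zu _] := zB _ _ er ur; have [_ zw] := zB _ _ er wr; have [zz1 zz2] := zB0 _ er.
  have [e1 h1 h2 _] := node_at _ er; have /andP[et0 _] := er.
  have := H eta (zL eta 0 0) (zL eta 0 1) u w oneB yLB (etaB _ er) zz1 zz2 zu zw (near1 _ ur) (neary _ wr).
  have -> : coordf XL i (pt (zL eta 0 0) (zL eta 0 1) eta) = 0.
    by rewrite /coordf /= vec2_eta e1 mxE.
  have -> : coordf XL i (pt 1 yL 0) = 0 by rewrite /coordf /= X00 mxE.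
  rewrite !subr0 !compE//; last 2 first.
  - exact: near1.
  - exact: neary.
  move=> /le_trans; apply; rewrite ler_wpM2r ?addr_ge0// -mulrA ler_wpM2l// (ger0_norm et0).
  by move: h1 h2; clear; lra.
have lin i C : (forall r x y e x' y', 0 <= r -> `|x| <= B -> `|y| <= B -> `|e| <= B ->
   `|x'| <= B -> `|y'| <= B -> `|x - 1| <= r -> `|y - yL| <= r -> `|e| <= r ->
   `|x' - 1| <= r -> `|y' - yL| <= r ->
   `|coordf XL i (pt x y e) - coordf XL i (pt x' y' e) -
     (D1 (coordf XL i) (pt 1 yL 0) * (x - x') + D2 (coordf XL i) (pt 1 yL 0) * (y - y'))| <=
     C * r * (`|x - x'| + `|y - y'|)) ->
   forall r eta x y x' y', 0 <= eta <= r -> r <= r0 ->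
    `|x - 1| <= r -> `|y - yL| <= r -> `|x' - 1| <= r -> `|y' - yL| <= r ->
    `|clamped XL B i eta x y - clamped XL B i eta x' y' -
      (D1 (coordf XL i) (pt 1 yL 0) * (x - x') + D2 (coordf XL i) (pt 1 yL 0) * (y - y'))| <=
      C * r * (`|x - x'| + `|y - y'|).
  move=> H s eta x y x' y' /andP[et0 es] sr x1 y1 x1' y1'.
  have xB := near1' _ (le_trans x1 sr); have xB' := near1' _ (le_trans x1' sr).
  have yB1 := neary' _ (le_trans y1 sr); have yB1' := neary' _ (le_trans y1' sr).
  have er : 0 <= eta <= r0 by rewrite et0 (le_trans es).
  rewrite !compE//; apply: H => //; last by rewrite ger0_norm.
  - exact: le_trans et0 es.
  - exact: etaB.
pose C := C0 + C1 + (S0 + S1) * (2 * Kz + 1).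
have Kz2 : 0 <= 2 * Kz + 1 by rewrite addr_ge0// mulr_ge0.
have SK0 := mulr_ge0 S00 Kz2; have SK1 := mulr_ge0 S10 Kz2.
have [c0 c1 c2 c3] : [/\ C0 <= C, C1 <= C, S0 * (2 * Kz + 1) <= C & S1 * (2 * Kz + 1) <= C].
  by rewrite /C mulrDl; move: C00 C10 SK0 SK1; clear; split; lra.
have up (k r' n : R) : k <= C -> 0 <= r' -> 0 <= n -> k * r' * n <= C * r' * n.
  by move=> kC r'0 n0; rewrite !ler_wpM2r.
exists r0, C, Kz, kz; split; first by rewrite r00.
split=> //.
- exact: le_trans c0.
- by move=> eta x y /andP[et0 er]; apply: HLc; rewrite et0 (le_trans er).
- move=> s eta x y x' y' es sr x1 y1 x1' y1'.
  have s0 : 0 <= s by have /andP[a b] := es; exact: le_trans b.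
  have n0 : 0 <= `|x - x'| + `|y - y'| by rewrite addr_ge0.
  by split; [apply: le_trans (up C0 s _ c0 s0 n0); apply: lin|
             apply: le_trans (up C1 s _ c1 s0 n0); apply: lin].
- move=> eta er; have [e1 h1 h2 h3] := node_at _ er; have [b1 b2] := zB0 _ er.
  by rewrite !clamped_id// vec2_eta e1 !mxE.
- move=> eta u w er ur wr; have /andP[et0 _] := er.
  have n0 : 0 <= `|u| + `|w| by rewrite addr_ge0.
  by split; [apply: le_trans (up _ _ _ c2 et0 n0); apply: shift|
             apply: le_trans (up _ _ _ c3 et0 n0); apply: shift].
Qed.

End closing.

(** * From the singular cycle to the limit cycle *)

Section singular_cycle.
Context {R : realType}.
Implicit Types XL XR : R -> 'rV[R]_2 -> 'rV[R]_2.

Lemma regularization_blend XL XR (phi : R -> R) (B eta eps : R) (p : 'rV[R]_2) :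
  `|p 0 0| < B -> `|p 0 1| < B ->
  regularization phi (XL eta) (XR eta) eps p =
  let psi x := phi (eps^-1 * (clamp 0 B x - 1)) in
  vec2 (blend (clamped XL B 0 eta) (clamped XR B 0 eta) psi (p 0 0) (p 0 1))
       (blend (clamped XL B 1 eta) (clamped XR B 1 eta) psi (p 0 0) (p 0 1)).
Proof.
move=> /ltW p0 /ltW p1 /=.
by apply: row2_eq; rewrite ?vec2_0 ?vec2_1 /regularization /blend !clamped_id// vec2_eta
  clamp_id ?subr0// !mxE; ring.
Qed.

Lemma weak_data XL (yL : R) (c : R -> 'rV[R]_2) :
  smooth (fun u : 'rV[R]_2 * R => XL u.2 u.1) ->
  proper_stable_node (XL 0) (vec2 1 yL) ->
  (forall l, weak_eigenvalue (XL 0) (vec2 1 yL) l ->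
     ~~ (eigenspace (jacobian (XL 0) (vec2 1 yL)) l == vec2 0 1)%MS) ->
  (forall t, 0 < t -> c t 0 0 < 1) ->
  approaches_along_weak_direction (XL 0) (vec2 1 yL) c ->
  let a11 := D1 (coordf XL 0) (pt 1 yL 0) in let a12 := D1 (coordf XL 1) (pt 1 yL 0) in
  let a21 := D2 (coordf XL 0) (pt 1 yL 0) in let a22 := D2 (coordf XL 1) (pt 1 yL 0) in
  exists l1 l2 lam mm,
  [/\ [/\ l1 < l2, l2 < 0 & lam < 0], a11 + a22 = l1 + l2, a11 * a22 - a12 * a21 = l1 * l2,
    a11 + a21 * mm = lam /\ a12 + a22 * mm = lam * mm &
    forall e, 0 < e -> exists2 T, 0 <= T & forall t, T <= t ->
    1 - c t 0 0 <= e /\ `|c t 0 1 - yL - mm * (c t 0 0 - 1)| <= e * (1 - c t 0 0)].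
Proof.
move=> XS [_ [l1 [l2 [l12 l20 E1 E2]]]] nonpar cl [cp cne [l [v [wl v0 vE cv]]]] a11 a12 a21 a22.
have JE0 (w : 'rV[R]_2) := jacobian_coord 1 yL w 0 XS.
have JE1 (w : 'rV[R]_2) := jacobian_coord 1 yL w 1 XS.
have [tr det] := eigen_trace_det JE0 JE1 l12 E1 E2.
have lneg : l < 0.
  have [|->|->] := eigen_two JE0 JE1 l12 E1 E2 (l := l) => //; first by have [] := wl.
  exact: lt_trans l12 l20.
have vJ : v *m jacobian (XL 0) (vec2 1 yL) = l *: v by exact/eigenspaceP.
have v00 : v 0 0 != 0.
  apply/eqP => h; move: (nonpar l wl).
  by rewrite (vertical_eigenvector JE0 JE1 l12 E1 E2 v0 vJ h).
have [e0 e1] := eigen_coord JE0 JE1 vJ.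
exists l1, l2, l, (v 0 1 / v 0 0); split=> //.
  split.
    apply: (mulfI v00); rewrite [RHS]mulrC -e0 /a11 /a21; by field.
  apply: (mulfI v00).
  have -> : v 0 0 * (l * (v 0 1 / v 0 0)) = l * v 0 1 by field.
  by rewrite -e1 /a12 /a22; field.
exact: weak_direction.
Qed.

(** Otherwise x would exceed 1 shortly after time 0. Strictness at q^R comes later, from the
    crossing condition. *)
Lemma enters_left (f g : R -> R -> R) (x y : R -> R) (yq : R) :
  is_sol f g x y -> x 0 = 1 -> y 0 = yq -> (forall t, 0 < t -> x t < 1) -> f 1 yq <= 0.
Proof.
move=> S x0 y0 xl; rewrite leNgt; apply/negP => f0.
have [[xD xE] _] := S 0; rewrite x0 y0 in xE.
have h0 : 0 < f 1 yq / 2 by rewrite divr_gt0.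
have [r r0 H] := derivable_linear_bound xD h0.
have r2 : 0 < r / 2 by rewrite divr_gt0.
have := H (r / 2); rewrite xE x0 (gtr0_norm r2) => /(_ _)h.
have {h} : `|x (r / 2) - 1 - f 1 yq * (r / 2)| <= f 1 yq / 2 * (r / 2).
  by apply: h; move: r0; clear; lra.
have := xl _ r2; have := mulr_gt0 f0 r2; rewrite ler_norml; clear; lra.
Qed.

(** Gamma_0 lies in the box of size B - 2 and [kap <= 1], so the cycle lies in the box of size B -
    1, with a margin in the box of size B. Closeness [kap] in each coordinate gives Euclidean
    distance at most 2 kap. *)
Lemma follows_cycle XL XR (phi : R -> R) (B r0 Lc M eta eps delta sigma yL w Tm TM kap TR d : R)
    (P tau xr yr xl yl : R -> R) :
  crossing_fields (clamped XL B 0) (clamped XL B 1) (clamped XR B 0) (clamped XR B 1) Lc M r0 ->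
  0 <= eta <= r0 -> 0 < kap <= 1 -> 2 * kap < d ->
  (forall r, 0 <= r <= TR -> `|xr r| <= B - 2 /\ `|yr r| <= B - 2) ->
  (forall r, 0 <= r -> `|xl r| <= B - 2 /\ `|yl r| <= B - 2) ->
  let psi := fun x => phi (eps^-1 * (clamp 0 B x - 1)) in
  gate delta sigma psi ->
  let F1 := blend (clamped XL B 0 eta) (clamped XR B 0 eta) psi in
  let F2 := blend (clamped XL B 1 eta) (clamped XR B 1 eta) psi in
  return_map F1 F2 (1 + delta) yL w Tm TM P tau ->
  (forall x y : R -> R, is_sol F1 F2 x y -> x 0 = 1 + delta -> `|y 0 - yL| <= w ->
    follows kap TR xr yr xl yl x y (tau (y 0))) ->
  exists G : set 'rV[R]_2, let X := regularization phi (XL eta) (XR eta) eps in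
  [/\ limit_cycle X G, attracting X G &
    (hausdorff_dist G (curve xl yl @` `[0%R, +oo[%classic `|` curve xr yr @` `[0%R, TR]%classic)%classic < d%:E)%E].
Proof.
move=> CF er /andP[kap0 kap1] kd rB lB psi GT F1 F2 RM FO.
have [_ _ FL FM _] := CF; have [L1L L2L R1L R2L] := FL _ er.
have [k k0 psiL] := gate_lip GT; have psi01 := gate01 GT.
have F1L : lip (Lc + (2 * Lc * 1 + 2 * M * k)) F1.
  by apply: blend_lip => // x y; have [] := FM _ er x y.
have F2L : lip (Lc + (2 * Lc * 1 + 2 * M * k)) F2.
  by apply: blend_lip => // x y; have [] := FM _ er x y.
pose X := regularization phi (XL eta) (XR eta) eps.
have XE (p : 'rV[R]_2) : `|p 0 0| < B -> `|p 0 1| < B ->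
    X p = vec2 (F1 (p 0 0) (p 0 1)) (F2 (p 0 0) (p 0 1)).
  by move=> p0 p1; rewrite /X (regularization_blend _ _ _ _ _ p0 p1).
have BB : B - 1 < B by rewrite gtrBl.
have near_ (a b : R) : `|a - b| <= kap -> `|b| <= B - 2 -> `|a| <= B - 1.
  by move=> h1 h2; have := ler_normD (a - b) b; rewrite subrK; move: kap1 h1 h2; clear; lra.
have tube (x y : R -> R) : is_sol F1 F2 x y -> x 0 = 1 + delta -> `|y 0 - yL| <= w ->
    forall t, 0 <= t <= tau (y 0) -> `|x t| <= B - 1 /\ `|y t| <= B - 1.
  move=> S x0 y0 t tb; have [H _ _] := FO x y S x0 y0.
  have [[r rb [h1 h2]]|[r rb [h1 h2]]] := H t tb.
    by have [b1 b2] := rB r rb; split; [exact: near_ h1 b1|exact: near_ h2 b2].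
  by have [b1 b2] := lB r rb; split; [exact: near_ h1 b1|exact: near_ h2 b2].
have [x [y [S x0 y0 red [LC AT]]]] := attracting_limit_cycle XE BB F1L F2L RM tube.
exists (range (curve x y)); split=> //.
have cl (u v : R -> R) t r : close_to kap x y t u v r -> eucl_dist (curve x y t) (curve u v r) <= 2 * kap.
  move=> [h1 h2]; rewrite (le_trans (eucl_dist_le _ _))// !vec2_0 !vec2_1.
  by move: h1 h2; clear; lra.
have [H1 H2 H3] := FO x y S x0 y0.
apply: hausdorff_lt kd _ _.
- move=> _ [t _ <-]; have [t' [t0 t1 xt yt]] := red t.
  have -> : curve x y t = curve x y t' by rewrite /curve xt yt.
  have tb : 0 <= t' <= tau (y 0) by rewrite t0.
  have [[r rb /cl h]|[r rb /cl h]] := H1 t' tb.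
    by exists (curve xr yr r) => //; right; exists r => //=; rewrite in_itv.
  by exists (curve xl yl r) => //; left; exists r => //=; rewrite in_itv /= andbT.
- move=> _ [[r rb <-]|[r rb <-]]; rewrite /= in_itv /= ?andbT in rb.
    by have [t _ /cl h] := H3 r rb; exists (curve x y t) => //; exists t.
  by have [t _ /cl h] := H2 r rb; exists (curve x y t) => //; exists t.
Qed.

End singular_cycle.

Unset Implicit Arguments.

Theorem theorem2 (R : realType)
  (XL XR : R -> 'rV[R]_2 -> 'rV[R]_2) (phi : R -> R)
  (zL : R -> 'rV[R]_2) (yL : R)
  (TR : R) (cR : R -> 'rV[R]_2) (qR : 'rV[R]_2) (cL : R -> 'rV[R]_2)
  (XL_smooth : smooth (fun u : 'rV[R]_2 * R => XL u.2 u.1))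
  (XR_smooth : smooth (fun u : 'rV[R]_2 * R => XR u.2 u.1))
  (phi_sigmoidal : sigmoidal phi)
  (* (i) *)
  (zL_node : \forall eta \near (0 : R), proper_stable_node (XL eta) (zL eta))
  (zL_0 : zL 0 = vec2 1 yL)
  (zL_derivable : derivable zL 0 1)
  (zL_transversal : derive1 zL 0 0 0 != 0)
  (no_equilibria : \forall eta \near (0 : R)^'+ & z \near vec2 1 yL,
     ~ (XL eta z = 0 /\ z 0 0 < 1))
  (* (ii) *)
  (weak_not_parallel : forall l, weak_eigenvalue (XL 0) (vec2 1 yL) l ->
     ~~ (eigenspace (jacobian (XL 0) (vec2 1 yL)) l == vec2 0 1)%MS)
  (* (iii) *)
  (XR1_pos : 0 < XR 0 (vec2 1 yL) 0 0)
  (dyXL1_pos : 0 < derive1 (fun y : R => XL 0 (vec2 1 y) 0 0) yL)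
  (sliding_0 : sliding (XL 0) (XR 0) yL = 0)
  (sliding_away : 0 < derive1 (sliding (XL 0) (XR 0)) yL)
  (* (iv) *)
  (TR_pos : 0 < TR)
  (cR_solution : solution_on (XR 0) `[0, TR] cR)
  (cR_start : cR 0 = vec2 1 yL)
  (cR_right : forall t, 0 < t < TR -> 1 < cR t 0 0)
  (cR_return : cR TR = qR)
  (qR_crossing : crossing_point (XL 0) (XR 0) qR)
  (* (v) *)
  (cL_solution : solution_on (XL 0) `[0, +oo[ cL)
  (cL_start : cL 0 = qR)
  (cL_left : forall t, 0 < t -> cL t 0 0 < 1)
  (cL_weak : approaches_along_weak_direction (XL 0) (vec2 1 yL) cL) :
  let Gamma0 := cL @` `[0, +oo[ `|` cR @` `[0, TR] in
  forall c : R, 0 < c ->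
  exists2 eta_max : R, 0 < eta_max &
  forall eta0 : R, 0 < eta0 <= eta_max ->
  exists a b : R, [/\ 0 < a, a < b, b <= eta0 &
  exists2 eps0 : R, 0 < eps0 &
  forall eps eta : R, 0 < eps <= eps0 -> a <= eta <= b ->
  exists Gamma : set 'rV[R]_2,
    let X := regularization phi (XL eta) (XR eta) eps in
    [/\ limit_cycle X Gamma, attracting X Gamma &
        (hausdorff_dist Gamma Gamma0 < c%:E)%E]].
Proof.
move=> Gamma0 c c0.
have [cRC cRD] := cR_solution; have [cLC cLD] := cL_solution.
have [cLcv cLne cLdir] := cL_weak.
have cRD' (t : R) : 0 < t < TR -> is_derive t (1:R) cR (XR 0 (cR t)).
  by move=> tT; apply: cRD; rewrite interior_itv /= in_itv.
have cLD' (t : R) : 0 < t -> is_derive t (1:R) cL (XL 0 (cL t)).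
  by move=> tT; apply: cLD; rewrite interior_itv /= in_itv /= andbT.
have [q0 q1] := qR_crossing; set yq := qR 0 1.
have qE : vec2 1 yq = qR by rewrite -(vec2_eta qR) q0.
have [KR0 KR00 HR0] := within_bounded (within_coord (i := 0) cRC).
have [KR1 KR10 HR1] := within_bounded (within_coord (i := 1) cRC).
have [KL KL0 HL] := orbit_bounded cLC cLcv.
(* Contains both arcs of Gamma_0 with margin 2, and the neighbourhood of p^L used in
   [clamped_node_family]. *)
pose B := KR0 + KR1 + KL + `|yL| + 4.
have yL0 := normr_ge0 yL.
have [B1 B2 B3] : [/\ 1 <= B, 2 <= B & `|yL| + 3 <= B].
  by rewrite /B; move: KR00 KR10 KL0 yL0; clear; split; lra.
have RB t : 0 <= t <= TR -> `|cR t 0 0| <= B - 2 /\ `|cR t 0 1| <= B - 2.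
  move=> tT; have := HR0 t tT; have := HR1 t tT; rewrite /B.
  by move: KR00 KR10 KL0 yL0; clear; split; lra.
have LB t : 0 <= t -> `|cL t 0 0| <= B - 2 /\ `|cL t 0 1| <= B - 2.
  move=> tT; have [] := HL t tT; rewrite /B.
  by move: KR00 KR10 KL0 yL0; clear; split; lra.
have leB (z : R) : `|z| <= B - 2 -> `|z| <= B by clear; lra.
have [Lc [M CF]] := clamped_crossing_fields B1 XL_smooth XR_smooth.
have z01 : 0 < (1:R) <= 1 by rewrite ltr01 lexx.
have z00 : 0 <= (0:R) <= 1 by rewrite lexx ler01.
have [_ _ FL FM FE] := CF 1 z01.
have [L1L L2L R1L R2L] := FL 0 z00.
have HLc (eta x y : R) : 0 <= eta <= 1 ->
    `|clamped XL B 0 eta x y - clamped XL B 0 0 x y| <= Lc * eta /\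
    `|clamped XL B 1 eta x y - clamped XL B 1 0 x y| <= Lc * eta.
  by move=> /FE/(_ x y)[].
have [r0 [C1 [Kz [kz [r01 NF]]]]] := clamped_node_family XL_smooth B3 HLc zL_node zL_0
  zL_derivable zL_transversal no_equilibria.
have node0 : proper_stable_node (XL 0) (vec2 1 yL) by rewrite -zL_0; exact: nbhs_singleton zL_node.
have [l1 [l2 [lam [mm [[l12 l20 lam0] tr det [ev1 ev2] conv]]]]] :=
  weak_data XL_smooth node0 weak_not_parallel cL_left cL_weak.
have [xl [yl [xl0 yl0 Sl]]] := flow_exists 1 yq L1L L2L.
have [xr [yr [xr0 yr0 Sr]]] := flow_exists 1 yL R1L R2L.
have cRE t : 0 <= t <= TR -> cR t = curve xr yr t.
  apply: (solution_is_flow R1L R2L cRC cRD' _ Sr).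
  - by move=> s /RB[h1 h2]; split; exact: leB.
  - by rewrite xr0 cR_start vec2_0.
  - by rewrite yr0 cR_start vec2_1.
have cLE t : 0 <= t -> cL t = curve xl yl t.
  move=> t0.
  have cLC' : {within `[0, t], continuous cL}.
    by apply: continuous_subspaceW cLC => s /=; rewrite !in_itv /= => /andP[-> _].
  apply: (solution_is_flow L1L L2L cLC' _ _ Sl).
  - by move=> s /andP[/cLD'].
  - by move=> s /andP[/LB[h1 h2] _]; split; exact: leB.
  - by rewrite xl0 cL_start q0.
  - by rewrite yl0 cL_start.
  - by rewrite t0 lexx.
have xlE t : 0 <= t -> xl t = cL t 0 0 by move=> /cLE ->; rewrite vec2_0.
have ylE t : 0 <= t -> yl t = cL t 0 1 by move=> /cLE ->; rewrite vec2_1.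
have xrE t : 0 <= t <= TR -> xr t = cR t 0 0 by move=> /cRE ->; rewrite vec2_0.
have yrE t : 0 <= t <= TR -> yr t = cR t 0 1 by move=> /cRE ->; rewrite vec2_1.
have TT : 0 <= TR <= TR by rewrite ltW//=.
have xrT : xr TR = 1 by rewrite xrE// cR_return q0.
have yrT : yr TR = yq by rewrite yrE// cR_return.
have xl_left t : 0 < t -> xl t < 1 by move=> t0; rewrite xlE ?ltW// cL_left.
have xr_right t : 0 < t < TR -> 1 < xr t.
  by move=> tT; rewrite xrE ?cR_right//; have /andP[a b] := tT; rewrite !ltW.
have oneB : `|1 : R| <= B by rewrite normr1.
have yqB : `|yq| <= B by rewrite /yq -cL_start; have [_ h] := LB 0 (lexx 0); exact: leB.
have yLB : `|yL| <= B by move: B3; clear; lra.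
(* The sign is negative because the orbit enters x < 1; it is strict, and shared by [XR], because
   q^R is a crossing point. *)
have L1q : clamped XL B 0 0 1 yq < 0 /\ clamped XR B 0 0 1 yq < 0.
  have := enters_left Sl xl0 yl0 xl_left; rewrite !clamped_id// qE => h.
  have hn : XL 0 qR 0 0 < 0.
    by rewrite lt_neqAle h andbT; apply: contraTneq q1 => ->; rewrite mul0r ltxx.
  by split=> //; rewrite -(nmulr_rgt0 _ hn).
have R1p : 0 < clamped XR B 0 0 1 yL by rewrite clamped_id.
have conv' e : 0 < e -> exists2 T, 0 <= T & forall t, T <= t ->
    1 - xl t <= e /\ `|yl t - yL - mm * (xl t - 1)| <= e * (1 - xl t).
  move=> /conv[T T0 HT]; exists T => // t Tt.
  by rewrite xlE ?ylE ?(le_trans T0)//; exact: HT.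
pose kap := Num.min 1 (c / 4).
have kap0 : 0 < kap by rewrite lt_min ltr01 divr_gt0.
have kap1 : 0 < kap <= 1 by rewrite kap0 ge_min lexx.
have kapc : 2 * kap < c.
  have : kap <= c / 4 by rewrite ge_min lexx orbT.
  by move: c0; clear; lra.
have [L1q0 R1q0] := L1q.
have [eta1 eta10 core] := core_loop (CF r0 r01) NF l12 l20 tr det lam0 ev1 ev2 Sl xl0 yl0 xl_left
  conv' Sr TR_pos xr0 yr0 xrT yrT xr_right R1p R1q0 L1q0 kap0.
have GE : Gamma0 = curve xl yl @` `[0, +oo[ `|` curve xr yr @` `[0, TR].
  congr (_ `|` _); apply: eq_imagel => t /=; rewrite in_itv /= ?andbT.
    exact: cLE.
  exact: cRE.
have /andP[r00 _] := r01.
exists (Num.min eta1 r0); first by rewrite lt_min eta10.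
move=> eta0; rewrite le_min => /and3P[e0 e1 er].
have a0 : 0 < eta0 / 2 by rewrite divr_gt0.
have a1 : 0 < eta0 / 2 <= eta1 by rewrite a0 /=; move: e1 e0; clear; lra.
have [delta [sigma [d0 s0 loop]]] := core _ a1.
exists (eta0 / 2), eta0; split=> //; first by move: e0; clear; lra.
(* [eps0] is determined by [delta] and [sigma], chosen for the whole interval, and so does not
   depend on [eta]. *)
have [eps0 eps00 HG] := gate_of_sigmoidal phi_sigmoidal B2 d0 s0.
exists eps0 => // eps eta /HG G /andP[ea eb].
have et : eta0 / 2 <= eta <= eta1 by rewrite ea (le_trans eb).
have [w [Tm [TM [P [tau [RM FO]]]]]] := loop _ _ et G.
have etr : 0 <= eta <= r0 by rewrite (le_trans (ltW a0))//= (le_trans eb).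
rewrite GE; apply: (follows_cycle (CF r0 r01) etr kap1 kapc _ _ G RM FO).
- by move=> r /[dup] rb /RB; rewrite -xrE// -yrE.
- by move=> r /[dup] rb /LB; rewrite -xlE// -ylE.
Qed.
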